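(* Let $\mathcal{D}$ be a unitary multifusion category. The weak Hopf algebra $\mathbf{Tube}({}_{\mathcal{D}}\mathcal{D}_{\mathcal{D}})$ (structure recalled in the context) is a $C^*$ weak Hopf algebra, with $*$-operation the antilinear extension of $$(v\otimes w)^*=\frac{d_e}{d_c}\;(v^\dagger)^\flat\otimes(w^\dagger)^\sharp$$ for $v\in\mathrm{Hom}(c,a\otimes e\otimes b)$, $w\in\mathrm{Hom}(a\otimes f\otimes b,h)$, where $(v^\dagger)^\flat\in\mathrm{Hom}(e,\bar a\otimes c\otimes\bar b)$ and $(w^\dagger)^\sharp\in\mathrm{Hom}(\bar a\otimes h\otimes\bar b,f)$ are obtained from $v^\dagger$ and $w^\dagger$ by bending the $a$- and $b$-legs.
   Context: A unitary multifusion category (UMFC) $\mathcal{D}$ is a finite semisimple $\mathbb{C}$-linear rigid monoidal category with compatible unitary dagger structure; $\mathbf{1}=\bigoplus_{i\in I}\mathbf{1}_i$ with $\mathbf{1}_i$ simple, $\mathcal{D}=\bigoplus\mathcal{D}_{i,j}$, $\mathcal{D}_{i,j}=\mathbf{1}_i\otimes\mathcal{D}\otimes\mathbf{1}_j$. $\mathrm{Irr}(\mathcal{D})$ is a set of representatives of simple objects, containing all $\mathbf{1}_i$. Associators are suppressed. $\mathcal{D}$ carries a spherical structure: for simple $x\in\mathcal{D}_{i,j}$ with dual $\bar x$ there are $\mathrm{coev}_x:\mathbf{1}\to x\otimes\bar x$, $\mathrm{ev}_x:\bar x\otimes x\to\mathbf{1}$ satisfying the zig-zag equations, the other pair of duality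 maps is $\mathrm{ev}_x^\dagger,\mathrm{coev}_x^\dagger$, and $\mathrm{coev}_x^\dagger\mathrm{coev}_x=d_x\mathrm{id}_{\mathbf{1}_i}$, $\mathrm{ev}_x\mathrm{ev}_x^\dagger=d_x\mathrm{id}_{\mathbf{1}_j}$ (on the relevant summands of $\mathbf{1}$) with the same number $d_x>0$; diagrams are invariant under planar isotopy. Tube space: $\mathbf{Tube}({}_{\mathcal{D}}\mathcal{D}_{\mathcal{D}})=\bigoplus_{a,b,c,e,f,h\in\mathrm{Irr}(\mathcal{D})}\mathrm{Hom}(c,a\otimes e\otimes b)\otimes\mathrm{Hom}(a\otimes f\otimes b,h)$. For arbitrary objects $A,B$ and $v\in\mathrm{Hom}(c,A\otimes e\otimes B)$, $w\in\mathrm{Hom}(A\otimes f\otimes B,h)$, put $\langle\!\langle v,w\rangle\!\rangle=\sum_{k,s\in\mathrm{Irr}(\mathcal{D})}\sum_{p,q}((p^*\otimes\mathrm{id}_e\otimes q^* )v)\otimes(w(p\otimes\mathrm{id}_f\otimes q))$, with $p$ over a basis of $\mathrm{Hom}(k,A)$, $p^*$ the dual basis of $\mathrm{Hom}(A,k)$ ($p^*p'=\delta_{p,p'}\mathrm{id}_k$), and $q,q^*$ likewise for $s,B$. Multiplication: $(v\otimes w)(v'\otimes w')=\delta_{f,h'}\delta_{e,c'}\langle\!\langle(\mathrm{id}_a\otimes v'\otimes\mathrm{id}_b)v,\;w(\mathrm{id}_a\otimes w'\otimes\mathrm{id}_b)\rangle\!\rangle$, with $A=a\otimes a'$, $B=b'\otimes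 b$. Unit: $1=\sum_{x,y}\mathrm{id}_y\otimes\mathrm{id}_x$ over pairs of simples in the same $\mathcal{D}_{i,j}$, the summand having $a=\mathbf{1}_i$, $b=\mathbf{1}_j$, $c=e=y$, $f=h=x$. Counit: $\varepsilon(v\otimes w)=0$ unless $e=f$, $c=h$, and then $\varepsilon(v\otimes w)\mathrm{id}_h=w\circ v$. Comultiplication: $\Delta(v\otimes w)=\sum_{i,k}\sum_p(v_p\otimes w)\otimes(v\otimes w_p)$, with $v_p$ a basis of $\mathrm{Hom}(k,a\otimes i\otimes b)$ and $w_p$ the dual basis of $\mathrm{Hom}(a\otimes i\otimes b,k)$, $w_pv_q=\delta_{p,q}\mathrm{id}_k$. Antipode: $S(v\otimes w)=\frac{d_f}{d_h}w^\flat\otimes v^\sharp$. Bending: for $u\in\mathrm{Hom}(a\otimes x\otimes b,y)$ put $u^\flat=(\mathrm{id}_{\bar a}\otimes u\otimes\mathrm{id}_{\bar b})(\mathrm{ev}_a^\dagger\otimes\mathrm{id}_x\otimes\mathrm{coev}_b)\in\mathrm{Hom}(x,\bar a\otimes y\otimes\bar b)$; for $u\in\mathrm{Hom}(y,a\otimes x\otimes b)$ put $u^\sharp=(\mathrm{ev}_a\otimes\mathrm{id}_x\otimes\mathrm{coev}_b^\dagger)(\mathrm{id}_{\bar a}\otimes u\otimes\mathrm{id}_{\bar b})\in\mathrm{Hom}(\bar a\otimes y\otimes\bar b,x)$. A weak Hopf algebra (Böhm–Nill–Szlachányi) is an algebra and coalgebra with $\Delta$ multiplicative, $(\Delta\otimes\mathrm{id})\Delta(1)=(\Delta(1)\otimes1)(1\otimes\Delta(1))=(1\otimes\Delta(1))(\Delta(1)\otimes1)$,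 $\varepsilon(xyz)=\sum\varepsilon(xy^{(1)})\varepsilon(y^{(2)}z)=\sum\varepsilon(xy^{(2)})\varepsilon(y^{(1)}z)$, and antipode $S$ with $\sum x^{(1)}S(x^{(2)})=\sum\varepsilon(1^{(1)}x)1^{(2)}$, $\sum S(x^{(1)})x^{(2)}=\sum1^{(1)}\varepsilon(x1^{(2)})$, $\sum S(x^{(1)})x^{(2)}S(x^{(3)})=S(x)$. A $*$-weak Hopf algebra has in addition an antilinear involution $*$ with $(xy)^*=y^*x^*$ and $\Delta(x)^*=\Delta(x^* )$ (with $(x\otimes y)^*=x^*\otimes y^*$). It is a $C^*$ weak Hopf algebra if it has a faithful $*$-representation on a Hilbert space. *)

(* Defs.v *)
(* The complex numbers are R[i] for an arbitrary R : realType. *)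
From HB Require Import structures.
From mathcomp Require Import all_boot all_order all_algebra.
From mathcomp Require Import boolp reals.
From mathcomp Require Import complex.

Set Implicit Arguments.
Unset Strict Implicit.
Unset Printing Implicit Defensive.

Import Order.TTheory GRing.Theory Num.Theory.
Local Open Scope ring_scope.

Reserved Notation "g ∘ f" (at level 40, left associativity).
Reserved Notation "f ^†" (at level 1, left associativity, format "f ^†").
Reserved Notation "x ⊗ y" (at level 35, right associativity).
Reserved Notation "f ⊗m g" (at level 35, right associativity).

Section LinearAlgebra.
Variable C : fieldType.
Implicit Types U V W : vectType C.

Definition vbas V : (\dim {:V}).-tuple V := vbasis {:V}.

(* The tensor product in coordinates with respect to [vbas V] and [vbas W]. *)
Definition tensor V W : vectType C := 'M[C]_(\dim {:V}, \dim {:W}).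

Definition tpure V W (v : V) (w : W) : tensor V W :=
  \matrix_(i, j) (coord (vbas V) i v * coord (vbas W) j w).

(* The extension of [b] from basis tensors, linear if [s] is the identity and
   antilinear if [s] is the complex conjugation. *)
Definition tlift_for (s : C -> C) V W (U : lmodType C) (b : V -> W -> U)
    (t : tensor V W) : U :=
  \sum_(i < \dim {:V}) \sum_(j < \dim {:W})
    s ((t : 'M[C]_(_, _)) i j) *: b (vbas V)`_i (vbas W)`_j.

Definition tlift V W (U : lmodType C) (b : V -> W -> U) : tensor V W -> U :=
  tlift_for id b.

Definition tmap V V' W W' (f : V -> V') (g : W -> W') :
    tensor V W -> tensor V' W' :=
  tlift (fun v w => tpure (f v) (g w)).

Definition tassoc U V W (t : tensor (tensor U V) W) : tensor U (tensor V W) :=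
  tlift (fun uv w => tlift (fun u v => tpure u (tpure v w)) uv) t.

(* (v ⊗ w)(v' ⊗ w') = mV v v' ⊗ mW w w'. *)
Definition tmul V W (mV : V -> V -> V) (mW : W -> W -> W)
    (t t' : tensor V W) : tensor V W :=
  tlift (fun v w => tlift (fun v' w' => tpure (mV v v') (mW w w')) t') t.

(* The direct sum of the [V i], in coordinates with respect to the [vbas (V i)]. *)
Definition dsum (I : finType) (V : I -> vectType C) : vectType C :=
  {ffun {i : I & 'I_(\dim {:V i})} -> C^o}.

Definition dinj (I : finType) (V : I -> vectType C) (i : I) (v : V i) : dsum V :=
  [ffun s => untag (0 : C^o) (fun k => coord (vbas (V i)) k v) s].

Definition dlift_for (s : C -> C) (I : finType) (V : I -> vectType C)
    (U : lmodType C) (F : forall i, V i -> U) (x : dsum V) : U :=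
  \sum_k s ((x : {ffun _ -> _}) k) *: F (tag k) (vbas (V (tag k)))`_(tagged k).

Lemma linear_coordE V (U : lmodType C) (F : V -> U) v : linear F ->
  F v = \sum_i coord (vbas V) i v *: F (vbas V)`_i.
Proof.
move=> Fl; pose L := GRing.isLinear.Build _ _ _ _ F Fl.
pose G : {linear V -> U} := HB.pack F L.
rewrite [in LHS](coord_basis (vbasisP {:V}) (memvf v)) -[F _]/(G _) linear_sum.
by apply: eq_bigr => i _; rewrite linearZ.
Qed.

Lemma tlift_pure V W (U : lmodType C) (b : V -> W -> U) v w :
  (forall w, linear (b ^~ w)) -> (forall v, linear (b v)) ->
  tlift b (tpure v w) = b v w.
Proof.
move=> bl br; rewrite (linear_coordE v (bl w)); apply: eq_bigr => i _.
rewrite (linear_coordE w (br _)) scaler_sumr; apply: eq_bigr => j _.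
by rewrite mxE scalerA.
Qed.

Lemma dlift_inj (I : finType) (V : I -> vectType C) (U : lmodType C)
    (F : forall i, V i -> U) i (v : V i) :
  linear (F i) -> dlift_for id F (dinj v) = F i v.
Proof.
move=> Fl; rewrite (linear_coordE v Fl) /dlift_for.
pose K (j : I) (k : 'I_(\dim {:V j})) : U :=
  (dinj v : {ffun _ -> _}) (Tagged (fun j => 'I_(\dim {:V j})) k) *:
    F j (vbas (V j))`_k.
rewrite (eq_bigr (fun p => K (tag p) (tagged p))); last by case.
rewrite -(sig_big_dep xpredT (fun=> xpredT) K) (bigD1 i) //=.
rewrite [X in _ + X]big1 ?addr0 => [|j ji].
  by apply: eq_bigr => k _; rewrite /K ffunE untagE.
by apply: big1 => k _; rewrite /K ffunE untag_dflt ?scale0r.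
Qed.
End LinearAlgebra.

Section WeakHopf.
Variable R : realType.
Local Notation C := R[i].

Record whaData (A : vectType C) := WhaData {
  wmul : A -> A -> A;
  wone : A;
  wcomul : A -> tensor A A;
  wcounit : A -> C;
  wantipode : A -> A
}.

Record weak_hopf_algebra (A : vectType C) (H : whaData A) : Prop := {
  wmul_linl : forall y, linear (fun x => wmul H x y);
  wmul_linr : forall x, linear (wmul H x);
  wmulA : forall x y z, wmul H x (wmul H y z) = wmul H (wmul H x y) z;
  wmul1l : forall x, wmul H (wone H) x = x;
  wmul1r : forall x, wmul H x (wone H) = x;
  wcomul_lin : linear (wcomul H);
  wcounit_lin : scalar (wcounit H);
  wantipode_lin : linear (wantipode H);
  wcomulA : forall x,
    tassoc (tmap (wcomul H) id (wcomul H x)) = tmap id (wcomul H) (wcomul H x);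
  wcounitl : forall x, tlift (fun a b => wcounit H a *: b) (wcomul H x) = x;
  wcounitr : forall x, tlift (fun a b => wcounit H b *: a) (wcomul H x) = x;
  wcomulM : forall x y,
    wcomul H (wmul H x y) = tmul (wmul H) (wmul H) (wcomul H x) (wcomul H y);
  wcomul1l :
    let D1_1 := tassoc (tpure (wcomul H (wone H)) (wone H)) in
    let one_D1 := tpure (wone H) (wcomul H (wone H)) in
    tassoc (tmap (wcomul H) id (wcomul H (wone H))) =
    tmul (wmul H) (tmul (wmul H) (wmul H)) D1_1 one_D1;
  wcomul1r :
    let D1_1 := tassoc (tpure (wcomul H (wone H)) (wone H)) in
    let one_D1 := tpure (wone H) (wcomul H (wone H)) in
    tassoc (tmap (wcomul H) id (wcomul H (wone H))) =
    tmul (wmul H) (tmul (wmul H) (wmul H)) one_D1 D1_1;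
  wcounitM : forall x y z,
    wcounit H (wmul H (wmul H x y) z) =
    tlift (fun y1 y2 => (wcounit H (wmul H x y1) * wcounit H (wmul H y2 z)) : C^o)
      (wcomul H y);
  wcounitMop : forall x y z,
    wcounit H (wmul H (wmul H x y) z) =
    tlift (fun y1 y2 => (wcounit H (wmul H x y2) * wcounit H (wmul H y1 z)) : C^o)
      (wcomul H y);
  wantipoder : forall x,
    tlift (fun x1 x2 => wmul H x1 (wantipode H x2)) (wcomul H x) =
    tlift (fun u1 u2 => wcounit H (wmul H u1 x) *: u2) (wcomul H (wone H));
  wantipodel : forall x,
    tlift (fun x1 x2 => wmul H (wantipode H x1) x2) (wcomul H x) =
    tlift (fun u1 u2 => wcounit H (wmul H x u2) *: u1) (wcomul H (wone H));
  wantipode3 : forall x,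
    tlift (fun x1 x23 =>
      tlift (fun x2 x3 => wmul H (wmul H (wantipode H x1) x2) (wantipode H x3)) x23)
      (tmap id (wcomul H) (wcomul H x)) = wantipode H x
}.

Record star_weak_hopf_algebra (A : vectType C) (H : whaData A) (star : A -> A) :
    Prop := {
  swha_wha : weak_hopf_algebra H;
  wstar_antilin : forall (k : C) x y, star (k *: x + y) = k^* *: star x + star y;
  wstarK : involutive star;
  wstarM : forall x y, star (wmul H x y) = wmul H (star y) (star x);
  wstar_comul : forall x,
    tlift_for Num.conj (fun a b => tpure (star a) (star b)) (wcomul H x) =
    wcomul H (star x)
}.

Record hilbertSpace := HilbertSpace {
  hcarrier :> lmodType C;
  inner : hcarrier -> hcarrier -> C;
  inner_linl : forall y, scalar (fun x => inner x y);
  inner_conj : forall x y, inner y x = (inner x y)^*;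
  inner_ge0 : forall x, 0 <= inner x x;
  inner_eq0 : forall x, inner x x = 0 -> x = 0;
  hcomplete : forall u : nat -> hcarrier,
    (forall e : C, 0 < e -> exists N, forall m n, (N <= m)%N -> (N <= n)%N ->
       inner (u m - u n) (u m - u n) < e) ->
    exists l, forall e : C, 0 < e -> exists N, forall n, (N <= n)%N ->
       inner (u n - l) (u n - l) < e
}.

Record faithful_star_rep (A : vectType C) (mul : A -> A -> A) (one : A)
    (star : A -> A) (H : hilbertSpace) (rho : A -> H -> H) : Prop := {
  rep_op_lin : forall x, linear (rho x);
  rep_bounded : forall x, exists M : C, forall u,
    inner (rho x u) (rho x u) <= M * inner u u;
  rep_lin : forall u, linear (fun x => rho x u);
  repM : forall x y u, rho (mul x y) u = rho x (rho y u);
  rep1 : forall u, rho one u = u;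
  rep_star : forall x u v, inner (rho x u) v = inner u (rho (star x) v);
  rep_faithful : forall x, (forall u, rho x u = 0) -> x = 0
}.

Definition cstar_weak_hopf_algebra (A : vectType C) (H : whaData A)
    (star : A -> A) : Prop :=
  star_weak_hopf_algebra H star /\
  exists (K : hilbertSpace) (rho : A -> K -> K),
    faithful_star_rep (wmul H) (wone H) star rho.
End WeakHopf.

Section Categories.
Variable R : realType.
Local Notation C := R[i].

(* A C-linear category with finite-dimensional morphism spaces and a dagger;
   [dag_pos] and [dag_sqrt] are the positivity conditions making it a
   C*-category. *)
Record daggerCat := DaggerCat {
  ob :> Type;
  mor : ob -> ob -> vectType C;
  idm : forall x, mor x x;
  comp : forall x y z, mor y z -> mor x y -> mor x z;
  dag : forall x y, mor x y -> mor y x;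
  comp_linl : forall x y z (f : mor x y),
    linear (fun g : mor y z => comp g f);
  comp_linr : forall x y z (g : mor y z),
    linear (fun f : mor x y => comp g f);
  compA : forall x y z t (h : mor z t) (g : mor y z) (f : mor x y),
    comp h (comp g f) = comp (comp h g) f;
  comp1l : forall x y (f : mor x y), comp (idm y) f = f;
  comp1r : forall x y (f : mor x y), comp f (idm x) = f;
  dag_antilin : forall x y (k : C) (f g : mor x y),
    dag (k *: f + g) = k^* *: dag f + dag g;
  dagK : forall x y (f : mor x y), dag (dag f) = f;
  dag_comp : forall x y z (g : mor y z) (f : mor x y),
    dag (comp g f) = comp (dag f) (dag g);
  dag_pos : forall x y (f : mor x y), comp (dag f) f = 0 -> f = 0;
  dag_sqrt : forall x y (f : mor x y),
    exists g : mor x x, comp (dag f) f = comp (dag g) g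
}.
End Categories.

Arguments idm {R d} x.
Notation "g ∘ f" := (comp g f).
Notation "f ^†" := (dag f).

Section CategoryNotions.
Variable R : realType.
Local Notation C := R[i].

Section Notions.
Variable D : daggerCat R.
Implicit Types x y z : D.

Definition isomorphic x y : Prop :=
  exists (f : mor x y) (g : mor y x), g ∘ f = idm x /\ f ∘ g = idm y.

Definition simple x : Prop :=
  idm x <> 0 /\ forall f : mor x x, exists k : C, f = k *: idm x.

Definition unitary x y (f : mor x y) : Prop :=
  f^† ∘ f = idm x /\ f ∘ f^† = idm y.

(* [p] exhibits [z] as the orthogonal direct sum of the [s i]. *)
Definition is_direct_sum (I : finType) (s : I -> D) z
    (p : forall i, mor (s i) z) : Prop :=
  [/\ forall i, (p i)^† ∘ p i = idm (s i),
      forall i j, i != j -> (p i)^† ∘ p j = 0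
    & \sum_i p i ∘ (p i)^† = idm z].
End Notions.

End CategoryNotions.

Section CompTheory.
Variables (R : realType) (D : daggerCat R).

Let postl (x y z : D) (f : mor x y) : {linear mor y z -> mor x z} :=
  HB.pack (fun g : mor y z => g ∘ f)
    (GRing.isLinear.Build _ _ _ _ _ (@comp_linl _ D x y z f)).
Let postr (x y z : D) (g : mor y z) : {linear mor x y -> mor x z} :=
  HB.pack (fun f : mor x y => g ∘ f)
    (GRing.isLinear.Build _ _ _ _ _ (@comp_linr _ D x y z g)).

Lemma compZl (x y z : D) k (g : mor y z) (f : mor x y) :
  (k *: g) ∘ f = k *: (g ∘ f).
Proof. exact: (linearZ_LR (postl _ f)). Qed.
Lemma compZr (x y z : D) k (g : mor y z) (f : mor x y) :
  g ∘ (k *: f) = k *: (g ∘ f).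
Proof. exact: (linearZ_LR (postr _ g)). Qed.
Lemma comp_suml (x y z : D) (I : finType) (g : I -> mor y z) (f : mor x y) :
  (\sum_i g i) ∘ f = \sum_i g i ∘ f.
Proof. exact: (linear_sum (postl _ f)). Qed.
Lemma comp_sumr (x y z : D) (I : finType) (g : mor y z) (f : I -> mor x y) :
  g ∘ (\sum_i f i) = \sum_i g ∘ f i.
Proof. exact: (linear_sum (postr _ g)). Qed.
Lemma comp0l (x y z : D) (f : mor x y) : (0 : mor y z) ∘ f = 0.
Proof. by rewrite -[in LHS](scale0r 0) compZl scale0r. Qed.
Lemma comp0r (x y z : D) (g : mor y z) : g ∘ (0 : mor x y) = 0.
Proof. by rewrite -[in LHS](scale0r 0) compZr scale0r. Qed.

Lemma schur (x y : D) (h : mor x y) :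
  simple x -> simple y -> h <> 0 -> isomorphic x y.
Proof.
move=> [x0 /(_ (h^† ∘ h)) [k hk]] [y0 /(_ (h ∘ h^†)) [l hl]] h0.
have k0 : k != 0.
  by apply/eqP => k0; apply: h0; apply: dag_pos; rewrite hk k0 scale0r.
have kl : k = l.
  have : k *: h = l *: h.
    by rewrite -[in LHS](comp1r h) -compZr -hk compA hl compZl comp1l.
  move/eqP; rewrite -subr_eq0 -scalerBl scaler_eq0 subr_eq0.
  by case/orP => /eqP.
exists h, (k^-1 *: h^†); split.
  by rewrite compZl hk scalerA mulVf ?scale1r.
by rewrite compZr hl -kl scalerA mulVf ?scale1r.
Qed.
End CompTheory.

Section MonoidalCategories.
Variable R : realType.
Local Notation C := R[i].

(* Associators and unitors are unitary, so their inverses are their daggers. *)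
Record daggerMonCat := DaggerMonCat {
  dcat :> daggerCat R;
  tens : dcat -> dcat -> dcat;
  tunit : dcat;
  tensm : forall x x' y y' : dcat,
    mor x x' -> mor y y' -> mor (tens x y) (tens x' y');
  assoc : forall x y z : dcat,
    mor (tens (tens x y) z) (tens x (tens y z));
  lunit : forall x : dcat, mor (tens tunit x) x;
  runit : forall x : dcat, mor (tens x tunit) x;
  tensm_linl : forall (x x' y y' : dcat) (g : mor y y'),
    linear (fun f : mor x x' => tensm f g);
  tensm_linr : forall (x x' y y' : dcat) (f : mor x x'),
    linear (fun g : mor y y' => tensm f g);
  tensm_id : forall x y : dcat, tensm (idm x) (idm y) = idm (tens x y);
  tensm_comp : forall (x x' x'' y y' y'' : dcat) (f' : mor x' x'')
    (f : mor x x') (g' : mor y' y'') (g : mor y y'),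
    tensm (f' ∘ f) (g' ∘ g) = tensm f' g' ∘ tensm f g;
  tensm_dag : forall (x x' y y' : dcat) (f : mor x x') (g : mor y y'),
    (tensm f g)^† = tensm f^† g^†;
  assoc_nat : forall (x x' y y' z z' : dcat) (f : mor x x') (g : mor y y')
    (h : mor z z'),
    assoc x' y' z' ∘ tensm (tensm f g) h = tensm f (tensm g h) ∘ assoc x y z;
  lunit_nat : forall (x x' : dcat) (f : mor x x'),
    lunit x' ∘ tensm (idm tunit) f = f ∘ lunit x;
  runit_nat : forall (x x' : dcat) (f : mor x x'),
    runit x' ∘ tensm f (idm tunit) = f ∘ runit x;
  assoc_unitary : forall x y z : dcat, unitary (assoc x y z);
  lunit_unitary : forall x : dcat, unitary (lunit x);
  runit_unitary : forall x : dcat, unitary (runit x);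
  pentagon : forall x y z t : dcat,
    assoc x y (tens z t) ∘ assoc (tens x y) z t =
    tensm (idm x) (assoc y z t) ∘ assoc x (tens y z) t ∘
      tensm (assoc x y z) (idm t);
  triangle : forall x y : dcat,
    tensm (idm x) (lunit y) ∘ assoc x tunit y = tensm (runit x) (idm y)
}.
End MonoidalCategories.

Arguments tunit {R d}.
Arguments assoc {R d} x y z.
Arguments lunit {R d} x.
Arguments runit {R d} x.
Notation "x ⊗ y" := (tens x y).
Notation "f ⊗m g" := (tensm f g).

Section Multifusion.
Variable R : realType.
Local Notation C := R[i].

(* [xb] is a right dual of [x]; with the dagger, it is also a left dual. *)
Definition zigzag (D : daggerMonCat R) (x xb : D)
    (coev : mor tunit (x ⊗ xb)) (ev : mor (xb ⊗ x) tunit) : Prop :=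
  runit x ∘ (idm x ⊗m ev) ∘ assoc x xb x ∘ (coev ⊗m idm x) ∘ (lunit x)^† = idm x
  /\
  lunit xb ∘ (ev ⊗m idm xb) ∘ (assoc xb x xb)^† ∘ (idm xb ⊗m coev) ∘ (runit xb)^†
  = idm xb.

Record unitary_multifusion (D : daggerMonCat R) : Prop := {
  umfc_zero : exists z : D, idm z = 0;
  umfc_biproduct : forall x y : D, exists (z : D)
    (p : forall b : bool, mor (if b then x else y) z), is_direct_sum p;
  umfc_semisimple : forall x : D, exists (n : nat) (s : 'I_n -> D)
    (p : forall i, mor (s i) x), (forall i, simple (s i)) /\ is_direct_sum p;
  umfc_finite : exists (n : nat) (s : 'I_n -> D),
    forall x : D, simple x -> exists i, isomorphic x (s i);
  umfc_rigid : forall x : D, exists (xb : D) coev ev, @zigzag D x xb coev ev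
}.

(* [irr] enumerates Irr(D); [uidx] is the index set of the decomposition of the
   unit object into simple summands 1_i = irr (uirr i), with isometric
   inclusions [uinc i]. *)
Record simples (D : daggerMonCat R) := Simples {
  irrT :> finType;
  irr : irrT -> D;
  irr_simple : forall x, simple (irr x);
  irr_inj : forall x y, isomorphic (irr x) (irr y) -> x = y;
  irr_surj : forall z : D, simple z -> exists x, isomorphic z (irr x);
  uidx : finType;
  uirr : uidx -> irrT;
  uinc : forall i, mor (irr (uirr i)) tunit;
  unit_decomp : is_direct_sum uinc
}.

Definition in_block (D : daggerMonCat R) (X : simples D) (i j : uidx X) (x : D) :
    Prop :=
  exists y : D, isomorphic x (irr (uirr i) ⊗ (y ⊗ irr (uirr j))).

(* The dual of a simple representative is taken to be a representative.  The
   scalar identities are stated on the whole unit object, where id_{1_i} becomes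
   the projection [uinc i ∘ (uinc i)^†]. *)
Record spherical (D : daggerMonCat R) (X : simples D) := Spherical {
  bar : X -> X;
  coev : forall x : X, mor tunit (irr x ⊗ irr (bar x));
  ev : forall x : X, mor (irr (bar x) ⊗ irr x) tunit;
  qdim : X -> C;
  dual_zigzag : forall x, zigzag (coev x) (ev x);
  qdim_gt0 : forall x, 0 < qdim x;
  coev_qdim : forall x (i j : uidx X), in_block i j (irr x) ->
    (coev x)^† ∘ coev x = qdim x *: (uinc i ∘ (uinc i)^†);
  ev_qdim : forall x (i j : uidx X), in_block i j (irr x) ->
    ev x ∘ (ev x)^† = qdim x *: (uinc j ∘ (uinc j)^†)
}.

(* Dual bases of Hom(k,z) and Hom(z,k), for a simple representative k. *)
Record dual_bases (D : daggerMonCat R) (X : simples D) (k : X) (z : D) :=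
  DualBases {
  dbsize : nat;
  dbv : dbsize.-tuple (mor (irr k) z);
  dbd : dbsize.-tuple (mor z (irr k));
  dbv_basis : basis_of fullv dbv;
  dbd_basis : basis_of fullv dbd;
  db_dual : forall i j,
    tnth dbd i ∘ tnth dbv j = (i == j)%:R *: idm (irr k)
}.

Lemma dual_bases_inhabited (D : daggerMonCat R) (X : simples D) (k : X) (z : D) :
  unitary_multifusion D -> inhabited (dual_bases k z).
Proof.
move=> HD; have [n [s [p [ss [p1 p0 pz]]]]] := umfc_semisimple HD z.
pose I := [set i | `[< isomorphic (irr k) (s i) >]].
have iso (i : 'I_#|I|) :
    {fg : mor (irr k) (s (enum_val i)) * mor (s (enum_val i)) (irr k) |
      fg.2 ∘ fg.1 = idm _ /\ fg.1 ∘ fg.2 = idm _}.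
  apply: cid; have := enum_valP i; rewrite inE => /asboolP[f [g [gf fg]]].
  by exists (f, g).
pose F i := (sval (iso i)).1; pose G i := (sval (iso i)).2.
have GF i : G i ∘ F i = idm _ by case: (svalP (iso i)).
have FG i : F i ∘ G i = idm _ by case: (svalP (iso i)).
pose V : #|I|.-tuple (mor (irr k) z) := [tuple p (enum_val i) ∘ F i | i < #|I|].
pose W : #|I|.-tuple (mor z (irr k)) := [tuple G i ∘ (p (enum_val i))^† | i < #|I|].
have dual i j : tnth W i ∘ tnth V j = (i == j)%:R *: idm (irr k).
  rewrite !tnth_mktuple -compA [_^† ∘ _]compA; case: eqVneq => [<-|ij].
    by rewrite p1 comp1l GF scale1r.
  rewrite p0 ?(inj_eq enum_val_inj) // scale0r.
  by rewrite comp0l comp0r.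
have id0 : idm (irr k) != 0 by apply/eqP; case: (irr_simple k).
have deltaE (c : 'I_#|I| -> C) j :
    \sum_i c i *: ((j == i)%:R *: idm (irr k)) = c j *: idm (irr k).
  rewrite (bigD1 j) //= eqxx scale1r big1 ?addr0 // => i ij.
  by rewrite eq_sym (negPf ij) scale0r scaler0.
have fV : free V.
  apply/freeP => c /(congr1 (fun f j => tnth W j ∘ f)) c0 j.
  have /eqP := congr1 (@^~ j) c0; rewrite comp_sumr.
  under eq_bigr do rewrite compZr -tnth_nth dual.
  rewrite deltaE comp0r scaler_eq0 (negPf id0) orbF.
  by move/eqP.
have fW : free W.
  apply/freeP => c /(congr1 (fun f j => f ∘ tnth V j)) c0 j.
  have /eqP := congr1 (@^~ j) c0; rewrite comp_suml.
  under eq_bigr do rewrite compZl -tnth_nth dual eq_sym.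
  rewrite deltaE comp0l scaler_eq0 (negPf id0) orbF.
  by move/eqP.
have notI i : i \notin I -> (forall u : mor (irr k) (s i), u = 0) /\
    (forall u : mor (s i) (irr k), u = 0).
  rewrite inE => /asboolP ni; split => u; apply: contrapT => u0; apply: ni.
    exact: schur (irr_simple k) (ss i) u0.
  have [f [g [gf fg]]] := schur (ss i) (irr_simple k) u0.
  by exists g, f.
have sumI (T : lmodType C) (K : 'I_n -> T) :
    (forall i, i \notin I -> K i = 0) ->
    \sum_i K i = \sum_(i < #|I|) K (enum_val i).
  move=> K0; rewrite (bigID (mem I)) /= [X in _ + X]big1 // addr0.
  by rewrite big_enum_val.
have [_ ek] := irr_simple k.
have sV : (fullv <= <<V>>)%VS.
  apply/subvP => u _; rewrite -[u]comp1l -pz comp_suml sumI.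
    apply: rpred_sum => i _; have [c hc] := ek (G i ∘ ((p (enum_val i))^† ∘ u)).
    suff -> : p (enum_val i) ∘ (p (enum_val i))^† ∘ u = c *: tnth V i.
      by apply: rpredZ; apply: memv_span; apply: mem_tnth.
    rewrite tnth_mktuple -compZr -[F i]comp1r.
    rewrite -compZr -hc [F i ∘ (_ ∘ _)]compA FG comp1l.
    by rewrite compA.
  by move=> i /notI[u0 _]; rewrite -compA (u0 (_ ∘ _)) comp0r.
have sW : (fullv <= <<W>>)%VS.
  apply/subvP => u _; rewrite -[u]comp1r -pz comp_sumr sumI.
    apply: rpred_sum => i _; have [c hc] := ek (u ∘ p (enum_val i) ∘ F i).
    suff -> : u ∘ (p (enum_val i) ∘ (p (enum_val i))^†) = c *: tnth W i.
      by apply: rpredZ; apply: memv_span; apply: mem_tnth.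
    rewrite tnth_mktuple -compZl -[G i]comp1l.
    rewrite -compZl -hc -[_ ∘ F i ∘ G i]compA FG comp1r.
    by rewrite compA.
  by move=> i /notI[_ u0]; rewrite compA (u0 (_ ∘ _)) comp0l.
have bV : basis_of fullv V.
  by rewrite /basis_of fV andbT eqEsubv subvf sV.
have bW : basis_of fullv W.
  by rewrite /basis_of fW andbT eqEsubv subvf sW.
by constructor; exact: DualBases bV bW dual.
Qed.
End Multifusion.

Section Tube.
Variables (R : realType) (D : daggerMonCat R) (X : simples D).
Variable (sph : spherical X).
(* The bases used in the sums over p, q in the structure maps. *)
Variable (B : forall (k : X) (z : D), dual_bases k z).
Local Notation C := R[i].
Implicit Types a b c e f h k x y : X.

(* id_x if x = y, and 0 otherwise. *)
Definition delta_mor x y : mor (irr x) (irr y) :=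
  match x =P y with
  | ReflectT xy => ecast z (mor (irr x) (irr z)) xy (idm (irr x))
  | ReflectF _ => 0
  end.

(* Indices are tuples (a, b, c, e, f, h). *)
Definition tube_idx : finType := (X * X * X * X * X * X)%type.

Definition tubeL (t : tube_idx) : vectType C :=
  let: (a, b, c, e, f, h) := t in mor (irr c) (irr a ⊗ (irr e ⊗ irr b)).

Definition tubeR (t : tube_idx) : vectType C :=
  let: (a, b, c, e, f, h) := t in mor (irr a ⊗ (irr f ⊗ irr b)) (irr h).

Definition Tube : vectType C := dsum (fun t => tensor (tubeL t) (tubeR t)).

Definition tube_pure a b c e f h (v : mor (irr c) (irr a ⊗ (irr e ⊗ irr b)))
    (w : mor (irr a ⊗ (irr f ⊗ irr b)) (irr h)) : Tube :=
  @dinj C tube_idx (fun t => tensor (tubeL t) (tubeR t)) (a, b, c, e, f, h)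
    (@tpure C (tubeL (a, b, c, e, f, h)) (tubeR (a, b, c, e, f, h)) v w).

Definition tube_form (U : Type) := forall a b c e f h,
  mor (irr c) (irr a ⊗ (irr e ⊗ irr b)) ->
  mor (irr a ⊗ (irr f ⊗ irr b)) (irr h) -> U.

Definition tube_lift_for (s : C -> C) (U : lmodType C) (F : tube_form U) :
    Tube -> U :=
  dlift_for s (fun t => tlift_for s
    (let: (a, b, c, e, f, h) as t := t return tubeL t -> tubeR t -> U in
     @F a b c e f h)).

Definition tube_lift (U : lmodType C) (F : tube_form U) := tube_lift_for id F.

Lemma tube_lift_pure (U : lmodType C) (F : tube_form U) a b c e f h v w :
  (forall w, linear (fun v => @F a b c e f h v w)) ->
  (forall v, linear (@F a b c e f h v)) ->
  tube_lift F (tube_pure v w) = @F a b c e f h v w.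
Proof.
move=> Fl Fr; rewrite /tube_lift /tube_lift_for dlift_inj.
  by rewrite -[LHS]/(tlift _ _) tlift_pure.
move=> k u u'; rewrite /tlift_for scaler_sumr -big_split; apply: eq_bigr => i _ /=.
rewrite scaler_sumr -big_split; apply: eq_bigr => j _ /=.
by rewrite !mxE scalerDl scalerA.
Qed.

Definition reassoc (a a' x b' b : D) :
    mor (a ⊗ ((a' ⊗ (x ⊗ b')) ⊗ b)) ((a ⊗ a') ⊗ (x ⊗ (b' ⊗ b))) :=
  (assoc a a' (x ⊗ (b' ⊗ b)))^† ∘
  (idm a ⊗m ((idm a' ⊗m assoc x b' b) ∘ assoc a' (x ⊗ b') b)).

Definition pad (x : D) : mor x (tunit ⊗ (x ⊗ tunit)) :=
  (lunit (x ⊗ tunit))^† ∘ (runit x)^†.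

Definition flat a b (x y : D) (u : mor (irr a ⊗ (x ⊗ irr b)) y) :
    mor x (irr (bar sph a) ⊗ (y ⊗ irr (bar sph b))) :=
  (idm (irr (bar sph a)) ⊗m (u ⊗m idm (irr (bar sph b)))) ∘
  (reassoc (irr (bar sph a)) (irr a) x (irr b) (irr (bar sph b)))^† ∘
  ((ev sph a)^† ⊗m (idm x ⊗m coev sph b)) ∘ pad x.

Definition sharp a b (x y : D) (u : mor y (irr a ⊗ (x ⊗ irr b))) :
    mor (irr (bar sph a) ⊗ (y ⊗ irr (bar sph b))) x :=
  (pad x)^† ∘ (ev sph a ⊗m (idm x ⊗m (coev sph b)^†)) ∘
  reassoc (irr (bar sph a)) (irr a) x (irr b) (irr (bar sph b)) ∘
  (idm (irr (bar sph a)) ⊗m (u ⊗m idm (irr (bar sph b)))).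

Definition tube_bracket c e f h (P Q : D)
    (v : mor (irr c) (P ⊗ (irr e ⊗ Q))) (w : mor (P ⊗ (irr f ⊗ Q)) (irr h)) :
    Tube :=
  \sum_k \sum_s
    \sum_(p < dbsize (B k P)) \sum_(q < dbsize (B s Q))
      tube_pure
        ((tnth (dbd (B k P)) p ⊗m (idm (irr e) ⊗m tnth (dbd (B s Q)) q)) ∘ v)
        (w ∘ (tnth (dbv (B k P)) p ⊗m (idm (irr f) ⊗m tnth (dbv (B s Q)) q))).

(* The Kronecker factors for (e, c') and (f, h') are built into [delta_mor]. *)
Definition tube_mul (t t' : Tube) : Tube :=
  tube_lift (fun a b c e f h v w =>
    tube_lift (fun a' b' c' e' f' h' v' w' =>
      tube_bracket
        (reassoc (irr a) (irr a') (irr e') (irr b') (irr b) ∘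
         (idm (irr a) ⊗m ((v' ∘ delta_mor e c') ⊗m idm (irr b))) ∘ v)
        (w ∘ (idm (irr a) ⊗m ((delta_mor h' f ∘ w') ⊗m idm (irr b))) ∘
         (reassoc (irr a) (irr a') (irr f') (irr b') (irr b))^†)) t') t.

(* id_y in Hom(y, 1_i ⊗ y ⊗ 1_j) and id_x in Hom(1_i ⊗ x ⊗ 1_j, x) are the
   composites of unitors with the inclusions of the summands 1_i, 1_j. *)
Definition tube_one : Tube :=
  \sum_(i : uidx X) \sum_(j : uidx X)
    \sum_(x | `[< in_block i j (irr x) >]) \sum_(y | `[< in_block i j (irr y) >])
      tube_pure
        (((uinc i)^† ⊗m (idm (irr y) ⊗m (uinc j)^†)) ∘ pad (irr y))
        ((pad (irr x))^† ∘ (uinc i ⊗m (idm (irr x) ⊗m uinc j))).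

Definition tube_counit (t : Tube) : C :=
  tube_lift (fun a b c e f h v w =>
    coord [tuple idm (irr c)] 0
      (delta_mor h c ∘ w ∘
       (idm (irr a) ⊗m (delta_mor e f ⊗m idm (irr b))) ∘ v) : C^o) t.

Definition tube_comul (t : Tube) : tensor Tube Tube :=
  tube_lift (fun a b c e f h v w =>
    \sum_i \sum_k
      let Bik := B k (irr a ⊗ (irr i ⊗ irr b)) in
      \sum_(p < dbsize Bik)
        tpure (tube_pure (tnth (dbv Bik) p) w) (tube_pure v (tnth (dbd Bik) p))) t.

Definition tube_antipode (t : Tube) : Tube :=
  tube_lift (fun a b c e f h v w =>
    (qdim sph f / qdim sph h) *: tube_pure (flat w) (sharp v)) t.

Definition tube_star (t : Tube) : Tube :=
  tube_lift_for Num.conj (fun a b c e f h v w =>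
    (qdim sph e / qdim sph c) *: tube_pure (flat v^†) (sharp w^†)) t.

Definition tube_wha : whaData Tube := {|
  wmul := tube_mul;
  wone := tube_one;
  wcomul := tube_comul;
  wcounit := tube_counit;
  wantipode := tube_antipode
|}.
End Tube.

(* Main.v *)
(* Tube is a coend: for arbitrary objects P, Q the bracket <v, w> is dinatural in
   P and Q (bracket_nat) and reduces to a pure tensor when P and Q are simple.
   All identities not involving the antipode follow by moving morphisms across
   brackets; structural isomorphisms disappear under the faithful strictification
   [st].  The antipode and the star use the adjunction
   a ⊗ - ⊗ b -| abar ⊗ - ⊗ bbar and the rotation identity
   d_l sc(v^sharp w^flat) = d_k sc(w v) (sharp_flat), which comes from sphericity;
   it implies that the bent dual bases, weighted by quotients of dimensions, are
   again dual bases.  Over orthonormal bases bending is unitary up to scalars, so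
   the star is an anti-automorphism; no structure map depends on the bases.
   Finally, the functional reading off the component in which both legs are
   the unit satisfies
     omega((v' ⊗ w')^* (v ⊗ w)) = d_h / (d_f d_a d_b) (v'^† v) (w w'^†)
   for equal indices and vanishes otherwise, so left multiplication is a faithful
   *-representation on Tube with the inner product omega(y^* x). *)
From HB Require Import structures.
From mathcomp Require Import all_boot all_order all_algebra.
From mathcomp Require Import boolp reals.
From mathcomp Require Import complex.
From mathcomp Require Import ring lra.
Require Import Defs.

Set Implicit Arguments.
Unset Strict Implicit.
Unset Printing Implicit Defensive.

Import Order.TTheory GRing.Theory Num.Theory.
Local Open Scope ring_scope.

(** * Strictification *)

(** The record [spherical] gives only zigzags and loop values on simple objects; invariance of
    diagrams under rotation is not among its fields and has to be derived. The obstacle sits in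
    Hom(k, a ⊗ b), which can be bent to the duals in two ways: dagger and then transposition
    ([alpha]), or transposition and then dagger ([beta]). Equality of the left and right loop values
    yields only that both maps have the same Gram form; positivity of the dagger then forces them to
    coincide ([alpha_beta]). This gives the partial traces of rank one operators, from which the
    rotation identity follows, and it lets the star pass through products of legs. A second obstacle
    is that legs often agree only up to isomorphism: iterated products, double duals, products with
    the unit. Brackets with arbitrary objects as legs absorb these isomorphisms, so no transport
    along equalities of simple objects is needed. *)

Section Strict.
Variables (R : realType) (D : daggerMonCat R).
Implicit Types x y z w t : D.

Lemma dag_id x : (idm x)^† = idm x.
Proof.
by rewrite -[in LHS](comp1l (idm x)^†) -{1}(dagK (idm x)) -dag_comp comp1l dagK.
Qed.

Lemma assocK x y z : (assoc x y z)^† ∘ assoc x y z = idm _.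
Proof. by case: (assoc_unitary x y z). Qed.
Lemma assocKV x y z : assoc x y z ∘ (assoc x y z)^† = idm _.
Proof. by case: (assoc_unitary x y z). Qed.
Lemma lunitK x : (lunit x)^† ∘ lunit x = idm _.
Proof. by case: (lunit_unitary x). Qed.
Lemma lunitKV x : lunit x ∘ (lunit x)^† = idm _.
Proof. by case: (lunit_unitary x). Qed.
Lemma runitKV x : runit x ∘ (runit x)^† = idm _.
Proof. by case: (runit_unitary x). Qed.

Lemma tens1M x y y' y'' (g : mor y' y'') (f : mor y y') :
  idm x ⊗m (g ∘ f) = (idm x ⊗m g) ∘ (idm x ⊗m f).
Proof. by rewrite -tensm_comp comp1l. Qed.
Lemma tensM1 x x' x'' y (g : mor x' x'') (f : mor x x') :
  (g ∘ f) ⊗m idm y = (g ⊗m idm y) ∘ (f ⊗m idm y).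
Proof. by rewrite -tensm_comp comp1l. Qed.
Lemma tens_split x x' y y' (f : mor x x') (g : mor y y') :
  f ⊗m g = (f ⊗m idm y') ∘ (idm x ⊗m g).
Proof. by rewrite -tensm_comp comp1l comp1r. Qed.

Lemma tens1_inj x y (f g : mor x y) : idm tunit ⊗m f = idm tunit ⊗m g -> f = g.
Proof.
move=> fg; rewrite -[f]comp1r -[g]comp1r -(lunitKV x) !compA -!lunit_nat.
by rewrite fg.
Qed.

(* Kelly's consequence of the pentagon and the triangle. *)
Lemma lunit_assoc x y : lunit (x ⊗ y) ∘ assoc tunit x y = lunit x ⊗m idm y.
Proof.
apply: tens1_inj; rewrite tens1M.
have E : idm tunit ⊗m lunit (x ⊗ y) ∘ assoc tunit tunit (x ⊗ y) ∘
    assoc (tunit ⊗ tunit) x y =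
    idm tunit ⊗m (lunit x ⊗m idm y) ∘ assoc tunit (tunit ⊗ x) y ∘
    assoc tunit tunit x ⊗m idm y.
  rewrite triangle -assoc_nat -compA -tensM1 triangle -tensm_id.
  by rewrite assoc_nat.
rewrite -[_ ∘ assoc _ _ (x ⊗ y) ∘ _]compA pentagon in E.
rewrite -[LHS]comp1r -[RHS]comp1r -tensm_id.
have K : assoc tunit (tunit ⊗ x) y ∘ assoc tunit tunit x ⊗m idm y ∘
   ((assoc tunit tunit x)^† ⊗m idm y ∘ (assoc tunit (tunit ⊗ x) y)^†) = idm _.
  rewrite compA -[X in X ∘ _]compA -tensM1 assocKV tensm_id comp1r.
  exact: assocKV.
have := congr1 (fun u => u ∘ ((assoc tunit tunit x)^† ⊗m idm y ∘
  (assoc tunit (tunit ⊗ x) y)^†)) E.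
by rewrite !compA -!compA [in LHS]compA; rewrite !compA in K *; rewrite -!compA in K *; rewrite K !tensm_id.
Qed.

(* A bracketed object [x] with its right-nested action [sa x] on objects:
   [snf x z : x ⊗ z -> sa x z] removes all brackets and units. *)
Structure sobj := SObj {
  so :> D;
  sa : D -> D;
  sm : forall z z', mor z z' -> mor (sa z) (sa z');
  snf : forall z, mor (so ⊗ z) (sa z);
  sm1 : forall z, sm (idm z) = idm (sa z);
  smM : forall z z' z'' (g : mor z' z'') (f : mor z z'), sm (g ∘ f) = sm g ∘ sm f;
  sm_dag : forall z z' (f : mor z z'), (sm f)^† = sm f^†;
  snf_nat : forall z z' (f : mor z z'), snf z' ∘ (idm so ⊗m f) = sm f ∘ snf z;
  snfK : forall z, (snf z)^† ∘ snf z = idm _;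
  snfKV : forall z, snf z ∘ (snf z)^† = idm _
}.

Local Obligation Tactic := idtac.
(** Atoms act by tensoring from the left, the unit as the identity functor, a product by
    composition. As canonical instances they are inferred from the shape of an object. *)
Program Definition so_var x : sobj := @SObj x (fun z => x ⊗ z)
  (fun z z' f => idm x ⊗m f) (fun z => idm (x ⊗ z)) _ _ _ _ _ _.
Next Obligation. by move=> x z /=; rewrite tensm_id. Qed.
Next Obligation. by move=> x z z' z'' g f /=; rewrite tens1M. Qed.
Next Obligation. by move=> x z z' f /=; rewrite tensm_dag dag_id. Qed.
Next Obligation. by move=> x z z' f /=; rewrite comp1l comp1r. Qed.
Next Obligation. by move=> x z /=; rewrite dag_id comp1r. Qed.
Next Obligation. by move=> x z /=; rewrite dag_id comp1r. Qed.
Canonical so_var.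

Program Definition so_unit : sobj := @SObj tunit (fun z => z)
  (fun z z' f => f) (fun z => lunit z) _ _ _ _ _ _.
Next Obligation. by []. Qed.
Next Obligation. by []. Qed.
Next Obligation. by []. Qed.
Next Obligation. by move=> z z' f /=; rewrite lunit_nat. Qed.
Next Obligation. exact: lunitK. Qed.
Next Obligation. exact: lunitKV. Qed.
Canonical so_unit.

Program Definition so_tens (x y : sobj) : sobj := @SObj (x ⊗ y)
  (fun z => sa x (sa y z)) (fun z z' f => sm x (sm y f))
  (fun z => snf x (sa y z) ∘ (idm x ⊗m snf y z) ∘ assoc x y z) _ _ _ _ _ _.
Next Obligation. by move=> x y z /=; rewrite !sm1. Qed.
Next Obligation. by move=> x y z z' z'' g f /=; rewrite !smM. Qed.
Next Obligation. by move=> x y z z' f /=; rewrite !sm_dag. Qed.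
Next Obligation.
move=> x y z z' f /=; rewrite -tensm_id -!compA assoc_nat.
rewrite [_ ⊗m snf y z' ∘ _]compA -tens1M snf_nat tens1M.
by rewrite -[in LHS]compA [LHS]compA snf_nat -!compA.
Qed.
Next Obligation.
move=> x y z /=; rewrite !dag_comp -!compA [(snf x _)^† ∘ _]compA snfK comp1l.
rewrite [(_ ⊗m _)^† ∘ _]compA tensm_dag dag_id -tens1M snfK tensm_id comp1l.
exact: assocK.
Qed.
Next Obligation.
move=> x y z /=; rewrite !dag_comp -!compA [assoc _ _ _ ∘ _]compA assocKV comp1l.
rewrite [(_ ⊗m _) ∘ _]compA tensm_dag dag_id -tens1M snfKV tensm_id comp1l.
exact: snfKV.
Qed.
Canonical so_tens.

(** The embedding of D into its endofunctors by left tensoring, transported to normal forms: [st f]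
    is a natural transformation from [sa x] to [sa y], and composition of endofunctors is strictly
    associative. The lock keeps rewriting from unfolding it. *)
Definition st (x y : sobj) (f : mor x y) z : mor (sa x z) (sa y z) :=
  locked (snf y z ∘ (f ⊗m idm z) ∘ (snf x z)^†).

Lemma st_def (x y : sobj) (f : mor x y) z :
  st f z = snf y z ∘ (f ⊗m idm z) ∘ (snf x z)^†.
Proof. by rewrite /st -lock. Qed.

Lemma st_comp (x y w : sobj) (g : mor y w) (f : mor x y) z :
  st (g ∘ f) z = st g z ∘ st f z.
Proof.
by rewrite !st_def tensM1 -!compA [(snf y z)^† ∘ _]compA snfK comp1l.
Qed.

Lemma st_id (x : sobj) z : st (idm x) z = idm _.
Proof. by rewrite !st_def tensm_id comp1r snfKV. Qed.

Lemma st_dag (x y : sobj) (f : mor x y) z : st f^† z = (st f z)^†.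
Proof. by rewrite !st_def !dag_comp dagK tensm_dag dag_id compA. Qed.

(** Naturality in [z] is the interchange law: morphisms on disjoint strands slide past each other.
    Together with the snakes it carries the diagrammatic arguments below. *)
Lemma st_nat (x y : sobj) (f : mor x y) z z' (h : mor z z') :
  st f z' ∘ sm x h = sm y h ∘ st f z.
Proof.
rewrite !st_def -[sm x h]comp1r -(snfKV x z) [sm x h ∘ _]compA -snf_nat.
rewrite -!compA [(snf x z')^† ∘ _]compA snfK comp1l.
rewrite [f ⊗m _ ∘ _]compA -tensm_comp comp1l comp1r.
by rewrite [RHS]compA -snf_nat -compA [idm y ⊗m h ∘ _]compA -tensm_comp comp1l comp1r.
Qed.

Lemma snf_dag_nat (x : sobj) z z' (f : mor z z') :
  (idm x ⊗m f) ∘ (snf x z)^† = (snf x z')^† ∘ sm x f.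
Proof.
rewrite -[LHS]comp1l -(snfK x z') -compA [snf x z' ∘ _]compA snf_nat.
by rewrite -compA snfKV comp1r.
Qed.

Lemma st_tens (x x' y y' : sobj) (f : mor x x') (g : mor y y') z :
  st (f ⊗m g) z = st f (sa y' z) ∘ sm x (st g z).
Proof.
have E : assoc x' y' z ∘ ((f ⊗m g) ⊗m idm z) ∘ (assoc x y z)^† = f ⊗m (g ⊗m idm z).
  by rewrite assoc_nat -compA assocKV comp1r.
have -> : st (f ⊗m g) z = snf x' (sa y' z) ∘ ((idm x' ⊗m snf y' z) ∘
    (f ⊗m (g ⊗m idm z)) ∘ (idm x ⊗m (snf y z)^†)) ∘ (snf x (sa y z))^†.
  by rewrite -E st_def /= !dag_comp tensm_dag dag_id !compA.
rewrite -!tensm_comp comp1l comp1r -st_def tens_split.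
by rewrite -!compA snf_dag_nat !st_def !compA.
Qed.

(** The pentagon says that both bracketings of a triple product have the same normal form; Kelly's
    identity and the triangle do this for the unitors. *)
Lemma st_assoc (x y w : sobj) z : st (assoc x y w) z = idm (sa x (sa y (sa w z))).
Proof.
rewrite st_def /= -[RHS](snfKV (so_tens (so_tens x y) w)) /=; congr (_ ∘ _).
have E : assoc x y (sa w z) ∘ (idm (x ⊗ y) ⊗m snf w z) =
    (idm x ⊗m (idm y ⊗m snf w z)) ∘ assoc x y (w ⊗ z).
  by rewrite -tensm_id assoc_nat.
rewrite !tens1M -[_ ∘ assoc x y (sa w z) ∘ _]compA E.
by rewrite -!compA pentagon !compA.
Qed.

Lemma st_lunit (x : sobj) z : st (lunit x) z = idm (sa x z).
Proof.
rewrite st_def /= -[RHS](snfKV (so_tens so_unit x)) /=; congr (_ ∘ _).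
by rewrite lunit_nat -compA lunit_assoc.
Qed.

Lemma st_runit (x : sobj) z : st (runit x) z = idm (sa x z).
Proof.
rewrite st_def /= -[RHS](snfKV (so_tens x so_unit)) /=; congr (_ ∘ _).
by rewrite -compA triangle.
Qed.

(** Evaluation at [tunit] loses nothing: [- ⊗ tunit] is faithful by naturality of [runit]. *)
Lemma st_inj (x y : sobj) (f g : mor x y) : st f tunit = st g tunit -> f = g.
Proof.
move=> fg; suff E : f ⊗m idm tunit = g ⊗m idm tunit.
  by rewrite -[f]comp1r -[g]comp1r -(runitKV x) !compA -!runit_nat E.
have unst (h : mor x y) : h ⊗m idm tunit = (snf y tunit)^† ∘ st h tunit ∘ snf x tunit.
  by rewrite !st_def -!compA snfK comp1r [RHS]compA snfK comp1l.
by rewrite !unst fg.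
Qed.

End Strict.

Canonical so_var.
Canonical so_unit.
Canonical so_tens.

Definition stE := (st_comp, st_id, st_dag, st_tens, st_assoc, st_lunit, st_runit).

Ltac strict := apply: st_inj; rewrite !stE /= ?(dag_id, comp1l, comp1r, tensm_id).

(** * Two-sided actions P ⊗ - ⊗ Q: [fm] moves the middle strand, [tc] the outer legs *)

Notation act P Q x := (P ⊗ (x ⊗ Q)) (only parsing).
Notation fm P Q f := (idm P ⊗m (f ⊗m idm Q)) (only parsing).
Notation tc g h x := (g ⊗m (idm x ⊗m h)) (only parsing).

Section Act.
Variables (R : realType) (D : daggerMonCat R).
Implicit Types x y z w t P Q : D.

Lemma fm1 P Q x : fm P Q (idm x) = idm (act P Q x).
Proof. by rewrite !tensm_id. Qed.

Lemma fmM P Q x y z (g : mor y z) (f : mor x y) :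
  fm P Q (g ∘ f) = fm P Q g ∘ fm P Q f.
Proof. by rewrite -!tensm_comp !comp1l. Qed.

Lemma fm_dag P Q x y (f : mor x y) : (fm P Q f)^† = fm P Q f^†.
Proof. by rewrite !tensm_dag !dag_id. Qed.

Lemma tc1 P Q x : tc (idm P) (idm Q) x = idm (act P Q x).
Proof. by rewrite !tensm_id. Qed.

Lemma tcM P P' P'' Q Q' Q'' x (g' : mor P' P'') (g : mor P P') (h' : mor Q' Q'')
    (h : mor Q Q') : tc (g' ∘ g) (h' ∘ h) x = tc g' h' x ∘ tc g h x.
Proof. by rewrite -!tensm_comp !comp1l. Qed.

Lemma tc_dag P P' Q Q' x (g : mor P P') (h : mor Q Q') :
  (tc g h x)^† = tc g^† h^† x.
Proof. by rewrite !tensm_dag !dag_id. Qed.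

Lemma tc_fm P P' Q Q' x y (g : mor P P') (h : mor Q Q') (f : mor x y) :
  tc g h y ∘ fm P Q f = fm P' Q' f ∘ tc g h x.
Proof. by rewrite -!tensm_comp !comp1l !comp1r. Qed.

(* Copies of [reassoc] and [pad] that rewriting with [compA] cannot unfold. *)
Definition ra P P' x Q' Q := locked (reassoc P P' x Q' Q).
Definition pd x := locked (pad x).
Lemma reassocE P P' x Q' Q : reassoc P P' x Q' Q = ra P P' x Q' Q.
Proof. by rewrite /ra -lock. Qed.
Lemma padE x : pad x = pd x.
Proof. by rewrite /pd -lock. Qed.

Lemma raK P P' x Q' Q :
  (ra P P' x Q' Q)^† ∘ ra P P' x Q' Q = idm _.
Proof. by rewrite /ra -!lock /reassoc; strict. Qed.

Lemma raKV P P' x Q' Q :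
  ra P P' x Q' Q ∘ (ra P P' x Q' Q)^† = idm _.
Proof. by rewrite /ra -!lock /reassoc; strict. Qed.

Lemma pdK x : (pd x)^† ∘ pd x = idm _.
Proof. by rewrite /pd -!lock /pad; strict. Qed.

Lemma pdKV x : pd x ∘ (pd x)^† = idm _.
Proof. by rewrite /pd -!lock /pad; strict. Qed.

Lemma pd_nat x y (f : mor x y) : pd y ∘ f = fm tunit tunit f ∘ pd x.
Proof. by rewrite /pd -!lock /pad; strict. Qed.

Lemma ra_nat P P' x y Q' Q (f : mor x y) :
  ra P P' y Q' Q ∘ fm P Q (fm P' Q' f) =
  fm (P ⊗ P') (Q' ⊗ Q) f ∘ ra P P' x Q' Q.
Proof. by rewrite /ra -!lock /reassoc; strict. Qed.

Lemma ra_tc P1 P2 P1' P2' x Q1 Q2 Q1' Q2' (g : mor P1 P2) (g' : mor P1' P2')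
    (h : mor Q1 Q2) (h' : mor Q1' Q2') :
  ra P2 P2' x Q2' Q2 ∘ (tc g h (act P2' Q2' x) ∘ fm P1 Q1 (tc g' h' x)) =
  tc (g ⊗m g') (h' ⊗m h) x ∘ ra P1 P1' x Q1' Q1.
Proof.
rewrite /ra -!lock /reassoc; strict; rewrite -!compA -!tens1M; congr (_ ∘ (_ ⊗m _)).
rewrite [LHS]compA -(st_nat g') /= -compA -!tens1M.
by rewrite (st_nat h').
Qed.

Lemma ra_fm_tc P P' P'' x Q Q' Q'' (g : mor P' P'') (h : mor Q' Q'') :
  ra P P'' x Q'' Q ∘ fm P Q (tc g h x) = tc (idm P ⊗m g) (h ⊗m idm Q) x ∘ ra P P' x Q' Q.
Proof. by rewrite -ra_tc tc1 comp1l. Qed.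

Lemma ra_tc_act P P' P'' x Q Q' Q'' (g : mor P P'') (h : mor Q Q'') :
  ra P'' P' x Q' Q'' ∘ tc g h (act P' Q' x) = tc (g ⊗m idm P') (idm Q' ⊗m h) x ∘ ra P P' x Q' Q.
Proof. by rewrite -ra_tc tc1 fm1 comp1r. Qed.

(** Since [ra] is unitary, the intertwining relations above can be turned into relations for
    [ra^†]. *)
Lemma fm_tc_ra P P' P'' x Q Q' Q'' (g : mor P' P'') (h : mor Q' Q'') :
  fm P Q (tc g h x) ∘ (ra P P' x Q' Q)^† =
  (ra P P'' x Q'' Q)^† ∘ tc (idm P ⊗m g) (h ⊗m idm Q) x.
Proof.
rewrite -[LHS]comp1l -raK -[LHS]compA [ra _ _ _ _ _ ∘ _]compA ra_fm_tc.
by rewrite -compA raKV comp1r.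
Qed.

Lemma tc_act_ra P P' P'' x Q Q' Q'' (g : mor P P'') (h : mor Q Q'') :
  tc g h (act P' Q' x) ∘ (ra P P' x Q' Q)^† =
  (ra P'' P' x Q' Q'')^† ∘ tc (g ⊗m idm P') (idm Q' ⊗m h) x.
Proof.
rewrite -[LHS]comp1l -raK -[LHS]compA [ra _ _ _ _ _ ∘ _]compA ra_tc_act.
by rewrite -compA raKV comp1r.
Qed.

Lemma fm_ra P P' x y Q' Q (f : mor x y) :
  fm P Q (fm P' Q' f) ∘ (ra P P' x Q' Q)^† =
  (ra P P' y Q' Q)^† ∘ fm (P ⊗ P') (Q' ⊗ Q) f.
Proof.
rewrite -[LHS]comp1l -raK -[LHS]compA [ra _ _ _ _ _ ∘ _]compA ra_nat.
by rewrite -compA raKV comp1r.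
Qed.

Lemma ra_pdl P x Q :
  ra tunit P x Q tunit ∘ pd (act P Q x) = tc (lunit P)^† (runit Q)^† x.
Proof. by rewrite /ra /pd -!lock /reassoc /pad; strict. Qed.

Lemma ra_pdr P x Q :
  ra P tunit x tunit Q ∘ fm P Q (pd x) = tc (runit P)^† (lunit Q)^† x.
Proof. by rewrite /ra /pd -!lock /reassoc /pad; strict. Qed.

(** The pentagon of the action: absorbing three pairs of legs in either order differs only by
    associators on the legs, which a bracket passes from one argument to the other. *)
Lemma ra3 P P' P'' x Q'' Q' Q :
  ra (P ⊗ P') P'' x Q'' (Q' ⊗ Q) ∘ ra P P' (P'' ⊗ (x ⊗ Q'')) Q' Q =
  ((assoc P P' P'')^† ⊗m (idm x ⊗m assoc Q'' Q' Q)) ∘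
  (ra P (P' ⊗ P'') x (Q'' ⊗ Q') Q ∘ fm P Q (ra P' P'' x Q'' Q')).
Proof. by rewrite /ra -!lock /reassoc; strict. Qed.
End Act.

(** * Semilinear maps and tensors *)

Section LinearMaps.
Variable C : fieldType.
Implicit Types (U V W : vectType C) (L M N : lmodType C).

Section Semilinear.
Variables (s : {rmorphism C -> C}) (L M : lmodType C).
(** One notion for linear maps ([idfun]) and antilinear ones ([Num.conj]), so that the structure
    maps and the star share their lemmas. *)
Definition slin (f : L -> M) := forall k x y, f (k *: x + y) = s k *: f x + f y.
Variables (f : L -> M).
Hypothesis fl : slin f.

Lemma slin0 : f 0 = 0.
Proof.
by have /esym/eqP := fl 1 0 0; rewrite scaler0 addr0 rmorph1 scale1r -subr_eq0 addrK => /eqP.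
Qed.
Lemma slinZ k x : f (k *: x) = s k *: f x.
Proof. by have := fl k x 0; rewrite !addr0 slin0 addr0. Qed.
Lemma slinD x y : f (x + y) = f x + f y.
Proof. by have := fl 1 x y; rewrite rmorph1 !scale1r. Qed.
Lemma slin_sum (I : Type) (r : seq I) (P : pred I) (F : I -> L) :
  f (\sum_(i <- r | P i) F i) = \sum_(i <- r | P i) f (F i).
Proof. exact: (big_morph f slinD slin0). Qed.
Lemma slinN x : f (- x) = - f x.
Proof. by rewrite -scaleN1r slinZ rmorphN rmorph1 scaleN1r. Qed.
End Semilinear.

Definition lin L M (f : L -> M) := forall k x y, f (k *: x + y) = k *: f x + f y.

Section Lin.
Variables (L M : lmodType C) (f : L -> M).
Hypothesis fl : lin f.
Let fs : slin idfun f := fl.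
Lemma lin0 : f 0 = 0. Proof. exact: (slin0 fs). Qed.
Lemma linZ k x : f (k *: x) = k *: f x. Proof. exact: (slinZ fs). Qed.
Lemma linD x y : f (x + y) = f x + f y. Proof. exact: (slinD fs). Qed.
Lemma linN x : f (- x) = - f x. Proof. exact: (slinN fs). Qed.
Lemma lin_sum (I : Type) (r : seq I) (P : pred I) (F : I -> L) :
  f (\sum_(i <- r | P i) F i) = \sum_(i <- r | P i) f (F i).
Proof. exact: (slin_sum fs). Qed.
End Lin.

Lemma lin_id L : lin (fun x : L => x). Proof. by []. Qed.
Lemma lin_locked L M (f : L -> M) : lin f -> lin (fun x => locked (f x)).
Proof. by move=> fl k x y; rewrite -!lock. Qed.
Lemma lin_comp L M N (f : M -> N) (g : L -> M) : lin f -> lin g -> lin (fun x => f (g x)).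
Proof. by move=> fl gl k x y; rewrite gl fl. Qed.
Lemma lin_bigsum L M (I : Type) (r : seq I) (P : pred I) (F : I -> L -> M) :
  (forall i, lin (F i)) -> lin (fun x => \sum_(i <- r | P i) F i x).
Proof.
move=> Fl k x y; rewrite scaler_sumr -big_split; apply: eq_bigr => i _.
exact: Fl.
Qed.
Lemma lin_add L M (f g : L -> M) : lin f -> lin g -> lin (fun x => f x + g x).
Proof. by move=> fl gl k x y; rewrite fl gl scalerDr addrACA. Qed.
Lemma lin_scale L M (c : C) (f : L -> M) : lin f -> lin (fun x => c *: f x).
Proof. by move=> fl k x y; rewrite fl scalerDr !scalerA mulrC. Qed.
Lemma lin_scalel L M (f : L -> C^o) (m : M) : lin f -> lin (fun x => f x *: m).
Proof. by move=> fl k x y; rewrite fl scalerDl -scalerA. Qed.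
Lemma lin_mull L (f : L -> C^o) (c : C) : lin f -> lin (fun x => f x * c : C^o).
Proof. by move=> fl k x y; rewrite fl mulrDl -scalerAl. Qed.
Lemma lin_mulr L (f : L -> C^o) (c : C) : lin f -> lin (fun x => c * f x : C^o).
Proof. by move=> fl k x y; rewrite fl mulrDr; congr (_ + _); apply: mulrCA. Qed.

Lemma lin_coord V n (b : n.-tuple V) i : lin (fun v => coord b i v : C^o).
Proof. by move=> k x y; rewrite linearP. Qed.

Lemma lin_tpurel V W (w : W) : lin (fun v : V => tpure v w).
Proof. by move=> k x y; apply/matrixP => i j; rewrite !mxE linearP mulrDl mulrA. Qed.
Lemma lin_tpurer V W (v : V) : lin (fun w : W => tpure v w).
Proof. by move=> k x y; apply/matrixP => i j; rewrite !mxE linearP mulrDr mulrCA. Qed.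

Lemma slin_tlift_for (s : {rmorphism C -> C}) V W L (b : V -> W -> L) :
  slin s (tlift_for s b).
Proof.
move=> k x y; rewrite /tlift_for scaler_sumr -big_split; apply: eq_bigr => i _ /=.
rewrite scaler_sumr -big_split; apply: eq_bigr => j _ /=.
by rewrite !mxE rmorphD rmorphM scalerDl scalerA.
Qed.
Lemma lin_tlift V W L (b : V -> W -> L) : lin (tlift b).
Proof. exact: (@slin_tlift_for idfun). Qed.

Lemma lin_tlift_fun V W L M (b : L -> V -> W -> M) (t : tensor V W) :
  (forall v w, lin (fun x => b x v w)) -> lin (fun x => tlift (b x) t).
Proof.
move=> bl; apply: lin_bigsum => i; apply: lin_bigsum => j.
exact/lin_scale/bl.
Qed.

Lemma coord_vbas V (i j : 'I_(\dim {:V})) : coord (vbas V) i (vbas V)`_j = (i == j)%:R.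
Proof. by rewrite coord_free ?(basis_free (vbasisP _)) // eq_sym. Qed.

Lemma tpure_span V W (t : tensor V W) :
  t = \sum_i \sum_j (t : 'M_(_, _)) i j *: tpure (vbas V)`_i (vbas W)`_j.
Proof.
apply/matrixP => i j; rewrite summxE (bigD1 i) //= summxE (bigD1 j) //= !mxE.
rewrite !coord_vbas !eqxx !mulr1 !big1 ?addr0 // => [k ki|k kj]; last first.
  by rewrite !mxE !coord_vbas [j == k]eq_sym (negPf kj) !mulr0.
rewrite summxE big1 // => l _.
by rewrite !mxE !coord_vbas [i == k]eq_sym (negPf ki) mul0r mulr0.
Qed.

Lemma tensor_ind V W (P : tensor V W -> Prop) :
  (forall k x y, P x -> P y -> P (k *: x + y)) ->
  (forall v w, P (tpure v w)) -> forall t, P t.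
Proof.
move=> Pl Pp t; have P0 : P 0.
  by have := Pl (-1) _ _ (Pp 0 0) (Pp 0 0); rewrite scaleN1r addNr.
have PD x y : P x -> P y -> P (x + y) by move=> Px; rewrite -[x]scale1r; apply: Pl.
rewrite [t]tpure_span; elim/big_ind: _ => // i _; elim/big_ind: _ => // j _.
by rewrite -[_ *: _]addr0; apply: Pl.
Qed.

Lemma tliftE V W L (b : V -> W -> L) v w :
  (forall w, lin (b ^~ w)) -> (forall v, lin (b v)) -> tlift b (tpure v w) = b v w.
Proof. exact: tlift_pure. Qed.

Lemma lin_tmap V V' W W' (f : V -> V') (g : W -> W') : lin (tmap f g).
Proof. exact: lin_tlift. Qed.
Lemma tmapE V V' W W' (f : V -> V') (g : W -> W') v w : lin f -> lin g ->
  tmap f g (tpure v w) = tpure (f v) (g w).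
Proof.
move=> fl gl; rewrite /tmap tliftE // => ?; first exact: (lin_comp (lin_tpurel _)).
exact: (lin_comp (lin_tpurer _)).
Qed.

Lemma lin_tassoc U V W : lin (@tassoc C U V W).
Proof. exact: lin_tlift. Qed.
Lemma tassocE U V W (u : U) (v : V) (w : W) :
  tassoc (tpure (tpure u v) w) = tpure u (tpure v w).
Proof.
have tE : forall (w0 : W), tlift (fun u v => tpure u (tpure v w0)) (tpure u v) = tpure u (tpure v w0).
  move=> w0; rewrite tliftE // => ?; first exact: lin_tpurel.
  by apply: lin_comp (lin_tpurer _) _; apply: lin_tpurel.
rewrite /tassoc tliftE ?tE // => [w'|uv]; first exact: lin_tlift.
apply: lin_tlift_fun => u' v'.
by apply: lin_comp (lin_tpurer _) _; apply: lin_tpurer.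
Qed.

Lemma lin_tmull V W (mV : V -> V -> V) (mW : W -> W -> W) t' : lin (fun t => tmul mV mW t t').
Proof. exact: lin_tlift. Qed.
Lemma lin_tmulr V W (mV : V -> V -> V) (mW : W -> W -> W) t : lin (tmul mV mW t).
Proof. by apply: lin_tlift_fun => v w; apply: lin_tlift. Qed.
Lemma tmulE V W (mV : V -> V -> V) (mW : W -> W -> W) v w v' w' :
  (forall y, lin (mV ^~ y)) -> (forall x, lin (mV x)) ->
  (forall y, lin (mW ^~ y)) -> (forall x, lin (mW x)) ->
  tmul mV mW (tpure v w) (tpure v' w') = tpure (mV v v') (mW w w').
Proof.
move=> Vl Vr Wl Wr.
have E a b : tlift (fun v' w' => tpure (mV a v') (mW b w')) (tpure v' w') =
    tpure (mV a v') (mW b w').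
  apply: tliftE => c; first exact: lin_comp (lin_tpurel _) (Vr _).
  exact: lin_comp (lin_tpurer _) (Wr _).
rewrite /tmul tliftE ?E // => ?; apply: lin_tlift_fun => a b.
  exact: lin_comp (lin_tpurel _) (Vl _).
exact: lin_comp (lin_tpurer _) (Wl _).
Qed.

Lemma lin_dinj (I : finType) (V : I -> vectType C) i : lin (@dinj C I V i).
Proof.
move=> k x y; apply/ffunP => s; rewrite !ffunE.
case: s => j m; case: (eqVneq j i) => [ji|ji]; last by rewrite !untag_dflt ?scaler0 ?addr0.
by subst j; rewrite !untagE linearP.
Qed.

Lemma slin_dlift_for (s : {rmorphism C -> C}) (I : finType) (V : I -> vectType C)
    L (F : forall i, V i -> L) : slin s (dlift_for s F).
Proof.
move=> k x y; rewrite /dlift_for scaler_sumr -big_split; apply: eq_bigr => i _ /=.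
by rewrite !ffunE rmorphD rmorphM scalerDl scalerA.
Qed.

Lemma dinj_span (I : finType) (V : I -> vectType C) (x : dsum V) :
  x = \sum_k (x : {ffun _ -> _}) k *: dinj (vbas (V (tag k)))`_(tagged k).
Proof.
apply/ffunP => -[i m]; rewrite sum_ffunE (bigD1 (Tagged (fun i => 'I_(\dim {:V i})) m)) //= !ffunE.
rewrite untagE coord_vbas eqxx [_ *: _]mulr1 big1 ?addr0 // => -[j l] jl.
rewrite !ffunE /=; case: (eqVneq i j) => [ij|ij]; last by rewrite untag_dflt ?scaler0.
subst j; rewrite untagE coord_vbas; case: (eqVneq m l) jl => [->|_ _]; first by case/eqP.
by rewrite scaler0.
Qed.

(** [P 0] is a separate premise because the index type may be empty; in [tensor_ind] it follows from
    the pure tensor of zeros. *)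
Lemma dsum_ind (I : finType) (V : I -> vectType C) (P : dsum V -> Prop) :
  P 0 -> (forall k x y, P x -> P y -> P (k *: x + y)) ->
  (forall i (v : V i), P (dinj v)) -> forall x, P x.
Proof.
move=> P0 Pl Pp x.
have PD y z : P y -> P z -> P (y + z) by move=> Py; rewrite -[y]scale1r; apply: Pl.
rewrite [x]dinj_span; elim/big_ind: _ => // i _.
by rewrite -[_ *: _]addr0; apply: Pl.
Qed.
End LinearMaps.

Section MorLin.
Variables (R : realType) (D : daggerMonCat R) (L : lmodType R[i]).
Implicit Types x y z : D.

Lemma lin_compl x y z (f : L -> mor y z) (g : mor x y) :
  lin f -> lin (fun u => f u ∘ g).
Proof. exact: (lin_comp (comp_linl g)). Qed.
Lemma lin_compr x y z (g : mor y z) (f : L -> mor x y) :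
  lin f -> lin (fun u => g ∘ f u).
Proof. exact: (lin_comp (comp_linr g)). Qed.
Lemma lin_tensl x x' y y' (f : L -> mor x x') (g : mor y y') :
  lin f -> lin (fun u => f u ⊗m g).
Proof. exact: (lin_comp (tensm_linl g)). Qed.
Lemma lin_tensr x x' y y' (f : mor x x') (g : L -> mor y y') :
  lin g -> lin (fun u => f ⊗m g u).
Proof. exact: (lin_comp (tensm_linr f)). Qed.
End MorLin.

Section Dagger.
Variables (R : realType) (D : daggerMonCat R).
Implicit Types x y z : D.

Lemma slin_dag x y : slin Num.conj (fun f : mor x y => f^†).
Proof. move=> k f g; exact: dag_antilin. Qed.
Lemma dagZ x y k (f : mor x y) : (k *: f)^† = k^* *: f^†.
Proof. exact: (slinZ (@slin_dag x y)). Qed.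
Lemma dag0 x y : (0 : mor x y)^† = 0.
Proof. exact: (slin0 (@slin_dag x y)). Qed.
Lemma dag_sum x y (I : Type) (r : seq I) (P : pred I) (F : I -> mor x y) :
  (\sum_(i <- r | P i) F i)^† = \sum_(i <- r | P i) (F i)^†.
Proof. exact: (slin_sum (@slin_dag x y)). Qed.

Lemma compDr x y z (g : mor y z) (f f' : mor x y) : g ∘ (f + f') = g ∘ f + g ∘ f'.
Proof. exact: (linD (comp_linr g)). Qed.
Lemma compBr x y z (g : mor y z) (f f' : mor x y) : g ∘ (f - f') = g ∘ f - g ∘ f'.
Proof. by rewrite compDr (linN (comp_linr g)). Qed.
Lemma comp_bigl x y z (I : Type) (r : seq I) (P : pred I) (g : I -> mor y z) (f : mor x y) :
  (\sum_(i <- r | P i) g i) ∘ f = \sum_(i <- r | P i) g i ∘ f.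
Proof. exact: (lin_sum (comp_linl f)). Qed.
Lemma comp_bigr x y z (I : Type) (r : seq I) (P : pred I) (g : mor y z) (f : I -> mor x y) :
  g ∘ (\sum_(i <- r | P i) f i) = \sum_(i <- r | P i) g ∘ f i.
Proof. exact: (lin_sum (comp_linr g)). Qed.
Lemma tensZl x x' y y' k (f : mor x x') (g : mor y y') : (k *: f) ⊗m g = k *: (f ⊗m g).
Proof. exact: (linZ (tensm_linl g)). Qed.
Lemma tensZr x x' y y' k (f : mor x x') (g : mor y y') : f ⊗m (k *: g) = k *: (f ⊗m g).
Proof. exact: (linZ (tensm_linr f)). Qed.
Lemma tens0l x x' y y' (g : mor y y') : (0 : mor x x') ⊗m g = 0.
Proof. exact: (lin0 (tensm_linl g)). Qed.
Lemma tens0r x x' y y' (f : mor x x') : f ⊗m (0 : mor y y') = 0.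
Proof. exact: (lin0 (tensm_linr f)). Qed.
Lemma tens_suml x x' y y' (I : Type) (r : seq I) (P : pred I) (f : I -> mor x x') (g : mor y y') :
  (\sum_(i <- r | P i) f i) ⊗m g = \sum_(i <- r | P i) f i ⊗m g.
Proof. exact: (lin_sum (tensm_linl g)). Qed.
Lemma tens_sumr x x' y y' (I : Type) (r : seq I) (P : pred I) (f : mor x x') (g : I -> mor y y') :
  f ⊗m (\sum_(i <- r | P i) g i) = \sum_(i <- r | P i) f ⊗m g i.
Proof. exact: (lin_sum (tensm_linr f)). Qed.
End Dagger.

(** * Simple objects and scalars *)

Section Simples.
Variables (R : realType) (D : daggerMonCat R) (X : simples D).
Local Notation C := R[i].
Implicit Types (x y z : D) (a b c k : X).

Definition sc k (f : mor (irr k) (irr k)) : C := coord [tuple idm (irr k)] 0 f.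

Lemma irr_id_neq0 k : idm (irr k) != 0.
Proof. by apply/eqP; case: (irr_simple k). Qed.

Lemma sc_id k : sc (idm (irr k)) = 1.
Proof.
have fr : free [tuple idm (irr k)] by rewrite /= seq1_free irr_id_neq0.
have := coord_free (0 : 'I_1) (0 : 'I_1) fr.
by rewrite eqxx /=.
Qed.

Lemma lin_sc k : lin (fun f : mor (irr k) (irr k) => sc f : C^o).
Proof. exact: lin_coord. Qed.

Lemma scZ k (t : C) (f : mor (irr k) (irr k)) : sc (t *: f) = t * sc f.
Proof. exact: (linZ (@lin_sc k)). Qed.
Lemma sc_sum k (I : Type) (r : seq I) (P : pred I) (F : I -> mor (irr k) (irr k)) :
  sc (\sum_(i <- r | P i) F i) = \sum_(i <- r | P i) sc (F i).
Proof. exact: (lin_sum (@lin_sc k)). Qed.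
Lemma sc0 k : sc (0 : mor (irr k) (irr k)) = 0.
Proof. exact: (lin0 (@lin_sc k)). Qed.

Lemma scE k (f : mor (irr k) (irr k)) : f = sc f *: idm (irr k).
Proof.
have [c ->] := (irr_simple k).2 f.
by rewrite scZ sc_id mulr1.
Qed.

Lemma sc_comp k (f g : mor (irr k) (irr k)) : sc (f ∘ g) = sc f * sc g.
Proof. by rewrite [f in LHS]scE compZl comp1l scZ. Qed.

Lemma sc_dag k (f : mor (irr k) (irr k)) : sc f^† = (sc f)^*.
Proof. by rewrite [f in LHS]scE dagZ dag_id scZ sc_id mulr1. Qed.

Lemma sc_inj k (f g : mor (irr k) (irr k)) : sc f = sc g -> f = g.
Proof. by move=> fg; rewrite [f]scE [g]scE fg. Qed.

Lemma hom_irr0 a b (f : mor (irr a) (irr b)) : a != b -> f = 0.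
Proof.
move=> ab; apply: contrapT => f0; case/eqP: ab.
exact/irr_inj/(schur (irr_simple a) (irr_simple b) f0).
Qed.

(** The square root axiom replaces [f] by an endomorphism of the simple object, where the expression
    is the squared modulus of a scalar. *)
Lemma sc_ge0 k z (f : mor (irr k) z) : 0 <= sc (f^† ∘ f).
Proof.
have [g ->] := dag_sqrt f.
by rewrite sc_comp sc_dag mulrC mul_conjC_ge0.
Qed.

Lemma sc_eq0 k z (f : mor (irr k) z) : sc (f^† ∘ f) = 0 -> f = 0.
Proof. by move=> f0; apply: dag_pos; rewrite [LHS]scE f0 scale0r. Qed.

Lemma delta_id a : delta_mor a a = idm (irr a).
Proof. by rewrite /delta_mor; case: eqP => // e; rewrite (eq_irrelevance e erefl). Qed.

Lemma delta_neq a b : a != b -> delta_mor a b = 0.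
Proof. by rewrite /delta_mor; case: eqP. Qed.

End Simples.

Lemma lin_sc' (R : realType) (D : daggerMonCat R) (X : simples D) (L : lmodType R[i]) (k : X)
  (f : L -> mor (irr k) (irr k)) : lin f -> lin (fun u => sc (f u) : R[i]^o).
Proof. exact: (lin_comp (@lin_sc _ _ _ _)). Qed.

Ltac lin_step := match goal with
  | |- lin (fun x => x) => exact: lin_id
  | |- lin (fun x => comp (@?f x) ?g) => apply: lin_compl
  | |- lin (fun x => comp ?g (@?f x)) => apply: lin_compr
  | |- lin (fun x => tensm (@?f x) ?g) => apply: lin_tensl
  | |- lin (fun x => tensm ?g (@?f x)) => apply: lin_tensr
  | |- lin (fun x => tpure (@?f x) ?g) => apply: (lin_comp (lin_tpurel _))
  | |- lin (fun x => tpure ?g (@?f x)) => apply: (lin_comp (lin_tpurer _))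
  | |- lin (fun x => \sum_(i <- _ | _) _) => apply: lin_bigsum => ?
  | |- lin (fun x => locked (@?f x)) => apply: lin_locked
  | |- lin (fun x => (@?f x) + (@?g x)) => apply: lin_add
  | |- lin (fun x => ?c *: (@?g x)) => apply: lin_scale
  | |- lin (fun x => (@?g x) *: ?c) => apply: lin_scalel
  | |- lin (fun x => (@?g x) * ?c) => apply: lin_mull
  | |- lin (fun x => ?c * (@?g x)) => apply: lin_mulr
  | |- lin (fun x => sc (@?g x)) => apply: lin_sc'
  | |- lin (fun x => tlift ?b (@?g x)) => apply: (lin_comp (lin_tlift _))
  | |- lin (comp _) => exact: comp_linr
  | |- lin (tensm _) => exact: tensm_linr
  | |- lin (tpure _) => exact: lin_tpurer
  | H : forall _, lin _ |- lin _ => exact: H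
  | H : forall _, lin _ |- lin _ => apply: (lin_comp (H _))
  end.
Ltac lin_hook := fail.
Ltac lin := repeat (cbv beta; first [lin_hook | lin_step]).

(** * Coend sums *)

Section CoendSums.
Variables (R : realType) (D : daggerMonCat R) (X : simples D).
Hypothesis HD : unitary_multifusion D.
Variable (B : forall (k : X) (z : D), dual_bases k z).
Local Notation C := R[i].
Implicit Types (x y z : D) (a b c k : X) (L : lmodType C).

Lemma dbv_expand k z (f : mor (irr k) z) :
  f = \sum_(p < dbsize (B k z)) sc (tnth (dbd (B k z)) p ∘ f) *: tnth (dbv (B k z)) p.
Proof.
rewrite [LHS](coord_basis (dbv_basis (B k z)) (memvf f)).
apply: eq_bigr => i _; rewrite -tnth_nth; congr (_ *: _).
rewrite [in RHS](coord_basis (dbv_basis (B k z)) (memvf f)) comp_sumr sc_sum.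
rewrite (bigD1 i) //= big1 => [|j ji].
  by rewrite addr0 compZr -tnth_nth db_dual eqxx scale1r scZ sc_id mulr1.
by rewrite compZr -tnth_nth db_dual eq_sym (negPf ji) scale0r scaler0 sc0.
Qed.

Lemma dbd_expand k z (g : mor z (irr k)) :
  g = \sum_(p < dbsize (B k z)) sc (g ∘ tnth (dbv (B k z)) p) *: tnth (dbd (B k z)) p.
Proof.
rewrite [LHS](coord_basis (dbd_basis (B k z)) (memvf g)).
apply: eq_bigr => i _; rewrite -tnth_nth; congr (_ *: _).
rewrite [in RHS](coord_basis (dbd_basis (B k z)) (memvf g)) comp_suml sc_sum.
rewrite (bigD1 i) //= big1 => [|j ji].
  by rewrite addr0 compZl -tnth_nth db_dual eqxx scale1r scZ sc_id mulr1.
by rewrite compZl -tnth_nth db_dual (negPf ji) scale0r scaler0 sc0.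
Qed.

Definition bilin (V W : lmodType C) L (b : V -> W -> L) :=
  (forall w, lin (b ^~ w)) /\ (forall v, lin (b v)).

(* The image in [L] of the class of [(id, id)] in the coend of
   [mor z k ⊗ mor k z'] at [z = z']. *)
Definition csum z L (F : forall k, mor z (irr k) -> mor (irr k) z -> L) : L :=
  \sum_k \sum_(p < dbsize (B k z)) F k (tnth (dbd (B k z)) p) (tnth (dbv (B k z)) p).

Lemma eq_csum z L (F G : forall k, mor z (irr k) -> mor (irr k) z -> L) :
  (forall k d v, F k d v = G k d v) -> csum F = csum G.
Proof. by move=> FG; apply: eq_bigr => k _; apply: eq_bigr => p _; apply: FG. Qed.

(** Dinaturality. Expanding [d ∘ g] on one side and [g ∘ v] on the other produces the same matrix of
    [g] in the chosen bases. *)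
Lemma csum_nat z z' (g : mor z z') L (F : forall k, mor z (irr k) -> mor (irr k) z' -> L) :
  (forall k, bilin (F k)) ->
  csum (fun k d v => F k (d ∘ g) v) = csum (fun k d v => F k d (g ∘ v)).
Proof.
move=> Fb; apply: eq_bigr => k _; have [Fl Fr] := Fb k.
under eq_bigr => p _ do rewrite [tnth _ p ∘ g]dbd_expand (lin_sum (Fl _)).
under [RHS]eq_bigr => p _ do rewrite [g ∘ _]dbv_expand (lin_sum (Fr _)).
rewrite exchange_big; apply: eq_bigr => p _; apply: eq_bigr => q _.
by rewrite (linZ (Fl _)) (linZ (Fr _)) compA.
Qed.

Lemma csum_irr a L (F : forall k, mor (irr a) (irr k) -> mor (irr k) (irr a) -> L) :
  (forall k, bilin (F k)) -> csum F = F a (idm _) (idm _).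
Proof.
move=> Fb; rewrite /csum (bigD1 a) //= [X in _ + X]big1 ?addr0 => [|k ka]; last first.
  apply: big1 => p _; rewrite [tnth (dbd _) p]hom_irr0 1?eq_sym //.
  exact: (lin0 ((Fb k).1 _)).
have [Fl Fr] := Fb a.
rewrite [X in F a X _](dbd_expand (idm _)) (lin_sum (Fl _)); apply: eq_bigr => p _.
rewrite comp1l (linZ (Fl _)) -(linZ (Fr _)); congr (F a _ _).
exact: scE.
Qed.

(** By semisimplicity it suffices to test on morphisms out of simple objects, where the sum is the
    basis expansion. *)
Lemma csum_id z : csum (fun k d v => v ∘ d) = idm z.
Proof.
have [n [s [p [ss [p1 p0 pz]]]]] := umfc_semisimple HD z.
have E k (f : mor (irr k) z) : csum (fun k (d : mor z (irr k)) v => v ∘ d) ∘ f = f.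
  rewrite /csum comp_suml (bigD1 k) //= [X in _ + X]big1 ?addr0 => [|l lk]; last first.
    rewrite comp_suml big1 // => i _.
    by rewrite -compA [_ ∘ f]hom_irr0 ?comp0r // eq_sym.
  rewrite comp_suml [RHS]dbv_expand; apply: eq_bigr => q _.
  by rewrite -compA [_ ∘ f]scE compZr comp1r scZ sc_id mulr1.
rewrite -[LHS]comp1r -[in LHS]pz comp_sumr -[RHS]pz; apply: eq_bigr => i _.
rewrite compA; congr (_ ∘ _).
have [k [f [g [gf fg]]]] := irr_surj X (ss i).
by rewrite -[p i]comp1r -gf [p i ∘ _]compA compA E.
Qed.

(** Any resolution of the identity through simple objects computes the coend sum. This is what
    allows bent bases, other dual bases and the decomposition of the unit to be substituted for
    [B]. *)
Lemma csum_decomp z (I : finType) (k_ : I -> X) (r : forall i, mor (irr (k_ i)) z)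
    (s : forall i, mor z (irr (k_ i))) L (F : forall k, mor z (irr k) -> mor (irr k) z -> L) :
  (forall k, bilin (F k)) ->
  \sum_i r i ∘ s i = idm z -> csum F = \sum_i F (k_ i) (s i) (r i).
Proof.
move=> Fb rs; transitivity (csum (fun k d v => F k (d ∘ (\sum_i r i ∘ s i)) v)).
  by apply: eq_csum => k d v; rewrite rs comp1r.
transitivity (\sum_i csum (fun k (d : mor z (irr k)) v => F k (d ∘ (r i ∘ s i)) v)).
  rewrite /csum [RHS]exchange_big; apply: eq_bigr => k _.
  rewrite [RHS]exchange_big; apply: eq_bigr => p _.
  by rewrite comp_sumr (lin_sum ((Fb k).1 _)).
apply: eq_bigr => i _.
transitivity (csum (fun k (d : mor z (irr k)) v => (fun d' v' => F k (d' ∘ s i) v') (d ∘ r i) v)).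
  by apply: eq_csum => k d v; rewrite compA.
rewrite (csum_nat (r i) (F := fun k d' v' => F k (d' ∘ s i) v')); last first.
  by move=> k; have [Fl Fr] := Fb k; split=> u; lin.
rewrite csum_irr ?comp1l ?comp1r // => k; have [Fl Fr] := Fb k.
by split=> u; lin.
Qed.
End CoendSums.

(** * Duals and the quantum trace *)

Section Duality.
Variables (R : realType) (D : daggerMonCat R).
Implicit Types x y z w : D.

Section Snakes.
Variables (x xb : D) (c : mor tunit (x ⊗ xb)) (e : mor (xb ⊗ x) tunit).
Hypothesis zz : zigzag c e.

Lemma snake1 z : (idm x ⊗m st e z) ∘ st c (x ⊗ z) = idm _.
Proof.
have /(congr1 (fun f => st f z)) := zz.1.
by rewrite !stE /= ?(dag_id, comp1l, comp1r, tensm_id).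
Qed.

Lemma snake2 z : st e (xb ⊗ z) ∘ (idm xb ⊗m st c z) = idm _.
Proof.
have /(congr1 (fun f => st f z)) := zz.2.
by rewrite !stE /= ?(dag_id, comp1l, comp1r, tensm_id).
Qed.

Lemma zigzag_flip : zigzag e^† c^†.
Proof.
case: zz => /(congr1 (@dag _ _ _ _)) z1 /(congr1 (@dag _ _ _ _)) z2; split.
  by rewrite -[RHS]dag_id -z2 !dag_comp !tensm_dag !dagK !dag_id !compA.
by rewrite -[RHS]dag_id -z1 !dag_comp !tensm_dag !dagK !dag_id !compA.
Qed.

Definition etaL z : mor z (xb ⊗ (x ⊗ z)) := locked (assoc xb x z ∘ (e^† ⊗m idm z) ∘ (lunit z)^†).
Definition etaR z : mor z ((z ⊗ x) ⊗ xb) := locked ((assoc z x xb)^† ∘ (idm z ⊗m c) ∘ (runit z)^†).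
Definition ptrL z (T : mor (x ⊗ z) (x ⊗ z)) : mor z z :=
  locked ((etaL z)^† ∘ (idm xb ⊗m T) ∘ etaL z).
Definition ptrR z (T : mor (z ⊗ x) (z ⊗ x)) : mor z z :=
  locked ((etaR z)^† ∘ (T ⊗m idm xb) ∘ etaR z).

End Snakes.

Section DualMorphism.
Variables (x xb : D) (c : mor tunit (x ⊗ xb)) (e : mor (xb ⊗ x) tunit).
Variables (y yb : D) (c' : mor tunit (y ⊗ yb)) (e' : mor (yb ⊗ y) tunit).

(** The transpose with respect to arbitrary duals of source and target: besides the duals chosen by
    [spherical], it is applied to duals of products and to flipped duals. *)
Definition dualm (g : mor x y) : mor yb xb :=
  locked (lunit xb ∘ (e' ⊗m idm xb) ∘ (assoc yb y xb)^† ∘ (idm yb ⊗m ((g ⊗m idm xb) ∘ c)) ∘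
  (runit yb)^†).

Definition undualm (u : mor yb xb) : mor x y :=
  locked (runit y ∘ (idm y ⊗m e) ∘ assoc y xb x ∘ (((idm y ⊗m u) ∘ c') ⊗m idm x) ∘ (lunit x)^†).

Lemma lin_dualm : lin dualm.
Proof. by rewrite /dualm; lin. Qed.

Lemma dualm_coev g : zigzag c' e' -> (idm y ⊗m dualm g) ∘ c' = (g ⊗m idm xb) ∘ c.
Proof.
move=> zz'; rewrite /dualm -!lock; strict.
by rewrite tens1M -compA -[in LHS](st_nat c') /= [LHS]compA snake1 // comp1l.
Qed.

Lemma dualm_ev g : zigzag c e -> e' ∘ (idm yb ⊗m g) = e ∘ (dualm g ⊗m idm x).
Proof.
move=> zz; rewrite /dualm -!lock; strict.
rewrite compA -(st_nat e') /= -compA -tens1M; congr (_ ∘ _); congr (_ ⊗m _).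
by rewrite compA -(st_nat g) /= -compA snake1 // comp1r.
Qed.

(** A snake recovers [u] from its composite with a coevaluation, so identities between transposes
    need only be checked there. *)
Lemma dualm_uniq (u v : mor yb xb) : zigzag c' e' ->
  (idm y ⊗m u) ∘ c' = (idm y ⊗m v) ∘ c' -> u = v.
Proof.
move=> zz' /(congr1 (fun f => st f tunit)); rewrite !stE /= !comp1l => uv.
apply: st_inj.
have E (w : mor yb xb) : st w tunit = st e' (xb ⊗ tunit) ∘
    (idm yb ⊗m ((idm y ⊗m st w tunit) ∘ st c' tunit)).
  by rewrite tens1M compA (st_nat e') /= -compA snake2 // comp1r.
by rewrite [LHS]E [RHS]E uv.
Qed.

Lemma dualmK (u : mor yb xb) : zigzag c e -> zigzag c' e' -> dualm (undualm u) = u.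
Proof.
move=> zz zz'; apply: dualm_uniq => //; rewrite dualm_coev // /undualm -!lock; strict.
have E := st_nat c' (st c tunit); rewrite /= in E.
rewrite -!compA E !compA -!tens1M; congr (_ ∘ _); congr (_ ⊗m _).
by rewrite -compA (st_nat u) /= compA snake2 // comp1l.
Qed.
End DualMorphism.

Lemma dualm_comp x xb (c : mor tunit (x ⊗ xb)) y yb (c' : mor tunit (y ⊗ yb))
    (e' : mor (yb ⊗ y) tunit) z zb (c'' : mor tunit (z ⊗ zb)) (e'' : mor (zb ⊗ z) tunit)
    (g : mor y z) (f : mor x y) : zigzag c' e' -> zigzag c'' e'' ->
  dualm c e'' (g ∘ f) = dualm c e' f ∘ dualm c' e'' g.
Proof.
move=> z' z''; apply: (dualm_uniq z''); rewrite (dualm_coev _ _ z'') tensM1.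
rewrite tens1M -[RHS]compA (dualm_coev _ _ z'') [RHS]compA -[in RHS]tensm_comp [in RHS]comp1l [in RHS]comp1r.
by rewrite [in RHS]tens_split -!compA (dualm_coev _ _ z').
Qed.

Lemma dualm_id x xb (c : mor tunit (x ⊗ xb)) (e : mor (xb ⊗ x) tunit) : zigzag c e ->
  dualm c e (idm x) = idm xb.
Proof. by move=> zz; apply: (dualm_uniq zz); rewrite (dualm_coev _ _ zz). Qed.

Section ProductDual.
Variables (x xb : D) (c : mor tunit (x ⊗ xb)) (e : mor (xb ⊗ x) tunit).
Variables (y yb : D) (c' : mor tunit (y ⊗ yb)) (e' : mor (yb ⊗ y) tunit).

Definition prod_coev : mor tunit ((x ⊗ y) ⊗ (yb ⊗ xb)) :=
  locked ((assoc x y (yb ⊗ xb))^† ∘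
  (idm x ⊗m (assoc y yb xb ∘ (c' ⊗m idm xb) ∘ (lunit xb)^†)) ∘ c).
Definition prod_ev : mor ((yb ⊗ xb) ⊗ (x ⊗ y)) tunit :=
  locked (e' ∘ (idm yb ⊗m (lunit y ∘ (e ⊗m idm y) ∘ (assoc xb x y)^†)) ∘ assoc yb xb (x ⊗ y)).

Lemma prod_zigzag : zigzag c e -> zigzag c' e' -> zigzag prod_coev prod_ev.
Proof.
move=> zz zz'; rewrite /prod_coev /prod_ev -!lock; split; strict.
  have E := st_nat c' (st e (y ⊗ tunit)); rewrite /= in E.
  rewrite compA -tens1M [idm y ⊗m (_ ∘ _)]tens1M -[_ ∘ st c' _]compA -E compA snake1 // comp1l.
  by rewrite snake1.
have E := st_nat e (st c' (xb ⊗ tunit)); rewrite /= in E.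
rewrite -compA -tens1M [idm xb ⊗m (_ ∘ _)]tens1M [X in idm yb ⊗m X]compA E -compA tens1M compA snake2 // comp1l.
by rewrite snake2 // tensm_id.
Qed.

Lemma prod_trR T : prod_coev^† ∘ (T ⊗m idm (yb ⊗ xb)) ∘ prod_coev =
  c^† ∘ (ptrR c' T ⊗m idm xb) ∘ c.
Proof.
by rewrite /prod_coev /ptrR /etaR -!lock; strict; rewrite dag_comp !compA.
Qed.

Lemma prod_trL T : prod_ev ∘ (idm (yb ⊗ xb) ⊗m T) ∘ prod_ev^† =
  e' ∘ (idm yb ⊗m ptrL e T) ∘ e'^†.
Proof.
by rewrite /prod_ev /ptrL /etaL -!lock; strict; rewrite dag_comp tensm_dag dag_id dagK !tens1M !compA.
Qed.

(** Both sides close the x-strand of [T] on the left and the y-strand on the right; only the order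
    of closing differs, so the interchange law suffices. *)
Lemma ptr_spherical T : e ∘ (idm xb ⊗m ptrR c' T) ∘ e^† = c'^† ∘ (ptrL e T ⊗m idm yb) ∘ c'.
Proof.
rewrite /ptrR /ptrL /etaL /etaR -!lock; strict.
have E := st_nat e (st c' tunit)^†; rewrite /= in E.
have E' := congr1 (@dag _ _ _ _) E; rewrite !dag_comp !tensm_dag !dag_id !dagK in E'.
by rewrite dagK tensm_dag dag_id !tens1M !compA E -!compA E' !compA.
Qed.
End ProductDual.

End Duality.

(** * Summands of the unit object *)

Section Units.
Variables (R : realType) (D : daggerMonCat R) (X : simples D).
Local Notation C := R[i].
Implicit Types (x y z : D) (a b k : X) (i j : uidx X).

Lemma uincK i : (uinc i)^† ∘ uinc i = idm _.
Proof. by have [u1 _ _] := unit_decomp X. Qed.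
Lemma uinc_orth i j : i != j -> (uinc i)^† ∘ uinc j = 0.
Proof. by have [_ u0 _] := unit_decomp X; apply: u0. Qed.
Lemma uinc_sum : \sum_(i : uidx X) uinc i ∘ (uinc i)^† = idm (@tunit _ D).
Proof. by have [_ _ us] := unit_decomp X. Qed.

Lemma uinc_neq0 i : uinc i != 0.
Proof.
apply/eqP => u0; have := uincK i; rewrite u0 comp0r => /eqP.
by rewrite eq_sym (negPf (irr_id_neq0 _)).
Qed.

(** Closed diagrams are compared as scalars without first identifying the summands they live on: if
    [i] and [j] differ, orthogonality makes both scalars zero. *)
Lemma unit_scale_inj i j (s t : C) :
  s *: (uinc i ∘ (uinc i)^†) = t *: (uinc j ∘ (uinc j)^†) -> s = t.
Proof.
have K0 (k : uidx X) (r : C) : r *: uinc k = 0 -> r = 0.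
  by move/eqP; rewrite scaler_eq0 (negPf (uinc_neq0 _)) orbF => /eqP.
have H i' j' (r r' : C) : i' != j' ->
    r *: (uinc i' ∘ (uinc i')^†) = r' *: (uinc j' ∘ (uinc j')^†) -> r = 0.
  move=> ij /(congr1 (fun f => f ∘ uinc i')).
  rewrite !compZl -!compA uincK uinc_orth 1?eq_sym // comp0r scaler0 comp1r.
  exact: K0.
have [<-|ij] := eqVneq i j => E; last first.
  by rewrite (H _ _ _ _ ij E) (H j i t s) // eq_sym.
apply/eqP; rewrite -subr_eq0; apply/eqP/(K0 i).
move/(congr1 (fun f => f ∘ uinc i)): E; rewrite !compZl -!compA uincK comp1r.
by rewrite scalerBl => ->; rewrite subrr.
Qed.

(** [v] is a coisometry, and [v^† ∘ v] is a scalar on a simple object that fixes the nonzero [v];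
    hence it is the identity and [v] is an isomorphism. *)
Lemma in_block_of i j (x : X) (v := tc (uinc i)^† (uinc j)^† (irr x) ∘ pd (irr x)) :
  v != 0 -> in_block i j (irr x).
Proof.
move=> v0; exists (irr x); exists v, v^†.
have vv : v ∘ v^† = idm _.
  rewrite /v dag_comp tc_dag !dagK -!compA [pd _ ∘ _]compA pdKV comp1l.
  by rewrite -tcM !uincK tc1.
clearbody v; split=> //; apply: sc_inj; rewrite sc_id.
have : sc (v^† ∘ v) *: v = v.
  by rewrite -[X in _ *: X]comp1r -compZr -scE compA vv comp1l.
move/eqP; rewrite -subr_eq0 -[X in _ - X]scale1r -scalerBl scaler_eq0 (negPf v0) orbF.
by rewrite subr_eq0 => /eqP.
Qed.

Lemma irr_block k : exists i j, in_block i j (irr k).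
Proof.
apply: contrapT => nb; have := irr_id_neq0 k; case/eqP.
suff E : pd (irr k) = 0 by rewrite -pdK E comp0r.
rewrite -[LHS]comp1l -tc1 -uinc_sum tens_suml comp_bigl big1 // => i _.
rewrite !tens_sumr comp_bigl big1 // => j _.
rewrite tcM -compA; apply: contrapT => v0; apply: nb; exists i, j.
by apply: in_block_of; apply/eqP => E; apply: v0; rewrite E comp0r.
Qed.
End Units.

(** * Sphericity, partial traces and the rotation identity *)

Section Spherical.
Variables (R : realType) (D : daggerMonCat R) (X : simples D) (sph : spherical X).
Hypothesis HD : unitary_multifusion D.
Variable (B : forall (k : X) (z : D), dual_bases k z).
Local Notation C := R[i].
Local Notation d_ := (qdim sph).
Local Notation "x ^b" := (bar sph x) (at level 2, format "x ^b").
Implicit Types (x y z : D) (a b k : X) (i j : uidx X).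

Lemma qdim_neq0 k : d_ k != 0.
Proof. by rewrite gt_eqF ?qdim_gt0. Qed.

Lemma coev_norm k : exists i, (coev sph k)^† ∘ coev sph k = d_ k *: (uinc i ∘ (uinc i)^†).
Proof. by have [i [j kij]] := irr_block k; exists i; apply: coev_qdim kij. Qed.
Lemma ev_norm k : exists j, ev sph k ∘ (ev sph k)^† = d_ k *: (uinc j ∘ (uinc j)^†).
Proof. by have [i [j kij]] := irr_block k; exists j; apply: ev_qdim kij. Qed.

Lemma coev_tr k (T : mor (irr k) (irr k)) :
  (coev sph k)^† ∘ (T ⊗m idm _) ∘ coev sph k = sc T *: ((coev sph k)^† ∘ coev sph k).
Proof. by rewrite [T in LHS]scE tensZl tensm_id compZr compZl comp1r. Qed.
Lemma coev_tr' k (T : mor (irr k^b) (irr k^b)) :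
  (coev sph k)^† ∘ (idm _ ⊗m T) ∘ coev sph k = sc T *: ((coev sph k)^† ∘ coev sph k).
Proof. by rewrite [T in LHS]scE tensZr tensm_id compZr compZl comp1r. Qed.
Lemma ev_tr k (T : mor (irr k) (irr k)) :
  ev sph k ∘ (idm _ ⊗m T) ∘ (ev sph k)^† = sc T *: (ev sph k ∘ (ev sph k)^†).
Proof. by rewrite [T in LHS]scE tensZr tensm_id compZr compZl comp1r. Qed.
Lemma ev_tr' k (T : mor (irr k^b) (irr k^b)) :
  ev sph k ∘ (T ⊗m idm _) ∘ (ev sph k)^† = sc T *: (ev sph k ∘ (ev sph k)^†).
Proof. by rewrite [T in LHS]scE tensZl tensm_id compZr compZl comp1r. Qed.

Section Standard.
Variables a b k : X.
Local Notation A := (irr a ⊗ irr b).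
Let cA := prod_coev (coev sph a) (coev sph b).
Let eA := prod_ev (ev sph a) (ev sph b).
Let zA : zigzag cA eA := prod_zigzag (dual_zigzag sph a) (dual_zigzag sph b).
Let zk := dual_zigzag sph k.
Implicit Types f g : mor (irr k) A.

Let l f g := sc (ptrL (ev sph a) (f ∘ g^†)).
Let r f g := sc (ptrR (coev sph b) (f ∘ g^†)).
(** [alpha] and [beta] are the two antilinear bendings, differing in whether the dagger is taken
    before or after transposition. *)
Definition alpha f : mor (irr k^b) (irr b^b ⊗ irr a^b) := dualm cA (ev sph k) f^†.
Definition beta f : mor (irr k^b) (irr b^b ⊗ irr a^b) := (dualm (coev sph k) eA f)^†.

Let lr f g : d_ a * r f g = d_ b * l f g.
Proof.
have := ptr_spherical (ev sph a) (coev sph b) (f ∘ g^†).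
rewrite ev_tr coev_tr.
have [j ->] := ev_norm a; have [i ->] := coev_norm b.
rewrite !scalerA ![_ * d_ _]mulrC; exact: unit_scale_inj.
Qed.

(** Inserting the operator into the loop of [coev k] and sliding it to the other strand turns the
    loop into one over [a ⊗ b], where closing [b] first leaves a scalar on [a]. *)
Let alpha_alpha f g : d_ k * sc ((alpha f)^† ∘ alpha g) = d_ a * r f g.
Proof.
have E h : (idm _ ⊗m alpha h) ∘ coev sph k = (h^† ⊗m idm _) ∘ cA.
  exact: dualm_coev.
have := coev_tr' ((alpha f)^† ∘ alpha g).
rewrite tens1M compA.
have -> : (coev sph k)^† ∘ (idm _ ⊗m (alpha f)^†) = cA^† ∘ (f ⊗m idm _).
  by have := congr1 (@dag _ _ _ _) (E f); rewrite !dag_comp !tensm_dag !dag_id dagK.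
rewrite -compA E compA -[X in X ∘ _]compA -tensM1 prod_trR coev_tr.
have [i ->] := coev_norm a; have [j ->] := coev_norm k.
rewrite !scalerA ![_ * d_ _]mulrC => /esym; exact: unit_scale_inj.
Qed.

Let beta_beta f g : d_ k * sc ((beta f)^† ∘ beta g) = d_ b * l f g.
Proof.
have E h : eA ∘ (idm _ ⊗m h) = ev sph k ∘ ((beta h)^† ⊗m idm _).
  by rewrite dagK; apply: dualm_ev.
have := ev_tr' ((beta f)^† ∘ beta g).
rewrite tensM1 compA -E -!compA.
have -> : (beta g ⊗m idm (irr k)) ∘ (ev sph k)^† = (idm _ ⊗m g^†) ∘ eA^†.
  by have := congr1 (@dag _ _ _ _) (E g); rewrite !dag_comp !tensm_dag !dag_id dagK.
rewrite [idm _ ⊗m f ∘ _]compA -tens1M compA prod_trL ev_tr.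
have [i ->] := ev_norm b; have [j ->] := ev_norm k.
rewrite !scalerA ![_ * d_ _]mulrC => /esym; exact: unit_scale_inj.
Qed.

Let beta_alpha f g : (beta f)^† ∘ alpha g = sc (g^† ∘ f) *: idm _.
Proof.
rewrite dagK /alpha /beta -(dualm_comp _ _ _ zA zk) [g^† ∘ f in LHS]scE.
by rewrite (linZ (lin_dualm _ _)) dualm_id.
Qed.

Lemma alphaD f g : alpha (f - g) = alpha f - alpha g.
Proof.
by rewrite /alpha (slinD (@slin_dag _ _ _ _)) (slinN (@slin_dag _ _ _ _))
  (linD (lin_dualm _ _)) (linN (lin_dualm _ _)).
Qed.
Lemma betaD f g : beta (f - g) = beta f - beta g.
Proof.
by rewrite /beta (linD (lin_dualm _ _)) (linN (lin_dualm _ _))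
  (slinD (@slin_dag _ _ _ _)) (slinN (@slin_dag _ _ _ _)).
Qed.

Lemma alpha_surj u : exists f, alpha f = u.
Proof. by exists (undualm eA (coev sph k) u)^†; rewrite /alpha dagK dualmK. Qed.

(** The Gram form of [alpha] is computed with coevaluations and that of [beta] with evaluations;
    they agree because both kinds of loops have the same value [qdim]. *)
Let alpha_beta_eq f g : sc ((alpha f)^† ∘ alpha g) = sc ((beta f)^† ∘ beta g).
Proof.
apply: (mulfI (qdim_neq0 k)); rewrite alpha_alpha beta_beta; exact: lr.
Qed.

(* If [alpha g = beta f] then [alpha f = beta g] as both antilinear maps have the
   same Gram form; so [x = f - g] satisfies [alpha x = - beta x], and
   [<x, x> = beta(x)^† alpha(x) = - beta(x)^† beta(x)] is both >= 0 and <= 0. *)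
Lemma alpha_beta f : alpha f = beta f.
Proof.
have [g ag] := alpha_surj (beta f).
have fg : alpha f = beta g.
  apply/eqP; rewrite -subr_eq0; apply/eqP.
  suff E h : sc ((alpha h)^† ∘ (alpha f - beta g)) = 0.
    have [h hE] := alpha_surj (alpha f - beta g).
    by apply: sc_eq0; rewrite -[in X in X ∘ _]hE E.
  rewrite compBr (linD (@lin_sc _ _ _ _)) (linN (@lin_sc _ _ _ _)).
  rewrite alpha_beta_eq -ag beta_alpha.
  rewrite -[(alpha h)^† ∘ beta g]dagK dag_comp dagK beta_alpha dagZ dag_id !scZ sc_id.
  by rewrite -sc_dag dag_comp dagK subrr.
have ax : alpha (f - g) = - beta (f - g) by rewrite alphaD betaD ag fg opprB.
have x0 : f - g = 0.
  apply: sc_eq0; apply/eqP; rewrite eq_le sc_ge0 andbT.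
  have := beta_alpha (f - g) (f - g); rewrite ax => /(congr1 (@sc _ _ _ _)).
  rewrite scZ sc_id mulr1 => <-.
  by rewrite (linN (comp_linr _)) (linN (@lin_sc _ _ _ _)) oppr_le0 sc_ge0.
by move/eqP: x0; rewrite subr_eq0 => /eqP fE; rewrite {1}fE ag.
Qed.

Lemma alpha_orth f g : (alpha f)^† ∘ alpha g = sc (g^† ∘ f) *: idm _.
Proof. by rewrite [in X in X ∘ _]alpha_beta beta_alpha. Qed.

(** [beta_beta] relates this trace to the Gram form of [beta], which is that of [alpha] and hence,
    up to exchanging [f] and [g], the original pairing. *)
Lemma ptrL_rank1 f g : d_ b * sc (ptrL (ev sph a) (f ∘ g^†)) = d_ k * sc (g^† ∘ f).
Proof.
by rewrite -beta_beta -alpha_beta_eq alpha_orth scZ sc_id mulr1.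
Qed.
Lemma ptrR_rank1 f g : d_ a * sc (ptrR (coev sph b) (f ∘ g^†)) = d_ k * sc (g^† ∘ f).
Proof. by rewrite -alpha_alpha alpha_orth scZ sc_id mulr1. Qed.
End Standard.

(* The quantum trace; in this form it is cyclic by dinaturality of [csum]. *)
Definition qtr z (T : mor z z) : C^o := csum B (fun k d v => d_ k * sc (d ∘ T ∘ v) : C^o).

Lemma lin_qtr z : lin (@qtr z).
Proof. by rewrite /qtr /csum; lin. Qed.

Lemma qtrC z z' (f : mor z' z) (g : mor z z') : qtr (f ∘ g) = qtr (g ∘ f).
Proof.
pose F k (d : mor z (irr k)) (v : mor (irr k) z') : C^o := d_ k * sc (d ∘ f ∘ v).
have Fb k : bilin (F k) by split=> u; rewrite /F; lin.
transitivity (csum B (fun k d v => F k d (g ∘ v))).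
  by apply: eq_csum => k d v; rewrite /F !compA.
by rewrite -(csum_nat B g Fb); apply: eq_csum => k d v; rewrite /F !compA.
Qed.

Lemma qtr_irr k (f : mor (irr k) (irr k)) : qtr f = d_ k * sc f.
Proof.
rewrite /qtr (csum_irr B (F := fun l d v => d_ l * sc (d ∘ f ∘ v) : C^o)) ?comp1l ?comp1r //.
move=> l; split=> u; lin.
Qed.

(** A resolution of the identity reduces [T] to operators [f ∘ g] through a simple object, whose
    partial traces are known from [ptrL_rank1]. *)
Lemma qtr_ptrL a x T : qtr T = qtr (ptrL (z := x) (ev sph a) T).
Proof.
have Lp : lin (ptrL (z := x) (ev sph a)) by rewrite /ptrL; lin.
rewrite -[T]comp1r -(csum_id HD B) /csum comp_bigr (lin_sum Lp) !(lin_sum (@lin_qtr _)).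
apply: eq_bigr => k _; rewrite comp_bigr (lin_sum Lp) !(lin_sum (@lin_qtr _)).
apply: eq_bigr => p _; rewrite compA; move: (T ∘ tnth (dbv _) p) (tnth (dbd _) p) => f g.
rewrite qtrC qtr_irr.
(* The strand [x] stays open in the partial trace, so [d] and [v] move inside it and cut it down to
   a simple object [b]. Summing over them afterwards restores the identity of [x]. *)
have E b (d : mor x (irr b)) (v : mor (irr b) x) :
    d_ b * sc (d ∘ ptrL (ev sph a) (f ∘ g) ∘ v) = d_ k * sc (g ∘ (idm _ ⊗m (v ∘ d)) ∘ f).
  have -> : d ∘ ptrL (ev sph a) (f ∘ g) ∘ v =
    ptrL (ev sph a) ((idm _ ⊗m d ∘ f) ∘ (g ∘ idm _ ⊗m v)).
    rewrite /ptrL /etaL -!lock; strict.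
    have E1 := st_nat (ev sph a) (st d tunit).
    have E2 := st_nat (ev sph a)^† (st v tunit).
    rewrite /= ?st_dag in E1 E2.
    by rewrite !dagK !tens1M !compA -E1 -!compA E2 !compA.
  have := ptrL_rank1 ((idm _ ⊗m d) ∘ f) ((g ∘ (idm _ ⊗m v))^†).
  by rewrite dagK => H; etransitivity; first exact: H; rewrite tens1M !compA.
rewrite /qtr; under [RHS]eq_csum do rewrite E.
rewrite /csum; under [RHS]eq_bigr do rewrite -mulr_sumr -sc_sum -comp_bigl -comp_bigr -tens_sumr.
rewrite -mulr_sumr -sc_sum -comp_bigl -comp_bigr -tens_sumr.
by rewrite -[\sum_i _]/(csum B (fun k d v => v ∘ d)) csum_id // tensm_id comp1r.
Qed.

Lemma qtr_ptrR b x T : qtr T = qtr (ptrR (z := x) (coev sph b) T).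
Proof.
have Lp : lin (ptrR (z := x) (coev sph b)) by rewrite /ptrR; lin.
rewrite -[T]comp1r -(csum_id HD B) /csum comp_bigr (lin_sum Lp) !(lin_sum (@lin_qtr _)).
apply: eq_bigr => k _; rewrite comp_bigr (lin_sum Lp) !(lin_sum (@lin_qtr _)).
apply: eq_bigr => p _; rewrite compA; move: (T ∘ tnth (dbv _) p) (tnth (dbd _) p) => f g.
rewrite qtrC qtr_irr.
have E a (d : mor x (irr a)) (v : mor (irr a) x) :
    d_ a * sc (d ∘ ptrR (coev sph b) (f ∘ g) ∘ v) = d_ k * sc (g ∘ ((v ∘ d) ⊗m idm _) ∘ f).
  have -> : d ∘ ptrR (coev sph b) (f ∘ g) ∘ v =
    ptrR (coev sph b) ((d ⊗m idm _ ∘ f) ∘ (g ∘ v ⊗m idm _)).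
    rewrite /ptrR /etaR -!lock; strict.
    rewrite !tensm_dag !dag_id.
    have E1 := st_nat d (st (coev sph b) tunit)^†.
    have E2 := st_nat v (st (coev sph b) tunit).
    rewrite /= in E1 E2.
    by rewrite !compA -E1 -!compA E2 !compA.
  have := ptrR_rank1 ((d ⊗m idm _) ∘ f) ((g ∘ (v ⊗m idm _))^†).
  by rewrite dagK => ->; rewrite tensM1 !compA.
rewrite /qtr; under [RHS]eq_csum do rewrite E.
rewrite /csum; under [RHS]eq_bigr do rewrite -mulr_sumr -sc_sum -comp_bigl -comp_bigr -tens_suml.
rewrite -mulr_sumr -sc_sum -comp_bigl -comp_bigr -tens_suml.
by rewrite -[\sum_i _]/(csum B (fun k d v => v ∘ d)) csum_id // tensm_id comp1r.
Qed.

(** Both sides are the quantum trace of [v ∘ w] on a ⊗ l ⊗ b: cyclicity gives the right side, and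
    closing the legs a and b gives the left side. *)
Lemma sharp_flat a b k l (v : mor (irr k) (act (irr a) (irr b) (irr l)))
    (w : mor (act (irr a) (irr b) (irr l)) (irr k)) :
  d_ l * sc (sharp sph v ∘ flat sph w) = d_ k * sc (w ∘ v).
Proof.
rewrite -[RHS]qtr_irr qtrC qtr_ptrL qtr_ptrR -[LHS]qtr_irr; congr (qtr _).
rewrite /sharp /flat /ptrR /ptrL /etaL /etaR /pad /reassoc -!lock; strict.
have E := st_nat (ev sph a) (idm (irr l) ⊗m (st (coev sph b) tunit)^†); rewrite /= in E.
rewrite dagK tensm_dag dag_id E.
by rewrite !tens1M !compA.
Qed.
End Spherical.

Section SemilinearLifts.
Variables (C : fieldType) (s : {rmorphism C -> C}).

Lemma slin_coordE (V : vectType C) (L : lmodType C) (F : V -> L) v : slin s F ->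
  F v = \sum_i s (coord (vbas V) i v) *: F (vbas V)`_i.
Proof.
move=> Fl; rewrite [in LHS](coord_basis (vbasisP {:V}) (memvf v)) (slin_sum Fl).
by apply: eq_bigr => i _; rewrite (slinZ Fl).
Qed.

Lemma tlift_for_pure (V W : vectType C) (L : lmodType C) (b : V -> W -> L) v w :
  (forall w, slin s (b ^~ w)) -> (forall v, slin s (b v)) ->
  tlift_for s b (tpure v w) = b v w.
Proof.
move=> bl br; rewrite (slin_coordE v (bl w)); apply: eq_bigr => i _.
rewrite (slin_coordE w (br _)) scaler_sumr; apply: eq_bigr => j _.
by rewrite mxE rmorphM scalerA.
Qed.

Lemma dlift_for_inj (I : finType) (V : I -> vectType C) (L : lmodType C)
    (F : forall i, V i -> L) i (v : V i) :
  slin s (F i) -> dlift_for s F (dinj v) = F i v.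
Proof.
move=> Fl; rewrite (slin_coordE v Fl) /dlift_for.
pose K (j : I) (k : 'I_(\dim {:V j})) : L :=
  s ((dinj v : {ffun _ -> _}) (Tagged (fun j => 'I_(\dim {:V j})) k)) *:
    F j (vbas (V j))`_k.
rewrite (eq_bigr (fun p => K (tag p) (tagged p))); last by case.
rewrite -(sig_big_dep xpredT (fun=> xpredT) K) (bigD1 i) //=.
rewrite [X in _ + X]big1 ?addr0 => [|j ji].
  by apply: eq_bigr => k _; rewrite /K ffunE untagE.
by apply: big1 => k _; rewrite /K ffunE untag_dflt ?rmorph0 ?scale0r.
Qed.
End SemilinearLifts.

Section CsumLinear.
Variables (R : realType) (D : daggerMonCat R) (X : simples D).
Hypothesis HD : unitary_multifusion D.
Variable (B : forall (k : X) (z : D), dual_bases k z).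

Lemma csum_lin z (L : lmodType R[i]) (G : mor z z -> L) :
  lin G -> csum B (fun k d v => G (v ∘ d)) = G (idm z).
Proof.
move=> Gl; rewrite -(csum_id HD B z) /csum (lin_sum Gl).
by apply: eq_bigr => k _; rewrite (lin_sum Gl).
Qed.

Lemma lin_csum z (L M : lmodType R[i]) (F : M -> forall k, mor z (irr k) -> mor (irr k) z -> L) :
  (forall k d v, lin (fun x => F x k d v)) -> lin (fun x => csum B (F x)).
Proof. by move=> Fl; apply: lin_bigsum => k; apply: lin_bigsum => p. Qed.

Lemma csum_linE z (L M : lmodType R[i]) (G : L -> M) (F : forall k, mor z (irr k) -> mor (irr k) z -> L) :
  lin G -> G (csum B F) = csum B (fun k d v => G (F k d v)).
Proof.
by move=> Gl; rewrite (lin_sum Gl); apply: eq_bigr => k _; rewrite (lin_sum Gl).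
Qed.

Lemma exchange_csum z z' (L : lmodType R[i])
    (F : forall k, mor z (irr k) -> mor (irr k) z -> forall l, mor z' (irr l) -> mor (irr l) z' -> L) :
  csum B (fun k d v => csum B (F k d v)) = csum B (fun l d' v' => csum B (fun k d v => F k d v l d' v')).
Proof.
rewrite /csum; under eq_bigr do rewrite exchange_big /=; rewrite exchange_big /=.
apply: eq_bigr => l _.
by under [LHS]eq_bigr do rewrite exchange_big /=; rewrite exchange_big.
Qed.
End CsumLinear.

(** * Pure tubes and brackets *)

Section TubePure.
Variables (R : realType) (D : daggerMonCat R) (X : simples D).
Local Notation C := R[i].
Local Notation Tube := (Tube X).
Implicit Types a b c e f h k l : X.

Lemma lin_tube_purel a b c e f h w : lin (fun v => @tube_pure R D X a b c e f h v w).
Proof.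
exact: (lin_comp (lin_dinj (V := fun t : tube_idx X => tensor (tubeL t) (tubeR t)) (i := (a, b, c, e, f, h)))
  (@lin_tpurel C (tubeL (a, b, c, e, f, h)) (tubeR (a, b, c, e, f, h)) w)).
Qed.
Lemma lin_tube_purer a b c e f h v : lin (@tube_pure R D X a b c e f h v).
Proof.
exact: (lin_comp (lin_dinj (V := fun t : tube_idx X => tensor (tubeL t) (tubeR t)) (i := (a, b, c, e, f, h)))
  (@lin_tpurer C (tubeL (a, b, c, e, f, h)) (tubeR (a, b, c, e, f, h)) v)).
Qed.

Lemma tube_ind (P : Tube -> Prop) :
  P 0 -> (forall (t : C) x y, P x -> P y -> P (t *: x + y)) ->
  (forall a b c e f h v w, P (@tube_pure R D X a b c e f h v w)) ->
  forall x, P x.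
Proof.
move=> P0 Pl Pp; apply: dsum_ind => // -[[[[[a b] c] e] f] h] t.
elim/tensor_ind: t => [k x y Px Py|v w]; last exact: Pp.
by rewrite lin_dinj; apply: Pl.
Qed.

Lemma tube_eq (s : {rmorphism C -> C}) (L : lmodType C) (f g : Tube -> L) :
  slin s f -> slin s g ->
  (forall a b c e f' h v w, f (@tube_pure R D X a b c e f' h v w) = g (tube_pure v w)) ->
  forall x, f x = g x.
Proof.
move=> fl gl fg; apply: tube_ind => //.
  by rewrite (slin0 fl) (slin0 gl).
by move=> t x y fx fy; rewrite fl gl fx fy.
Qed.

Lemma tube_lin_eq (L : lmodType C) (f g : Tube -> L) : lin f -> lin g ->
  (forall a b c e f' h v w, f (@tube_pure R D X a b c e f' h v w) = g (tube_pure v w)) ->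
  forall x, f x = g x.
Proof. exact: (@tube_eq idfun). Qed.

Lemma slin_tube_lift (s : {rmorphism C -> C}) (L : lmodType C) (F : tube_form X L) :
  slin s (tube_lift_for s F).
Proof. exact: slin_dlift_for. Qed.

Lemma lin_tube_lift (L : lmodType C) (F : tube_form X L) : lin (tube_lift F).
Proof. exact: (@slin_tube_lift idfun). Qed.

Lemma lin_tube_lift_fun (L M : lmodType C) (F : M -> tube_form X L) t :
  (forall a b c e f h v w, lin (fun x => @F x a b c e f h v w)) ->
  lin (fun x => tube_lift (F x) t).
Proof.
move=> Fl; apply: lin_bigsum => -[[[[[[a b] c] e] f] h] i]; apply: lin_scale.
apply: lin_bigsum => j; apply: lin_bigsum => k; apply: lin_scale.
exact: Fl.
Qed.

Lemma tube_lift_for_pure (s : {rmorphism C -> C}) (L : lmodType C) (F : tube_form X L)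
    a b c e f h v w :
  (forall w, slin s (fun v => @F a b c e f h v w)) ->
  (forall v, slin s (@F a b c e f h v)) ->
  tube_lift_for s F (tube_pure v w) = @F a b c e f h v w.
Proof.
move=> Fl Fr; rewrite /tube_lift_for dlift_for_inj.
  by rewrite tlift_for_pure.
exact: slin_tlift_for.
Qed.

Lemma tube_liftE (L : lmodType C) (F : tube_form X L) a b c e f h v w :
  bilin (@F a b c e f h) -> tube_lift F (tube_pure v w) = @F a b c e f h v w.
Proof. by case=> Fl Fr; apply: (@tube_lift_for_pure idfun). Qed.
End TubePure.

Ltac lin_pure_step := match goal with
  | |- lin (fun x => tube_pure (@?f x) ?w) => apply: (lin_comp (lin_tube_purel w))
  | |- lin (fun x => tube_pure ?v (@?f x)) => apply: (lin_comp (lin_tube_purer v))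
  | |- lin (fun x => csum _ _) => apply: lin_csum => ? ? ?
  end.
Ltac lin_hook ::= lin_pure_step.

Section Bracket.
Variables (R : realType) (D : daggerMonCat R) (X : simples D).
Hypothesis HD : unitary_multifusion D.
Variable (B : forall (k : X) (z : D), dual_bases k z).
Local Notation br := (tube_bracket B).
Implicit Types (a b c e f h k l : X) (P Q : D).

Lemma bracketE c e f h P Q (v : mor (irr c) (act P Q (irr e))) (w : mor (act P Q (irr f)) (irr h)) :
  br v w = csum B (fun k d u => csum B (fun s d' u' =>
    tube_pure (tc d d' (irr e) ∘ v) (w ∘ tc u u' (irr f)))).
Proof.
rewrite /tube_bracket /csum; apply: eq_bigr => k _; rewrite exchange_big.
by apply: eq_bigr => p _.
Qed.

Lemma lin_bracketl c e f h P Q (w : mor (act P Q (irr f)) (irr h)) :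
  lin (fun v : mor (irr c) (act P Q (irr e)) => br v w).
Proof.
rewrite /tube_bracket; lin.
Qed.
Lemma lin_bracketr c e f h P Q (v : mor (irr c) (act P Q (irr e))) :
  lin (fun w : mor (act P Q (irr f)) (irr h) => br v w).
Proof.
rewrite /tube_bracket; lin.
Qed.

Lemma bracket_nat c e f h P Q P' Q' (g : mor P P') (g' : mor Q Q')
    (v : mor (irr c) (act P Q (irr e))) (w : mor (act P' Q' (irr f)) (irr h)) :
  br (tc g g' (irr e) ∘ v) w = br v (w ∘ tc g g' (irr f)).
Proof.
pose F k (d : mor P (irr k)) (u : mor (irr k) P') := csum B (fun s d' u' =>
   tube_pure (tc d (d' ∘ g') (irr e) ∘ v) (w ∘ tc u u' (irr f))).
pose G k (d : mor P (irr k)) (u : mor (irr k) P') s (d' : mor Q (irr s)) (u' : mor (irr s) Q') :=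
   tube_pure (tc d d' (irr e) ∘ v) (w ∘ tc u u' (irr f)).
transitivity (csum B (fun k d u => F k (d ∘ g) u)).
  rewrite bracketE; apply: eq_csum => k d u; apply: eq_csum => s d' u'.
  by rewrite tcM !compA.
rewrite (csum_nat B g); last first.
  by move=> k; split=> y; rewrite /F; lin.
rewrite bracketE; apply: eq_csum => k d u; rewrite /F.
rewrite (csum_nat B g' (F := G k d (g ∘ u))).
  by apply: eq_csum => s d' u'; rewrite /G -compA -tcM.
by move=> s; split=> y; rewrite /G; lin.
Qed.

Lemma bracket_irr a b c e f h (v : mor (irr c) (act (irr a) (irr b) (irr e)))
   (w : mor (act (irr a) (irr b) (irr f)) (irr h)) : br v w = tube_pure v w.
Proof.
rewrite bracketE csum_irr; last first.
  by move=> k; split=> y; lin.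
rewrite csum_irr ?tc1 ?comp1l ?comp1r // => s; split=> y; lin.
Qed.

End Bracket.

Ltac lin_bracket_step := match goal with
  | |- lin (fun x => tube_bracket _ (@?f x) ?w) => apply: (lin_comp (lin_bracketl _ w))
  | |- lin (fun x => tube_bracket _ ?v (@?f x)) => apply: (lin_comp (lin_bracketr _ v))
  | |- lin (fun x => tube_lift ?F (@?g x)) => apply: (lin_comp (lin_tube_lift F))
  | |- lin (fun x => tube_lift _ _) => apply: lin_tube_lift_fun => *
  end.
Ltac lin_hook ::= first [lin_pure_step | lin_bracket_step].

Lemma exchange_big4 (V : nmodType) (I J K L : finType) (F : I -> J -> K -> L -> V) :
  \sum_i \sum_j \sum_k \sum_l F i j k l = \sum_k \sum_l \sum_i \sum_j F i j k l.
Proof.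
rewrite pair_bigA [RHS]pair_bigA /=.
under eq_bigr do rewrite pair_bigA /=.
by rewrite exchange_big /=; apply: eq_bigr => p _; rewrite pair_bigA.
Qed.

Lemma big_only (V : nmodType) (I : finType) (j : I) (F : I -> V) :
  (forall i, i != j -> F i = 0) -> \sum_i F i = F j.
Proof.
by move=> F0; rewrite (bigD1 j) //= [X in _ + X]big1 ?addr0.
Qed.

(** * Algebra, coalgebra and their compatibility *)

Section TubeAlgebra.
Variables (R : realType) (D : daggerMonCat R) (X : simples D).
Hypothesis HD : unitary_multifusion D.
Variable (B : forall (k : X) (z : D), dual_bases k z).
Local Notation C := R[i].
Local Notation br := (tube_bracket B).
Local Notation mul := (tube_mul B).
Local Notation dl := delta_mor.
Implicit Types (a b c e f h k l : X) (P Q : D).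

Lemma lin_tube_mull y : lin (fun x => mul x y).
Proof. exact: lin_tube_lift. Qed.

Lemma lin_tube_mulr x : lin (mul x).
Proof. by apply: lin_tube_lift_fun => *; apply: lin_tube_lift. Qed.

Lemma mul_pure a b c e f h v w a' b' c' e' f' h' v' w' :
  mul (@tube_pure R D X a b c e f h v w) (@tube_pure R D X a' b' c' e' f' h' v' w') =
  br (ra _ _ _ _ _ ∘ (fm _ _ (v' ∘ dl e c') ∘ v)) (w ∘ fm _ _ (dl h' f ∘ w') ∘ (ra _ _ _ _ _)^†).
Proof.
rewrite /tube_mul tube_liftE; last by split=> y; lin.
rewrite tube_liftE; last by split=> y; lin.
by rewrite !reassocE compA.
Qed.

Lemma csum_lin2 P Q (L : lmodType C) (G : mor P P -> mor Q Q -> L) : bilin G ->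
  csum B (fun k d u => csum B (fun s d' u' => G (u ∘ d) (u' ∘ d'))) = G (idm P) (idm Q).
Proof.
case=> Gl Gr; rewrite -(csum_lin HD B (Gl (idm Q))).
by apply: eq_csum => k d u; rewrite (csum_lin HD B (Gr (u ∘ d))).
Qed.

(** The product is defined on simple legs. It extends to arbitrary legs one factor at a time: the
    basis morphisms of the bracket cross to the other argument, where they sum to an identity. *)
Lemma mul_pure_bracket a b c e f h v w P' Q' c' e' f' h'
    (v' : mor (irr c') (act P' Q' (irr e'))) (w' : mor (act P' Q' (irr f')) (irr h')) :
  mul (@tube_pure R D X a b c e f h v w) (br v' w') =
  br (ra _ _ _ _ _ ∘ (fm _ _ (v' ∘ dl e c') ∘ v)) (w ∘ fm _ _ (dl h' f ∘ w') ∘ (ra _ _ _ _ _)^†).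
Proof.
rewrite bracketE (csum_linE _ _ (lin_tube_mulr _)).
under eq_csum do rewrite (csum_linE _ _ (lin_tube_mulr _)).
set V := ra _ _ _ _ _ ∘ _; set W := w ∘ _ ∘ _.
transitivity (csum B (fun k (d : mor P' (irr k)) u => csum B (fun s (d' : mor Q' (irr s)) u' =>
  br V (W ∘ tc (idm (irr a) ⊗m (u ∘ d)) ((u' ∘ d') ⊗m idm (irr b)) (irr f'))))).
  apply: eq_csum => k d u; apply: eq_csum => s d' u'; rewrite mul_pure.
  have -> : ra (irr a) (irr k) (irr e') (irr s) (irr b) ∘
      (fm (irr a) (irr b) (tc d d' (irr e') ∘ v' ∘ dl e c') ∘ v) =
      tc (idm (irr a) ⊗m d) (d' ⊗m idm (irr b)) (irr e') ∘ V.
    by rewrite -[_ ∘ v' ∘ _]compA fmM -[_ ∘ v]compA compA ra_fm_tc -compA.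
  rewrite bracket_nat; congr (br _ _).
  rewrite compA fmM compA -[_ ∘ (ra _ _ _ _ _)^†]compA fm_tc_ra.
  by rewrite -!compA -tcM -tens1M -tensM1 /W -?compA.
rewrite (csum_lin2 (G := fun y y' => br V (W ∘ tc (idm (irr a) ⊗m y) (y' ⊗m idm (irr b)) (irr f')))).
  by rewrite !tensm_id comp1r.
by split=> y; lin.
Qed.

Lemma mul_bracket P Q P' Q' c e f h c' e' f' h'
    (v : mor (irr c) (act P Q (irr e))) (w : mor (act P Q (irr f)) (irr h))
    (v' : mor (irr c') (act P' Q' (irr e'))) (w' : mor (act P' Q' (irr f')) (irr h')) :
  mul (br v w) (br v' w') =
  br (ra _ _ _ _ _ ∘ (fm _ _ (v' ∘ dl e c') ∘ v)) (w ∘ fm _ _ (dl h' f ∘ w') ∘ (ra _ _ _ _ _)^†).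
Proof.
rewrite [br v w]bracketE (csum_linE _ _ (lin_tube_mull _)).
under eq_csum do rewrite (csum_linE _ _ (lin_tube_mull _)).
set V := ra _ _ _ _ _ ∘ _; set W := w ∘ _ ∘ _.
transitivity (csum B (fun k (d : mor P (irr k)) u => csum B (fun s (d' : mor Q (irr s)) u' =>
  br V (W ∘ tc ((u ∘ d) ⊗m idm P') (idm Q' ⊗m (u' ∘ d')) (irr f'))))).
  apply: eq_csum => k d u; apply: eq_csum => s d' u'; rewrite mul_pure_bracket.
  have -> : ra (irr k) P' (irr e') Q' (irr s) ∘
      (fm (irr k) (irr s) (v' ∘ dl e c') ∘ (tc d d' (irr e) ∘ v)) =
      tc (d ⊗m idm P') (idm Q' ⊗m d') (irr e') ∘ V.
    by rewrite [fm _ _ _ ∘ _]compA -tc_fm -[_ ∘ v]compA compA ra_tc_act -compA.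
  rewrite bracket_nat; congr (br _ _).
  rewrite -[w ∘ _ ∘ _]compA tc_fm compA -[_ ∘ (ra _ _ _ _ _)^†]compA tc_act_ra.
  by rewrite -!compA -tcM -tens1M -tensM1 /W -?compA.
rewrite (csum_lin2 (G := fun y y' => br V (W ∘ tc (y ⊗m idm P') (idm Q' ⊗m y') (irr f')))).
  by rewrite !tensm_id comp1r.
by split=> y; lin.
Qed.

(** The triple products have legs bracketed differently; [ra3] isolates the associators on the first
    argument, [bracket_nat] moves them to the second, and there they cancel. *)
Lemma tube_mulA x y z : mul x (mul y z) = mul (mul x y) z.
Proof.
move: x; apply: tube_lin_eq => [||a b c e f h v w].
- exact: lin_tube_mull.
- exact: (lin_comp (lin_tube_mull _) (lin_tube_mull _)).
move: y; apply: tube_lin_eq => [||a' b' c' e' f' h' v' w'].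
- exact: (lin_comp (lin_tube_mulr _) (lin_tube_mull _)).
- exact: (lin_comp (lin_tube_mull _) (lin_tube_mulr _)).
move: z; apply: tube_lin_eq => [||a'' b'' c'' e'' f'' h'' v'' w''].
- exact: (lin_comp (lin_tube_mulr _) (lin_tube_mulr _)).
- exact: lin_tube_mulr.
rewrite !mul_pure -!(bracket_irr B) !mul_bracket.
set d1 := dl e c'; set d2 := dl e' c''; set d3 := dl h' f; set d4 := dl h'' f'.
have F1 := ra3 (irr a) (irr a') (irr a'') (irr e'') (irr b'') (irr b') (irr b).
have F2 := congr1 (@dag _ _ _ _) (ra3 (irr a) (irr a') (irr a'') (irr f'') (irr b'') (irr b') (irr b)).
rewrite !dag_comp !tensm_dag !dag_id dagK in F2.
have -> : ra (irr a ⊗ irr a') (irr a'') (irr e'') (irr b'') (irr b' ⊗ irr b)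
   ∘ (fm (irr a ⊗ irr a') (irr b' ⊗ irr b) (v'' ∘ d2) ∘
    (ra (irr a) (irr a') (irr e') (irr b') (irr b) ∘ (fm _ _ (v' ∘ d1) ∘ v))) =
  tc (assoc (irr a) (irr a') (irr a''))^† (assoc (irr b'') (irr b') (irr b)) (irr e'') ∘
  (ra (irr a) (irr a' ⊗ irr a'') (irr e'') (irr b'' ⊗ irr b') (irr b) ∘
   (fm _ _ (ra (irr a') (irr a'') (irr e'') (irr b'') (irr b') ∘
     (fm _ _ (v'' ∘ d2) ∘ v') ∘ d1) ∘ v)).
  rewrite [fm _ _ (v'' ∘ d2) ∘ (ra _ _ _ _ _ ∘ _)]compA -ra_nat -compA compA F1.
  by rewrite -!compA; congr (_ ∘ (_ ∘ _)); rewrite !compA -!fmM !compA.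
rewrite bracket_nat; congr (br _ _).
have F3 : (ra (irr a) (irr a') (act (irr a'') (irr b'') (irr f'')) (irr b') (irr b))^† ∘
    ((ra (irr a ⊗ irr a') (irr a'') (irr f'') (irr b'') (irr b' ⊗ irr b))^† ∘
      tc (assoc (irr a) (irr a') (irr a''))^† (assoc (irr b'') (irr b') (irr b)) (irr f'')) =
    fm (irr a) (irr b) (ra (irr a') (irr a'') (irr f'') (irr b'') (irr b'))^† ∘
    (ra (irr a) (irr a' ⊗ irr a'') (irr f'') (irr b'' ⊗ irr b') (irr b))^†.
  rewrite compA F2 -compA -tcM assocKV.
  have -> : (assoc (irr b'') (irr b') (irr b))^† ∘ assoc (irr b'') (irr b') (irr b) = idm _.
    exact: assocK.
  by rewrite tc1 comp1r.
rewrite -![in RHS]compA [(ra _ _ _ _ _)^† ∘ (fm _ _ _ ∘ _) in RHS]compA -fm_ra -[in RHS]compA F3.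
by rewrite !fmM -!compA.
Qed.

(** A component of the unit with the whole of [tunit] as both legs, which replaces the sum over
    pairs of summands. By [unt_mul] these components are orthogonal idempotents. *)
Definition unt y x := br (pd (irr y)) (pd (irr x))^†.

Lemma tube_oneE : tube_one X = \sum_x \sum_y unt y x.
Proof.
pose G (i j : uidx X) (x y : X) := tube_pure ((tc (uinc i)^† (uinc j)^† (irr y)) ∘ pd (irr y))
    ((pd (irr x))^† ∘ (tc (uinc i) (uinc j) (irr x))).
transitivity (\sum_(i : uidx X) \sum_(j : uidx X) \sum_x \sum_y G i j x y).
  apply: eq_bigr => i _; apply: eq_bigr => j _.
  rewrite big_mkcond; apply: eq_bigr => x _; case: asboolP => bx; last first.
    rewrite big1 // => y _.
    have -> : G i j x y = 0.
      rewrite /G -[_^† ∘ _]dagK dag_comp tc_dag dagK.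
      have [->|/in_block_of //] := eqVneq (tc (uinc i)^† (uinc j)^† (irr x) ∘ pd (irr x)) 0.
      by rewrite dag0 (lin0 (lin_tube_purer _)).
    by [].
  rewrite big_mkcond; apply: eq_bigr => y _; case: asboolP => by_; rewrite ?padE //.
  rewrite /G.
  have [->|/in_block_of //] := eqVneq (tc (uinc i)^† (uinc j)^† (irr y) ∘ pd (irr y)) 0.
  by rewrite (lin0 (lin_tube_purel _)).
rewrite exchange_big4; apply: eq_bigr => x _; apply: eq_bigr => y _; rewrite /G.
transitivity (\sum_(i : uidx X) \sum_(j : uidx X) br (pd (irr y))
    ((pd (irr x))^† ∘ tc (uinc i ∘ (uinc i)^†) (uinc j ∘ (uinc j)^†) (irr x))).
  apply: eq_bigr => i _; apply: eq_bigr => j _.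
  by rewrite -(bracket_irr B) bracket_nat -compA -tcM.
rewrite /unt -[in RHS](comp1r (pd (irr x))^†) -tc1 -(uinc_sum X).
rewrite tens_suml comp_bigr (lin_sum (lin_bracketr _ _)); apply: eq_bigr => i _.
by rewrite !tens_sumr comp_bigr (lin_sum (lin_bracketr _ _)).
Qed.

Lemma mul_unitl P Q c e f h (v : mor (irr c) (act P Q (irr e)))
    (w : mor (act P Q (irr f)) (irr h)) y x :
  mul (unt y x) (br v w) = if (y == c) && (x == h) then br v w else 0.
Proof.
rewrite mul_bracket; have [->|yc] := eqVneq y c; last first.
  rewrite (delta_neq yc) comp0r tens0l tens0r comp0l comp0r.
  by rewrite (lin0 (lin_bracketl _ _)).
have [->|xh] := eqVneq x h; last first.
  rewrite (@delta_neq _ _ _ h x) 1?eq_sym // comp0l tens0l tens0r comp0r comp0l.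
  by rewrite (lin0 (lin_bracketr _ _)).
rewrite !delta_id comp1l comp1r -pd_nat.
have -> : (pd (irr h))^† ∘ fm tunit tunit w = w ∘ (pd (act P Q (irr f)))^†.
  by rewrite -[LHS]dagK dag_comp dagK fm_dag -pd_nat dag_comp dagK.
rewrite compA ra_pdl bracket_nat -!compA.
have -> : (pd (act P Q (irr f)))^† ∘ ((ra tunit P (irr f) Q tunit)^† ∘
  tc (lunit P)^† (runit Q)^† (irr f)) = idm _.
  by rewrite compA -dag_comp ra_pdl tc_dag !dagK -tcM lunitKV runitKV tc1.
by rewrite comp1r.
Qed.

Lemma mul_unitr P Q c e f h (v : mor (irr c) (act P Q (irr e)))
    (w : mor (act P Q (irr f)) (irr h)) y x :
  mul (br v w) (unt y x) = if (e == y) && (f == x) then br v w else 0.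
Proof.
rewrite mul_bracket; have [<-|ey] := eqVneq e y; last first.
  rewrite (delta_neq ey) comp0r tens0l tens0r comp0l comp0r.
  by rewrite (lin0 (lin_bracketl _ _)).
have [<-|fx] := eqVneq f x; last first.
  rewrite (@delta_neq _ _ _ x f) 1?eq_sym // comp0l tens0l tens0r comp0r comp0l.
  by rewrite (lin0 (lin_bracketr _ _)).
rewrite !delta_id comp1l comp1r.
rewrite compA ra_pdr bracket_nat -fm_dag -!compA.
have -> : (fm P Q (pd (irr f)))^† ∘ ((ra P tunit (irr f) tunit Q)^† ∘
  tc (runit P)^† (lunit Q)^† (irr f)) = idm _.
  by rewrite compA -dag_comp ra_pdr tc_dag !dagK -tcM lunitKV runitKV tc1.
by rewrite comp1r.
Qed.

Lemma unt_mul y x y' x' : mul (unt y x) (unt y' x') =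
  if (y == y') && (x == x') then unt y x else 0.
Proof. exact: mul_unitr. Qed.

Lemma sum2_pick (V : nmodType) (I : finType) (i0 j0 : I) (F : I -> I -> V) :
  \sum_i \sum_j (if (j0 == j) && (i0 == i) then F i j else 0) = F i0 j0.
Proof.
rewrite (bigD1 i0) //= [X in _ + X]big1 ?addr0 => [|i ii].
  rewrite (bigD1 j0) //= !eqxx big1 ?addr0 // => j jj.
  by rewrite eq_sym (negPf jj).
by rewrite big1 // => j _; rewrite [i0 == i]eq_sym (negPf ii) andbF.
Qed.

Lemma mul_bracket1 P Q c e f h (v : mor (irr c) (act P Q (irr e)))
    (w : mor (act P Q (irr f)) (irr h)) : mul (br v w) (tube_one X) = br v w.
Proof.
rewrite tube_oneE (lin_sum (lin_tube_mulr _)).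
under eq_bigr do (rewrite (lin_sum (lin_tube_mulr _)); under eq_bigr do rewrite mul_unitr).
by rewrite (sum2_pick _ _ (fun _ _ => br v w)).
Qed.

Lemma mul_1bracket P Q c e f h (v : mor (irr c) (act P Q (irr e)))
    (w : mor (act P Q (irr f)) (irr h)) : mul (tube_one X) (br v w) = br v w.
Proof.
rewrite tube_oneE (lin_sum (lin_tube_mull _)).
under eq_bigr do (rewrite (lin_sum (lin_tube_mull _)); under eq_bigr do rewrite mul_unitl).
under eq_bigr do under eq_bigr do rewrite eq_sym [_ == h]eq_sym.
by rewrite (sum2_pick _ _ (fun _ _ => br v w)).
Qed.

Lemma tube_mul1l x : mul (tube_one X) x = x.
Proof.
move: x; apply: tube_lin_eq => // [|a b c e f h v w]; first exact: lin_tube_mulr.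
by rewrite -(bracket_irr B) mul_1bracket.
Qed.

Lemma tube_mul1r x : mul x (tube_one X) = x.
Proof.
move: x; apply: tube_lin_eq => // [|a b c e f h v w]; first exact: lin_tube_mull.
by rewrite -(bracket_irr B) mul_bracket1.
Qed.
End TubeAlgebra.

Ltac lin_mul_step := match goal with
  | |- lin (fun x => tube_mul _ (@?f x) ?w) => apply: (lin_comp (lin_tube_mull _ w))
  | |- lin (fun x => tube_mul _ ?v (@?f x)) => apply: (lin_comp (lin_tube_mulr _ v))
  | |- lin (tube_mul _ _) => apply: lin_tube_mulr
  | |- lin (tube_pure _) => apply: lin_tube_purer
  | |- lin (tube_bracket _ _) => apply: lin_bracketr
  end.
Ltac lin_hook ::= first [lin_pure_step | lin_bracket_step | lin_mul_step].

Section CsumHom.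
Variables (R : realType) (D : daggerMonCat R) (X : simples D).
Variable (B : forall (k : X) (z : D), dual_bases k z).
Implicit Types (c h k : X) (z : D).
Local Notation dl := delta_mor.

Lemma sc_delta_comm c k (f : mor (irr c) (irr k)) : sc (dl k c ∘ f) = sc (f ∘ dl k c).
Proof.
case: (eqVneq k c) f => [->|kc] f; first by rewrite delta_id comp1l comp1r.
by rewrite (delta_neq kc) comp0l comp0r !sc0.
Qed.

(** The expansion of [w] in a dual basis; [dl h k] makes the coefficient well typed for every [k]
    and kills those different from [h]. *)
Lemma csum_homl z h (w : mor z (irr h)) (L : lmodType R[i]) (G : forall k, mor z (irr k) -> L) :
  (forall k, lin (G k)) ->
  csum B (fun k d u => sc (dl h k ∘ (w ∘ u)) *: G k d) = G h w.
Proof.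
move=> Gl; rewrite -(csum_nat B w (F := fun k d u => sc (dl h k ∘ u) *: G k d)); last first.
  by move=> k; split=> y; lin.
rewrite csum_irr ?delta_id ?comp1l ?sc_id ?scale1r // => k.
by split=> y; lin.
Qed.

Lemma csum_homr z c (v : mor (irr c) z) (L : lmodType R[i]) (G : forall k, mor (irr k) z -> L) :
  (forall k, lin (G k)) ->
  csum B (fun k d u => sc (dl k c ∘ (d ∘ v)) *: G k u) = G c v.
Proof.
move=> Gl; under eq_csum do rewrite sc_delta_comm.
rewrite (csum_nat B v (F := fun k d u => sc (d ∘ dl k c) *: G k u)); last first.
  by move=> k; split=> y; lin.
rewrite csum_irr ?delta_id ?comp1l ?comp1r ?sc_id ?scale1r // => k.
by split=> y; lin.
Qed.

(** For an object that is itself simple up to a coisometry, the coend sum has a single term. *)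
Lemma csum_iso z k (g : mor (irr k) z) (L : lmodType R[i])
    (F : forall l, mor z (irr l) -> mor (irr l) z -> L) :
  (forall l, bilin (F l)) -> g ∘ g^† = idm z -> csum B F = F k g^† g.
Proof.
move=> Fb gg; transitivity (csum B (fun l d v => F l (d ∘ g ∘ g^†) v)).
  by apply: eq_csum => l d v; rewrite -compA gg comp1r.
have Fb' l : bilin (fun d v => F l (d ∘ g^†) v).
  by have [Fl Fr] := Fb l; split=> y; lin.
rewrite (csum_nat B g (F := fun l d v => F l (d ∘ g^†) v)) // csum_irr ?comp1l ?comp1r //.
by move=> l; have [Fl Fr] := Fb l; split=> y; lin.
Qed.
End CsumHom.

Lemma csum_bigsum (R : realType) (D : daggerMonCat R) (X : simples D)
    (B : forall (k : X) (z : D), dual_bases k z) z (L : lmodType R[i]) (J : finType)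
    (F : J -> forall k, mor z (irr k) -> mor (irr k) z -> L) :
  csum B (fun k d v => \sum_j F j k d v) = \sum_j csum B (F j).
Proof.
rewrite /csum [RHS]exchange_big; apply: eq_bigr => k _.
by rewrite [RHS]exchange_big.
Qed.

(** * Comultiplication and counit *)

Section TubeCoalgebra.
Variables (R : realType) (D : daggerMonCat R) (X : simples D).
Hypothesis HD : unitary_multifusion D.
Variable (B : forall (k : X) (z : D), dual_bases k z).
Local Notation C := R[i].
Local Notation Tube := (Tube X).
Local Notation br := (tube_bracket B).
Local Notation comul := (tube_comul B).
Local Notation dl := delta_mor.
Implicit Types (a b c e f h k l : X) (P Q : D).

Lemma lin_comul : lin comul.
Proof. exact: lin_tube_lift. Qed.

Lemma comul_pure a b c e f h v w :
  comul (@tube_pure R D X a b c e f h v w) = \sum_i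
    csum B (z := act (irr a) (irr b) (irr i))
      (fun k d u => tpure (tube_pure u w) (tube_pure v d)).
Proof. by rewrite /tube_comul tube_liftE //; split=> y; lin. Qed.

(** For each [i], the leg morphisms of the bracket are carried through the coend sum on the middle
    object by dinaturality and then collapse to an identity. *)
Lemma comul_bracket P Q c e f h (v : mor (irr c) (act P Q (irr e)))
   (w : mor (act P Q (irr f)) (irr h)) :
  comul (br v w) = \sum_i csum B (z := act P Q (irr i))
      (fun k d u => tpure (br u w) (br v d)).
Proof.
rewrite bracketE (csum_linE _ _ lin_comul).
under eq_csum do rewrite (csum_linE _ _ lin_comul).
pose G i l (D' : mor (act P Q (irr i)) (irr l)) (U : mor (irr l) (act P Q (irr i))) :=
  tpure (br U w) (br v D').
have Gb i l : bilin (@G i l) by split=> y; rewrite /G; lin.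
transitivity (csum B (fun k (d : mor P (irr k)) u => csum B (fun s (d' : mor Q (irr s)) u' =>
   \sum_i csum B (fun l D' U => @G i l D' (tc (u ∘ d) (u' ∘ d') (irr i) ∘ U))))).
  apply: eq_csum => k d u; apply: eq_csum => s d' u'; rewrite comul_pure.
  apply: eq_bigr => i _.
  rewrite (eq_csum B (G := fun l D' U => @G i l (D' ∘ tc d d' (irr i)) (tc u u' (irr i) ∘ U))).
    rewrite (csum_nat B (tc d d' (irr i)) (F := fun l D' U => @G i l D' (tc u u' (irr i) ∘ U))).
      by apply: eq_csum => l D' U; rewrite compA -tcM.
    by move=> l; have [Gl Gr] := Gb i l; split=> y; lin.
  move=> l D' U; rewrite /G -!(bracket_irr B) bracket_nat.
  by rewrite -bracket_nat.
rewrite (csum_lin2 HD B (G := fun y y' => \sum_i csum B (fun l D' U => @G i l D' (tc y y' (irr i) ∘ U)))).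
  by apply: eq_bigr => i _; apply: eq_csum => l D' U; rewrite tc1 comp1l.
by split=> y; apply: lin_bigsum => i; apply: lin_csum => l D' U;
  have [_ Gr] := Gb i l; lin.
Qed.

Lemma tube_comulA x : tassoc (tmap comul id (comul x)) = tmap id comul (comul x).
Proof.
have Li : lin (@id Tube) by [].
have Lm := lin_comul.
move: x; apply: tube_lin_eq => [||a b c e f h v w].
- by apply: (lin_comp (@lin_tassoc _ _ _ _)); apply: (lin_comp (lin_tmap _ _)).
- by apply: (lin_comp (lin_tmap _ _)).
rewrite comul_pure !(lin_sum (lin_tmap _ _)) (lin_sum (@lin_tassoc _ _ _ _)).
pose G i j k (d : mor (act (irr a) (irr b) (irr i)) (irr k))
   (u : mor (irr k) (act (irr a) (irr b) (irr i)))
   l (d' : mor (act (irr a) (irr b) (irr j)) (irr l))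
   (u' : mor (irr l) (act (irr a) (irr b) (irr j))) : tensor Tube (tensor Tube Tube) :=
   tpure (tube_pure u' w) (tpure (tube_pure u d') (tube_pure v d)).
transitivity (\sum_i \sum_j csum B (fun k d u => csum B (fun l d' u' => @G i j k d u l d' u'))).
  apply: eq_bigr => i _.
  rewrite (csum_linE _ _ (lin_tmap _ _)) (csum_linE _ _ (@lin_tassoc _ _ _ _)).
  rewrite -csum_bigsum; apply: eq_csum => k d u.
  have Lt : lin (fun t : tensor Tube Tube => tassoc (tpure t (tube_pure v d))).
    exact: (lin_comp (@lin_tassoc _ _ _ _) (lin_tpurel _)).
  rewrite tmapE // comul_pure (lin_sum Lt); apply: eq_bigr => j _.
  by rewrite (csum_linE _ _ Lt); apply: eq_csum => l d' u'; rewrite tassocE.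
rewrite exchange_big; apply: eq_bigr => j _ /=; rewrite (csum_linE _ _ (lin_tmap _ _)).
rewrite (eq_bigr _ (fun i _ => exchange_csum B _)) -csum_bigsum.
apply: eq_csum => l d' u'.
have Lt : lin (tpure (tube_pure u' w) : tensor Tube Tube -> _) by apply: lin_tpurer.
rewrite tmapE // comul_pure (lin_sum Lt); apply: eq_bigr => i _.
by rewrite (csum_linE _ _ Lt).
Qed.

Lemma lin_counit : lin (fun x : Tube => tube_counit x : C^o).
Proof. exact: lin_tube_lift. Qed.

Lemma counit_pure a b c e f h v w : tube_counit (@tube_pure R D X a b c e f h v w) =
  sc (dl h c ∘ w ∘ fm _ _ (dl e f) ∘ v).
Proof.
rewrite /tube_counit tube_liftE //; split=> y.
  by apply: (lin_comp (@lin_sc _ _ _ _)); lin.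
by apply: (lin_comp (@lin_sc _ _ _ _)); lin.
Qed.

Lemma counit_bracket P Q c e f h (v : mor (irr c) (act P Q (irr e)))
   (w : mor (act P Q (irr f)) (irr h)) :
  tube_counit (br v w) = sc (dl h c ∘ w ∘ fm P Q (dl e f) ∘ v).
Proof.
rewrite bracketE (csum_linE _ _ lin_counit).
under eq_csum do rewrite (csum_linE _ _ lin_counit).
pose G y y' := sc (dl h c ∘ w ∘ (tc y y' (irr f) ∘ (fm P Q (dl e f) ∘ v))) : C^o.
transitivity (csum B (fun k (d : mor P (irr k)) u => csum B (fun s (d' : mor Q (irr s)) u' =>
   G (u ∘ d) (u' ∘ d')))).
  apply: eq_csum => k d u; apply: eq_csum => s d' u'; rewrite counit_pure /G tcM.
  rewrite -!compA; congr (sc (_ ∘ (_ ∘ (_ ∘ _)))).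
  by rewrite [RHS]compA tc_fm -compA.
rewrite (csum_lin2 HD B (G := G)) /G; last by split=> y; lin.
by rewrite tc1 comp1l !compA.
Qed.

Lemma tube_counitl x : tlift (fun a b : Tube => tube_counit a *: b) (comul x) = x.
Proof.
have Lt : lin (tlift (fun a b : Tube => tube_counit a *: b)) by apply: lin_tlift.
have Lc : forall w : Tube, lin (fun v : Tube => tube_counit v *: w).
  by move=> w; apply: (lin_comp (lin_scalel _ (@lin_id _ _)) lin_counit).
move: x; apply: tube_lin_eq => [||a b c e f h v w] //.
  exact: (lin_comp Lt lin_comul).
rewrite comul_pure (lin_sum Lt) (big_only (j := f)) => [|i fi]; rewrite (csum_linE _ _ Lt).
  transitivity (csum B (fun k d u => sc (dl h k ∘ (w ∘ u)) *: tube_pure v d)).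
    apply: eq_csum => k d u; rewrite tliftE // => [|y]; last by apply: lin_scale.
    by rewrite counit_pure delta_id fm1 comp1r compA.
  by rewrite csum_homl // => k; lin.
rewrite /csum big1 // => k _; rewrite big1 // => p _; rewrite tliftE // => [|y]; last by apply: lin_scale.
by rewrite counit_pure (delta_neq fi) tens0l tens0r comp0r comp0l sc0 scale0r.
Qed.

Lemma tube_counitr x : tlift (fun a b : Tube => tube_counit b *: a) (comul x) = x.
Proof.
have Lt : lin (tlift (fun a b : Tube => tube_counit b *: a)) by apply: lin_tlift.
have Lc : forall w : Tube, lin (fun v : Tube => tube_counit v *: w).
  by move=> w; apply: (lin_comp (lin_scalel _ (@lin_id _ _)) lin_counit).
move: x; apply: tube_lin_eq => [||a b c e f h v w] //.
  exact: (lin_comp Lt lin_comul).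
rewrite comul_pure (lin_sum Lt) (big_only (j := e)) => [|i ei]; rewrite (csum_linE _ _ Lt).
  transitivity (csum B (fun k d u => sc (dl k c ∘ (d ∘ v)) *: tube_pure u w)).
    apply: eq_csum => k d u; rewrite tliftE // => [|y]; last by apply: lin_scale.
    by rewrite counit_pure delta_id fm1 comp1r compA.
  by rewrite csum_homr // => k; lin.
rewrite /csum big1 // => k _; rewrite big1 // => p _; rewrite tliftE // => [|y]; last by apply: lin_scale.
by rewrite counit_pure (@delta_neq _ _ _ e i) 1?eq_sym // tens0l tens0r comp0r comp0l sc0 scale0r.
Qed.
End TubeCoalgebra.

Lemma exchange_big33 (V : nmodType) (I J K L M N : finType) (F : I -> J -> K -> L -> M -> N -> V) :
  \sum_i \sum_j \sum_k \sum_l \sum_m \sum_n F i j k l m n =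
  \sum_l \sum_m \sum_n \sum_i \sum_j \sum_k F i j k l m n.
Proof.
pose S l m n := \sum_i \sum_j \sum_k F i j k l m n.
transitivity (\sum_i \sum_j \sum_l \sum_m \sum_n \sum_k F i j k l m n).
  apply: eq_bigr => i _; apply: eq_bigr => j _; rewrite exchange_big.
  apply: eq_bigr => l _; rewrite exchange_big; apply: eq_bigr => m _.
  by rewrite exchange_big.
rewrite exchange_big4; apply: eq_bigr => l _; apply: eq_bigr => m _.
by rewrite (eq_bigr _ (fun i _ => exchange_big _ _ _ _ _ _)) exchange_big.
Qed.

(** * Weak bialgebra axioms *)

Section TubeBialgebra.
Variables (R : realType) (D : daggerMonCat R) (X : simples D).
Hypothesis HD : unitary_multifusion D.
Variable (B : forall (k : X) (z : D), dual_bases k z).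
Local Notation C := R[i].
Local Notation Tube := (Tube X).
Local Notation br := (tube_bracket B).
Local Notation mul := (tube_mul B).
Local Notation comul := (tube_comul B).
Local Notation unt := (unt B).
Local Notation dl := delta_mor.
Implicit Types (a b c e f h k l : X) (P Q : D).

Lemma tmul_pureE (x y x' y' : Tube) :
  tmul mul mul (tpure x y) (tpure x' y') = tpure (mul x x') (mul y y').
Proof. by apply: tmulE => ?; first [apply: lin_tube_mull | apply: lin_tube_mulr]. Qed.

(** The left side sums over Hom(k, (a ⊗ a') ⊗ i' ⊗ (b' ⊗ b)). Resolving the identity of the inner
    object a' ⊗ i' ⊗ b' through simple objects k' splits this into an inner and an outer sum, which
    are the two comultiplications; the delta in the product matches k' with the index of the outer
    one. *)
Lemma tube_comulM x y : comul (mul x y) = tmul mul mul (comul x) (comul y).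
Proof.
have Lc := @lin_comul R D X B.
move: x; apply: tube_lin_eq => [||a b c e f h v w].
- exact: (lin_comp Lc (lin_tube_mull _ _)).
- exact: (lin_comp (lin_tmull _ _ _) Lc).
move: y; apply: tube_lin_eq => [||a' b' c' e' f' h' v' w'].
- exact: (lin_comp Lc (lin_tube_mulr _ _)).
- exact: (lin_comp (lin_tmulr _ _ _) Lc).
rewrite mul_pure (comul_bracket HD).
set V := ra _ _ _ _ _ ∘ _; set W := w ∘ _ ∘ _.
pose F i' k (d : mor (act (irr a) (irr b) (act (irr a') (irr b') (irr i'))) (irr k))
    (u : mor (irr k) (act (irr a) (irr b) (act (irr a') (irr b') (irr i')))) :=
  tpure (br (ra (irr a) (irr a') (irr i') (irr b') (irr b) ∘ u) W)
   (br V (d ∘ (ra (irr a) (irr a') (irr i') (irr b') (irr b))^†)).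
have Fb i' k : bilin (@F i' k) by split=> y; rewrite /F; lin.
rewrite !comul_pure (lin_sum (lin_tmulr _ _ _)); apply: eq_bigr => i' _.
rewrite (csum_linE _ _ (lin_tmulr _ _ _)).
transitivity (csum B (@F i')).
  rewrite /F (csum_nat B (ra (irr a) (irr a') (irr i') (irr b') (irr b))^†
    (F := fun k d u => tpure (br (ra (irr a) (irr a') (irr i') (irr b') (irr b) ∘ u) W) (br V d))).
    by apply: eq_csum => k d u; rewrite compA raKV comp1l.
  by move=> k; split=> y; lin.
transitivity (csum B (fun k' (d' : mor (act (irr a') (irr b') (irr i')) (irr k')) u' =>
   csum B (fun k (d : mor (act (irr a) (irr b) (irr k')) (irr k)) u =>
   F i' k (d ∘ fm _ _ d') (fm _ _ u' ∘ u)))).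
  transitivity (csum B (fun k d u => F i' k d (fm (irr a) (irr b) (idm _) ∘ u))).
    by apply: eq_csum => k d u; rewrite fm1 comp1l.
  rewrite -(csum_lin HD B (G := fun y => csum B (fun k d u => F i' k d (fm (irr a) (irr b) y ∘ u)))); last first.
    by apply: lin_csum => k d u; have [_ Fr] := Fb i' k; lin.
  apply: eq_csum => k' d' u'.
  rewrite (csum_nat B (fm (irr a) (irr b) d') (F := fun k d u => F i' k d (fm (irr a) (irr b) u' ∘ u))).
    by apply: eq_csum => k d u; rewrite fmM compA.
  by move=> k; have [Fl Fr] := Fb i' k; split=> y; lin.
apply: eq_csum => k' d' u'; rewrite (lin_sum (lin_tmull _ _ _)) (big_only (j := k')) => [|i ik].
  rewrite (csum_linE _ _ (lin_tmull _ _ _)); apply: eq_csum => k d u.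
  by rewrite tmul_pureE !mul_pure !delta_id comp1l comp1r.
rewrite (csum_linE _ _ (lin_tmull _ _ _)) /csum big1 // => k _; rewrite big1 // => p _.
rewrite tmul_pureE !mul_pure (delta_neq ik) comp0r tens0l tens0r comp0l comp0r.
by rewrite (lin0 (lin_bracketl _ _)) (lin0 (lin_tpurel _)).
Qed.

Lemma comul_unt y x : comul (unt y x) = \sum_z tpure (unt z x) (unt y z).
Proof.
rewrite /unt (comul_bracket HD); apply: eq_bigr => i _.
rewrite (csum_iso B _ (pdKV (irr i))) ?dagK //.
by move=> l; split=> t; lin.
Qed.

Lemma comul_one : comul (tube_one X) = \sum_x \sum_y \sum_z tpure (unt z x) (unt y z).
Proof.
rewrite (tube_oneE B) (lin_sum (lin_comul _)); apply: eq_bigr => x _.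
by rewrite (lin_sum (lin_comul _)); apply: eq_bigr => y _; rewrite comul_unt.
Qed.

Lemma comul_one2 : tassoc (tmap comul id (comul (tube_one X))) =
  \sum_x \sum_y \sum_z \sum_t tpure (unt t x) (tpure (unt z t) (unt y z)).
Proof.
rewrite comul_one.
have L : lin (fun t => tassoc (tmap comul (@id Tube) t)).
  by apply: (lin_comp (@lin_tassoc _ _ _ _)); apply: lin_tmap.
do 3! (rewrite (lin_sum L); apply: eq_bigr => ? _).
rewrite tmapE //; last exact: lin_comul.
rewrite comul_unt (lin_sum (lin_tpurel _)) (lin_sum (@lin_tassoc _ _ _ _)).
by apply: eq_bigr => t _; rewrite tassocE.
Qed.

(** A term of the product of the two threefold tensors: the middle factors are orthogonal
    idempotents, so only matching indices survive. *)
Let mid (x y z x' y' z' : X) : tensor Tube (tensor Tube Tube) :=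
  if (y == z') && (z == x') then tpure (unt z x) (tpure (unt y z) (unt y' z')) else 0.

Lemma sum_mid : \sum_x \sum_y \sum_z \sum_x' \sum_y' \sum_z' mid x y z x' y' z' =
  \sum_x \sum_y \sum_z \sum_t tpure (unt t x) (tpure (unt z t) (unt y z)).
Proof.
apply: eq_bigr => x _.
transitivity (\sum_y \sum_z \sum_y' tpure (unt z x) (tpure (unt y z) (unt y' y))).
  apply: eq_bigr => y _; apply: eq_bigr => z _.
  rewrite exchange_big; apply: eq_bigr => y' _.
  exact: (sum2_pick z y (fun x' z' => tpure (unt z x) (tpure (unt y z) (unt y' z')))).
under eq_bigr do rewrite exchange_big.
by rewrite exchange_big; apply: eq_bigr => y _.
Qed.

Lemma tmul3_pureE (x y z x' y' z' : Tube) :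
  tmul mul (tmul mul mul) (tpure x (tpure y z)) (tpure x' (tpure y' z')) =
  tpure (mul x x') (tpure (mul y y') (mul z z')).
Proof.
rewrite tmulE ?tmul_pureE // => t; by [apply: lin_tube_mull|apply: lin_tube_mulr|apply: lin_tmull|apply: lin_tmulr].
Qed.

Let D1_1 := tassoc (tpure (comul (tube_one X)) (tube_one X)).
Let one_D1 := tpure (tube_one X) (comul (tube_one X)).

Lemma D1_1E : D1_1 = \sum_x \sum_y \sum_z tpure (unt z x) (tpure (unt y z) (tube_one X)).
Proof.
rewrite /D1_1 comul_one.
have L : lin (fun t : tensor Tube Tube => tassoc (tpure t (tube_one X))).
  exact: (lin_comp (@lin_tassoc _ _ _ _) (lin_tpurel _)).
by do 3! (rewrite (lin_sum L); apply: eq_bigr => ? _); rewrite tassocE.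
Qed.

Lemma one_D1E : one_D1 = \sum_x \sum_y \sum_z tpure (tube_one X) (tpure (unt z x) (unt y z)).
Proof.
rewrite /one_D1 comul_one.
by do 3! (rewrite (lin_sum (lin_tpurer _)); apply: eq_bigr => ? _).
Qed.

Lemma tube_comul1l : tassoc (tmap comul id (comul (tube_one X))) =
  tmul mul (tmul mul mul) D1_1 one_D1.
Proof.
rewrite comul_one2 -sum_mid D1_1E one_D1E.
do 3! (rewrite (lin_sum (lin_tmull _ _ _)); apply: eq_bigr => ? _).
do 3! (rewrite (lin_sum (lin_tmulr _ _ _)); apply: eq_bigr => ? _).
rewrite tmul3_pureE mul_bracket1 // mul_1bracket // unt_mul // /mid.
case: ifP => // _; rewrite (lin0 (lin_tpurel _)) (lin0 (lin_tpurer _)) //.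
Qed.

Lemma tube_comul1r : tassoc (tmap comul id (comul (tube_one X))) =
  tmul mul (tmul mul mul) one_D1 D1_1.
Proof.
rewrite comul_one2 -sum_mid D1_1E one_D1E.
rewrite (exchange_big33 (fun x y z x' y' z' => mid x y z x' y' z')).
do 3! (rewrite (lin_sum (lin_tmull _ _ _)); apply: eq_bigr => ? _).
do 3! (rewrite (lin_sum (lin_tmulr _ _ _)); apply: eq_bigr => ? _).
rewrite tmul3_pureE mul_bracket1 // mul_1bracket // unt_mul // /mid.
rewrite eq_sym [X in _ && X]eq_sym; case: ifP => [/andP[/eqP-> /eqP->] //|_].
by rewrite (lin0 (lin_tpurel _)) (lin0 (lin_tpurer _)).
Qed.

Lemma counit_mul_bracket P Q P' Q' c e f h c' e' f' h'
    (v : mor (irr c) (act P Q (irr e))) (w : mor (act P Q (irr f)) (irr h))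
    (v' : mor (irr c') (act P' Q' (irr e'))) (w' : mor (act P' Q' (irr f')) (irr h')) :
  tube_counit (mul (br v w) (br v' w')) =
  sc (dl h c ∘ (w ∘ (fm P Q (dl h' f ∘ (w' ∘ fm P' Q' (dl e' f') ∘ v') ∘ dl e c') ∘ v))).
Proof.
rewrite mul_bracket // (counit_bracket HD); congr sc.
rewrite -!compA; congr (_ ∘ (_ ∘ _)).
rewrite [fm (P ⊗ P') _ _ ∘ _]compA -ra_nat -!compA [(ra _ _ _ _ _)^† ∘ _]compA raK comp1l.
by rewrite !fmM -!compA.
Qed.

(** By [counit_mul_bracket] the left side is the scalar of a nested composite. Its inner part, v'
    followed by z, lies in Hom(c', a' ⊗ i ⊗ b'); expanding it in a basis splits the scalar into a
    product, one factor for each tensor component of the comultiplication. *)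
Lemma tube_counitM x y z : tube_counit (mul (mul x y) z) =
  tlift (fun y1 y2 => (tube_counit (mul x y1) * tube_counit (mul y2 z)) : C^o) (comul y).
Proof.
have Le := @lin_counit R D X; have Lc := @lin_comul R D X B.
have Lb (x0 z0 : Tube) : bilin (fun y1 y2 : Tube => (tube_counit (mul x0 y1) * tube_counit (mul y2 z0)) : C^o).
  split=> t; first by apply: lin_mull; apply: (lin_comp Le); lin.
  by apply: lin_mulr; apply: (lin_comp Le); lin.
rewrite -tube_mulA //.
move: x; apply: (tube_lin_eq (L := C^o)) => [||a b c e f h v w].
- by apply: (lin_comp Le); lin.
- by apply: lin_tlift_fun => y1 y2; apply: lin_mull; apply: (lin_comp Le); lin.
move: z; apply: (tube_lin_eq (L := C^o)) => [||a'' b'' c'' e'' f'' h'' v'' w''].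
- by apply: (lin_comp Le); lin.
- by apply: lin_tlift_fun => y1 y2; apply: lin_mulr; apply: (lin_comp Le); lin.
move: y; apply: (tube_lin_eq (L := C^o)) => [||a' b' c' e' f' h' v' w'].
- by apply: (lin_comp Le); lin.
- by apply: (lin_comp (lin_tlift _) Lc).
rewrite comul_pure. rewrite (lin_sum (lin_tlift _)). rewrite -(bracket_irr B v w) -(bracket_irr B v'' w'') -(bracket_irr B v' w').
rewrite (mul_bracket HD B v' w' v'' w''). apply: (etrans (counit_mul_bracket _ _ _ _)).
set ze := w'' ∘ fm _ _ (dl e'' f'') ∘ v''.
pose G i k (u : mor (irr k) (act (irr a') (irr b') (irr i))) : C^o :=
  sc (dl h c ∘ (w ∘ (fm (irr a) (irr b) (dl h' f ∘ (w' ∘ fm _ _ (dl i f') ∘ u) ∘ dl e k) ∘ v))).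
have Gl i k : lin (@G i k) by rewrite /G; apply: (lin_comp (@lin_sc _ _ _ _)); lin.
transitivity (\sum_i G i c' (fm _ _ (dl h'' i ∘ ze ∘ dl e' c'') ∘ v')).
  rewrite (big_only (j := h'')) => [|i ih]; last first.
    by rewrite (@delta_neq _ _ _ h'' i) 1?eq_sym // !comp0l tens0l tens0r comp0l (lin0 (Gl _ _)).
  rewrite /G delta_id comp1l; congr (sc (_ ∘ (_ ∘ (fm _ _ (_ ∘ _ ∘ _) ∘ _)))).
  rewrite /ze !fmM -!compA; congr (_ ∘ (_ ∘ _)).
  by rewrite [fm (irr a' ⊗ irr a'') _ _ ∘ _]compA -ra_nat -!compA [(ra _ _ _ _ _)^† ∘ _]compA raK comp1l.
apply: eq_bigr => i _; rewrite (csum_linE _ _ (lin_tlift _)).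
rewrite -[LHS](csum_homr B _ (Gl i)); apply: eq_csum => k d u.
rewrite (tliftE _ _ (Lb _ _).1 (Lb _ _).2) -(bracket_irr B u w') -(bracket_irr B v' d).
rewrite [X in _ = X * _]counit_mul_bracket [X in _ = _ * X]counit_mul_bracket.
by rewrite mulrC.
Qed.

(** The same nested composite, but the part that is expanded is z followed by w', in Hom(a' ⊗ i ⊗
    b', h'); this exchanges the two tensor components. *)
Lemma tube_counitMop x y z : tube_counit (mul (mul x y) z) =
  tlift (fun y1 y2 => (tube_counit (mul x y2) * tube_counit (mul y1 z)) : C^o) (comul y).
Proof.
have Le := @lin_counit R D X; have Lc := @lin_comul R D X B.
have Lb (x0 z0 : Tube) : bilin (fun y1 y2 : Tube => (tube_counit (mul x0 y2) * tube_counit (mul y1 z0)) : C^o).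
  split=> t; first by apply: lin_mulr; apply: (lin_comp Le); lin.
  by apply: lin_mull; apply: (lin_comp Le); lin.
rewrite -tube_mulA //.
move: x; apply: (tube_lin_eq (L := C^o)) => [||a b c e f h v w].
- by apply: (lin_comp Le); lin.
- by apply: lin_tlift_fun => y1 y2; apply: lin_mull; apply: (lin_comp Le); lin.
move: z; apply: (tube_lin_eq (L := C^o)) => [||a'' b'' c'' e'' f'' h'' v'' w''].
- by apply: (lin_comp Le); lin.
- by apply: lin_tlift_fun => y1 y2; apply: lin_mulr; apply: (lin_comp Le); lin.
move: y; apply: (tube_lin_eq (L := C^o)) => [||a' b' c' e' f' h' v' w'].
- by apply: (lin_comp Le); lin.
- by apply: (lin_comp (lin_tlift _) Lc).
rewrite comul_pure. rewrite (lin_sum (lin_tlift _)).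
rewrite -(bracket_irr B v w) -(bracket_irr B v'' w'') -(bracket_irr B v' w').
rewrite (mul_bracket HD B v' w' v'' w''). apply: (etrans (counit_mul_bracket _ _ _ _)).
set ze := w'' ∘ fm _ _ (dl e'' f'') ∘ v''.
pose G i k (d : mor (act (irr a') (irr b') (irr i)) (irr k)) : C^o :=
  sc (dl h c ∘ (w ∘ (fm (irr a) (irr b) (dl k f ∘ (d ∘ fm _ _ (dl e' i) ∘ v') ∘ dl e c') ∘ v))).
have Gl i k : lin (@G i k) by rewrite /G; apply: (lin_comp (@lin_sc _ _ _ _)); lin.
transitivity (\sum_i G i h' (w' ∘ fm _ _ (dl h'' f' ∘ ze ∘ dl i c''))).
  rewrite (big_only (j := e')) => [|i ie]; last first.
    rewrite /G (@delta_neq _ _ _ e' i) 1?eq_sym // tens0l tens0r !(comp0l, comp0r).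
    by rewrite tens0l tens0r !(comp0l, comp0r) sc0.
  rewrite /G delta_id fm1 comp1r; congr (sc (_ ∘ (_ ∘ (fm _ _ (_ ∘ _ ∘ _) ∘ _)))).
  rewrite /ze !fmM -!compA; congr (_ ∘ (_ ∘ (_ ∘ _))).
  by rewrite [fm (irr a' ⊗ irr a'') _ _ ∘ _]compA -ra_nat -!compA [(ra _ _ _ _ _)^† ∘ _]compA raK comp1l.
apply: eq_bigr => i _; rewrite (csum_linE _ _ (lin_tlift _)).
rewrite -[LHS](csum_homl B _ (Gl i)); apply: eq_csum => k d u.
rewrite (tliftE _ _ (Lb _ _).1 (Lb _ _).2) -(bracket_irr B u w') -(bracket_irr B v' d).
rewrite [X in _ = X * _]counit_mul_bracket [X in _ = _ * X]counit_mul_bracket.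
by rewrite mulrC -[w' ∘ _ ∘ u]compA.
Qed.
End TubeBialgebra.

(** * Bending and the antipode *)

Section Bending.
Variables (R : realType) (D : daggerMonCat R) (X : simples D) (sph : spherical X).
Local Notation C := R[i].
Local Notation "x ^b" := (bar sph x) (at level 2, format "x ^b").
Implicit Types (a b c e f h k l : X) (x y z : D).
Local Notation F a b x := (act (irr a) (irr b) x).
Local Notation G a b x := (act (irr a^b) (irr b^b) x).
Local Notation Fm a b f := (fm (irr a) (irr b) f).
Local Notation Gm a b f := (fm (irr a^b) (irr b^b) f).

(* The units of the adjunction [a ⊗ - ⊗ b -| abar ⊗ - ⊗ bbar] and of the opposite one. *)
Definition eta a b x : mor x (G a b (F a b x)) :=
  locked ((ra _ _ _ _ _)^† ∘ tc (ev sph a)^† (coev sph b) x ∘ pd x).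
Definition kappa a b x : mor x (F a b (G a b x)) :=
  locked ((ra _ _ _ _ _)^† ∘ tc (coev sph a) (ev sph b)^† x ∘ pd x).

Lemma flatE a b x y (u : mor (F a b x) y) : flat sph u = Gm a b u ∘ eta a b x.
Proof. by rewrite /flat /eta -lock reassocE padE !compA. Qed.
Lemma sharpE a b x y (u : mor y (F a b x)) : sharp sph u = (eta a b x)^† ∘ Gm a b u.
Proof. by rewrite /sharp /eta -lock reassocE padE !dag_comp !dagK tc_dag dagK !compA. Qed.

Lemma eta_ra a b x :
  ra _ _ _ _ _ ∘ eta a b x = tc (ev sph a)^† (coev sph b) x ∘ pd x.
Proof. by rewrite /eta -lock !compA raKV comp1l. Qed.
Lemma eta_dag a b x :
  (eta a b x)^† = (pd x)^† ∘ (tc (ev sph a) (coev sph b)^† x ∘ ra _ _ _ _ _).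
Proof. by rewrite /eta -lock !dag_comp !dagK tc_dag dagK. Qed.
Lemma kappa_ra a b x :
  ra _ _ _ _ _ ∘ kappa a b x = tc (coev sph a) (ev sph b)^† x ∘ pd x.
Proof. by rewrite /kappa -lock !compA raKV comp1l. Qed.

Lemma eta_nat a b x y (f : mor x y) : eta a b y ∘ f = Gm a b (Fm a b f) ∘ eta a b x.
Proof.
rewrite /eta -!lock -!compA pd_nat [tc _ _ _ ∘ _]compA tc_fm.
by rewrite -!compA [RHS]compA fm_ra -compA.
Qed.
Lemma kappa_nat a b x y (f : mor x y) : kappa a b y ∘ f = Fm a b (Gm a b f) ∘ kappa a b x.
Proof.
rewrite /kappa -!lock -!compA pd_nat [tc _ _ _ ∘ _]compA tc_fm.
by rewrite -!compA [RHS]compA fm_ra -compA.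
Qed.

(** The triangle identities of the adjunction with unit [eta] and counit [kappa^†]; the snakes for
    [a] and [b] act on opposite sides of [x]. *)
Lemma kappa_eta a b x : (kappa a b (F a b x))^† ∘ Fm a b (eta a b x) = idm _.
Proof.
have za := dual_zigzag sph a; have zb := dual_zigzag sph b.
rewrite /kappa /eta -!lock -!reassocE -!padE /reassoc /pad; strict.
have E := congr1 (@dag _ _ _ _) (snake1 za (x ⊗ (irr b ⊗ (irr b^b ⊗ (irr b ⊗ tunit))))).
rewrite dag_comp tensm_dag !dag_id in E.
rewrite dag_comp tens1M -!compA [(st (coev _ a) _)^† ∘ _]compA E comp1l.
by rewrite !tensm_dag !dag_id dagK -!tens1M snake1 // !tensm_id.
Qed.
Lemma kappa_eta' a b x : Gm a b (kappa a b x)^† ∘ eta a b (G a b x) = idm _.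
Proof.
have za := dual_zigzag sph a; have zb := dual_zigzag sph b.
rewrite /kappa /eta -!lock -!reassocE -!padE /reassoc /pad; strict.
have E := congr1 (@dag _ _ _ _) (snake2 za (x ⊗ (irr b^b ⊗ (irr b ⊗ (irr b^b ⊗ tunit))))).
rewrite dag_comp tensm_dag !dag_id in E.
rewrite dag_comp tens1M -!compA [_ ∘ ((st (ev _ a) _)^† ∘ _)]compA E comp1l.
by rewrite !tensm_dag !dag_id dagK -!tens1M snake2 // !tensm_id.
Qed.

Lemma eta_kappa a b x : Fm a b (eta a b x)^† ∘ kappa a b (F a b x) = idm _.
Proof.
by have := congr1 (@dag _ _ _ _) (kappa_eta a b x); rewrite dag_comp dagK fm_dag dag_id.
Qed.

Lemma sharp_kappa a b x y (u : mor y (F a b x)) : Fm a b (sharp sph u) ∘ kappa a b y = u.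
Proof. by rewrite sharpE fmM -compA -kappa_nat compA eta_kappa comp1l. Qed.

(** [flat] is the adjunction bijection; the argument on the left is the preimage of [g] under it. *)
Lemma flat_surj a b x y (g : mor x (G a b y)) : flat sph ((kappa a b y)^† ∘ Fm a b g) = g.
Proof. by rewrite flatE fmM -compA -eta_nat compA kappa_eta' comp1l. Qed.

Lemma lin_flat a b x y : lin (@flat R D X sph a b x y).
Proof. by move=> t u v; rewrite !flatE; move: t u v; change (lin (fun u : mor (F a b x) y => Gm a b u ∘ eta a b x)); lin. Qed.
Lemma lin_sharp a b x y : lin (@sharp R D X sph a b x y).
Proof. by move=> t u v; rewrite !sharpE; move: t u v; change (lin (fun u : mor y (F a b x) => (eta a b x)^† ∘ Gm a b u)); lin. Qed.

Section Completeness.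
Hypothesis HD : unitary_multifusion D.
Variable (B : forall (k : X) (z : D), dual_bases k z).

Lemma qdim_div_eq k l (s t : C) :
  qdim sph l * s = qdim sph k * t -> (qdim sph l / qdim sph k) * s = t.
Proof. by move=> E; rewrite mulrAC E mulrAC mulfV ?mul1r // qdim_neq0. Qed.

(** Test on [g = flat w] from a simple object and expand [w] in the dual basis. The coefficient is
    [sc (w ∘ v)], whereas bending produces [sc (sharp v ∘ flat w)]; by the rotation identity the
    weight is exactly their ratio. *)
Lemma bend_complete a b k :
  \sum_f \sum_(p < dbsize (B k (F a b (irr f)))) (qdim sph f / qdim sph k) *:
     (flat sph (tnth (dbd (B k (F a b (irr f)))) p) ∘
      sharp sph (tnth (dbv (B k (F a b (irr f)))) p)) = idm (G a b (irr k)).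
Proof.
set E := \sum_f _.
suff Eg l (g : mor (irr l) (G a b (irr k))) : E ∘ g = g.
  rewrite -[LHS]comp1r -(csum_id HD B) /csum comp_bigr; apply: eq_bigr => l _.
  by rewrite comp_bigr; apply: eq_bigr => p _; rewrite compA Eg.
rewrite /E comp_bigl (big_only (j := l)) => [|f fl]; last first.
  rewrite comp_bigl big1 // => p _.
  by rewrite compZl -compA [_ ∘ g]hom_irr0 ?comp0r ?scaler0 // eq_sym.
rewrite comp_bigl -[RHS](flat_surj g); set w := _ ∘ _.
rewrite [in RHS](dbd_expand B w) (lin_sum (@lin_flat _ _ _ _)).
apply: eq_bigr => p _; rewrite (linZ (@lin_flat _ _ _ _)).
rewrite -[g in LHS](flat_surj g) -/w compZl -compA.
rewrite [sharp _ _ ∘ _]scE compZr comp1r scalerA; congr (_ *: _).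
apply: qdim_div_eq; exact: (sharp_flat sph HD B).
Qed.
End Completeness.
End Bending.

(** * The antipode axioms *)

Section Antipode.
Variables (R : realType) (D : daggerMonCat R) (X : simples D) (sph : spherical X).
Hypothesis HD : unitary_multifusion D.
Variable (B : forall (k : X) (z : D), dual_bases k z).
Local Notation "x ^b" := (bar sph x) (at level 2, format "x ^b").
Local Notation br := (tube_bracket B).
Local Notation mul := (tube_mul B).
Local Notation comul := (tube_comul B).
Local Notation unt := (unt B).
Local Notation dl := delta_mor.
Local Notation S := (tube_antipode sph).
Local Notation d_ := (qdim sph).
Implicit Types (a b c e f h k l : X) (P Q : D).
Local Notation F a b x := (act (irr a) (irr b) x).
Local Notation Fm a b f := (fm (irr a) (irr b) f).

Lemma lin_antipode : lin S.
Proof. exact: lin_tube_lift. Qed.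

Lemma antipode_pure a b c e f h v w : S (@tube_pure R D X a b c e f h v w) =
  (d_ f / d_ h) *: tube_pure (flat sph w) (sharp sph v).
Proof.
rewrite /tube_antipode tube_liftE //; split=> y; apply: lin_scale.
  by apply: (lin_comp (lin_tube_purer _)); apply: lin_sharp.
by apply: (lin_comp (lin_tube_purel _)); apply: lin_flat.
Qed.

Lemma bracket_unt k c h (T : mor (irr c) (irr h)) :
  br (pd (irr k)) (T ∘ (pd (irr c))^†) = sc (dl h c ∘ T) *: unt k c.
Proof.
have [hc|hc] := eqVneq h c.
  move: T; rewrite hc => T; rewrite delta_id comp1l [T in LHS]scE compZl comp1l.
  exact: (linZ (lin_bracketr _ _)).
rewrite (delta_neq hc) comp0l sc0 scale0r (hom_irr0 T) 1?eq_sym // comp0l.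
exact: (lin0 (lin_bracketr _ _)).
Qed.

(** The weights of the antipode are those of [bend_complete], so the sum over bases collapses to
    [kappa]. This is an (ev, coev) pair on the legs; moved to the other argument it straightens
    [sharp v] back to [v]. *)
Lemma mul_comul_antipode a b c e f h (v : mor (irr c) (F a b (irr e)))
    (w : mor (F a b (irr f)) (irr h)) :
  \sum_i csum B (z := F a b (irr i)) (fun k d u => mul (tube_pure u w) (S (tube_pure v d))) =
  sc (dl h c ∘ (w ∘ (Fm a b (dl e f) ∘ v))) *: \sum_k unt k c.
Proof.
set W := w ∘ Fm a b (dl e f ∘ sharp sph v) ∘ (ra _ _ _ _ _)^†.
transitivity (\sum_k \sum_i \sum_(p < dbsize (B k (F a b (irr i)))) (d_ i / d_ k) *:
  br (ra _ _ _ _ _ ∘ (Fm a b (flat sph (tnth (dbd (B k (F a b (irr i)))) p)) ∘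
     tnth (dbv (B k (F a b (irr i)))) p)) W).
  rewrite exchange_big; apply: eq_bigr => i _; apply: eq_bigr => k _; apply: eq_bigr => p _.
  by rewrite antipode_pure (linZ (lin_tube_mulr _ _)) mul_pure delta_id comp1r.
rewrite scaler_sumr; apply: eq_bigr => k _; rewrite -bracket_unt.
transitivity (br (ra _ _ _ _ _ ∘ kappa sph a b (irr k)) W).
  (* The identity in front of [kappa] is replaced by its resolution through bent bases;
     [sharp_kappa] then unbends each basis vector. *)
  rewrite -[kappa _ _ _ _]comp1l -fm1 -(bend_complete sph HD B a b k).
  rewrite tens_suml tens_sumr comp_bigl comp_bigr (lin_sum (lin_bracketl _ _)).
  apply: eq_bigr => i _.
  rewrite tens_suml tens_sumr comp_bigl comp_bigr (lin_sum (lin_bracketl _ _)).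
  apply: eq_bigr => p _.
  rewrite tensZl tensZr compZl compZr (linZ (lin_bracketl _ _)).
  by rewrite fmM -[_ ∘ kappa _ _ _ _]compA sharp_kappa.
rewrite kappa_ra bracket_nat; congr (br _ _).
rewrite -[LHS]comp1r -(pdKV (irr c)) compA; congr (_ ∘ _).
rewrite /W -!compA -(kappa_ra sph a b) [(ra _ _ _ _ _)^† ∘ _]compA raK comp1l.
by rewrite fmM -compA sharp_kappa.
Qed.

(** Here the bases meet as [u ∘ d] and sum to an identity at once. The weight is constant along the
    sum and is absorbed by the rotation identity for [v] and [w]. *)
Lemma antipode_mul_comul a b c e f h (v : mor (irr c) (F a b (irr e)))
    (w : mor (F a b (irr f)) (irr h)) :
  \sum_i csum B (z := F a b (irr i)) (fun k d u => mul (S (tube_pure u w)) (tube_pure v d)) =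
  sc (dl h c ∘ (w ∘ (Fm a b (dl e f) ∘ v))) *: \sum_i unt f i.
Proof.
set V := ra _ _ _ _ _ ∘ (fm (irr a^b) (irr b^b) (v ∘ dl h c) ∘ flat sph w).
rewrite scaler_sumr; apply: eq_bigr => i _.
transitivity (csum B (z := F a b (irr i)) (fun k d u => (d_ f / d_ h) *:
   br V ((eta sph a b (irr i))^† ∘ fm (irr a^b) (irr b^b) (u ∘ d) ∘ (ra _ _ _ _ _)^†))).
  apply: eq_csum => k d u; rewrite antipode_pure (linZ (lin_tube_mull _ _)) mul_pure.
  rewrite delta_id comp1l /V; congr (_ *: br _ (_ ∘ _)).
  by rewrite sharpE fmM !compA.
rewrite (csum_lin HD B (G := fun y => (d_ f / d_ h) *:
   br V ((eta sph a b (irr i))^† ∘ fm (irr a^b) (irr b^b) y ∘ (ra _ _ _ _ _)^†))); last by lin.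
rewrite fm1 comp1r -dag_comp eta_ra dag_comp tc_dag dagK -bracket_nat.
have -> : tc (ev sph a) (coev sph b)^† (irr e) ∘ V =
    pd (irr e) ∘ (sharp sph (v ∘ dl h c) ∘ flat sph w).
  rewrite /V sharpE !compA; congr (_ ∘ _ ∘ _).
  by rewrite eta_dag compA compA pdKV comp1l.
set T := _ ∘ flat sph w.
have [ef|ef] := eqVneq e f; last first.
  rewrite (delta_neq ef) tens0l tens0r comp0l !comp0r sc0 scale0r.
  by rewrite (hom_irr0 T) 1?eq_sym // comp0r (lin0 (lin_bracketl _ _)) scaler0.
case: f / ef w @V @T => w V T.
rewrite delta_id fm1 comp1l sc_delta_comm -[w ∘ v ∘ dl h c]compA.
rewrite -(qdim_div_eq (sharp_flat sph HD B (v ∘ dl h c) w)).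
rewrite -[T]/(sharp sph (v ∘ dl h c) ∘ flat sph w) -/T [T in LHS]scE compZr comp1r.
by rewrite (linZ (lin_bracketl _ _)) scalerA.
Qed.

Lemma tube_antipoder x :
  tlift (fun x1 x2 => mul x1 (S x2)) (comul x) =
  tlift (fun u1 u2 => tube_counit (mul u1 x) *: u2) (comul (tube_one X)).
Proof.
have Le := @lin_counit R D X; have Lc := @lin_comul R D X B; have LS := lin_antipode.
move: x; apply: tube_lin_eq => [||a b c e f h v w].
- by apply: (lin_comp (lin_tlift _)).
- apply: lin_tlift_fun => x y; apply: (lin_comp (lin_scalel _ (@lin_id _ _))).
  by apply: (lin_comp Le); lin.
rewrite comul_pure. rewrite (lin_sum (lin_tlift _)).
transitivity (\sum_i csum B (z := F a b (irr i)) (fun k d u => mul (tube_pure u w) (S (tube_pure v d)))).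
  apply: eq_bigr => i _; rewrite (csum_linE _ _ (lin_tlift _)); apply: eq_csum => k d u.
  apply: tliftE => y; first by lin.
  by apply: (lin_comp (lin_tube_mulr _ _)).
rewrite mul_comul_antipode.
rewrite (comul_one HD) (lin_sum (lin_tlift _)) [RHS](big_only (j := h)) => [|x xh].
  rewrite (lin_sum (lin_tlift _)) scaler_sumr; apply: eq_bigr => y _.
  rewrite (lin_sum (lin_tlift _)) (big_only (j := c)) => [|z zc].
    rewrite tliftE => [|t|t]; last by apply: lin_scale.
      rewrite -(bracket_irr B v w) mul_unitl // !eqxx (counit_bracket HD).
      by rewrite -!compA.
    apply: (lin_comp (lin_scalel _ (@lin_id _ _))).
    by apply: (lin_comp Le); lin.
  rewrite tliftE => [|t|t]; last by apply: lin_scale.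
    by rewrite -(bracket_irr B v w) mul_unitl // (negPf zc) (lin0 Le) scale0r.
  apply: (lin_comp (lin_scalel _ (@lin_id _ _))).
  by apply: (lin_comp Le); lin.
rewrite (lin_sum (lin_tlift _)) big1 // => y _.
rewrite (lin_sum (lin_tlift _)) big1 // => z _.
rewrite tliftE => [|t|t]; last by apply: lin_scale.
  by rewrite -(bracket_irr B v w) mul_unitl // (negPf xh) andbF (lin0 Le) scale0r.
apply: (lin_comp (lin_scalel _ (@lin_id _ _))).
by apply: (lin_comp Le); lin.
Qed.

Lemma tube_antipodel x :
  tlift (fun x1 x2 => mul (S x1) x2) (comul x) =
  tlift (fun u1 u2 => tube_counit (mul x u2) *: u1) (comul (tube_one X)).
Proof.
have Le := @lin_counit R D X; have Lc := @lin_comul R D X B; have LS := lin_antipode.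
move: x; apply: tube_lin_eq => [||a b c e f h v w].
- by apply: (lin_comp (lin_tlift _)).
- apply: lin_tlift_fun => x y; apply: (lin_comp (lin_scalel _ (@lin_id _ _))).
  by apply: (lin_comp Le); lin.
rewrite comul_pure. rewrite (lin_sum (lin_tlift _)).
transitivity (\sum_i csum B (z := F a b (irr i)) (fun k d u => mul (S (tube_pure u w)) (tube_pure v d))).
  apply: eq_bigr => i _; rewrite (csum_linE _ _ (lin_tlift _)); apply: eq_csum => k d u.
  apply: tliftE => y; last by lin.
  by apply: (lin_comp (lin_tube_mull _ _)).
rewrite antipode_mul_comul.
rewrite (comul_one HD) (lin_sum (lin_tlift _)) scaler_sumr; apply: eq_bigr => x _.
rewrite (lin_sum (lin_tlift _)) (big_only (j := e)) => [|y ye].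
  rewrite (lin_sum (lin_tlift _)) (big_only (j := f)) => [|z zf].
    rewrite tliftE => [|t|t]; first last.
    - apply: (lin_comp (lin_scalel _ (@lin_id _ _))).
      by apply: (lin_comp Le); lin.
    - by apply: lin_scale.
    rewrite -(bracket_irr B v w) mul_unitr // !eqxx (counit_bracket HD).
    by rewrite -!compA.
  rewrite tliftE => [|t|t]; first last.
  - apply: (lin_comp (lin_scalel _ (@lin_id _ _))).
    by apply: (lin_comp Le); lin.
  - by apply: lin_scale.
  by rewrite -(bracket_irr B v w) mul_unitr // [f == z]eq_sym (negPf zf) andbF (lin0 Le) scale0r.
rewrite (lin_sum (lin_tlift _)) big1 // => z _.
rewrite tliftE => [|t|t]; first last.
- apply: (lin_comp (lin_scalel _ (@lin_id _ _))).
  by apply: (lin_comp Le); lin.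
- by apply: lin_scale.
by rewrite -(bracket_irr B v w) mul_unitr // eq_sym (negPf ye) (lin0 Le) scale0r.
Qed.

(** [antipode_mul_comul] turns the first two factors into scalars times idempotents; the scalars are
    the coefficients that reassemble [w] in the last factor, on which the idempotents act as the
    identity. *)
Lemma tube_antipode3 x :
  tlift (fun x1 x23 =>
    tlift (fun x2 x3 => mul (mul (S x1) x2) (S x3)) x23)
    (tmap id comul (comul x)) = S x.
Proof.
have Lc := @lin_comul R D X B; have LS := lin_antipode.
have Ll x3 y : lin (fun x1 => mul (mul (S x1) x3) y).
  apply: (lin_comp (lin_tube_mull _ _)); apply: (lin_comp (lin_tube_mull _ _)); exact: LS.
have Lm x1 y : lin (fun x2 => mul (mul (S x1) x2) y).
  by apply: (lin_comp (lin_tube_mull _ _)); apply: lin_tube_mulr.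
have Lr x1 x2 : lin (fun x3 => mul (mul (S x1) x2) (S x3)).
  by apply: (lin_comp (lin_tube_mulr _ _)).
have Lt x1 : lin (tlift (fun x2 x3 => mul (mul (S x1) x2) (S x3))) by apply: lin_tlift.
move: x; apply: tube_lin_eq => [||a b c e f h v w] //.
  by apply: (lin_comp (lin_tlift _)); apply: (lin_comp (lin_tmap _ _)).
rewrite comul_pure. rewrite (lin_sum (lin_tmap _ _)) (lin_sum (lin_tlift _)).
transitivity (\sum_i \sum_j csum B (z := F a b (irr i)) (fun k d u =>
  csum B (z := F a b (irr j)) (fun l d' u' =>
  mul (mul (S (tube_pure u w)) (tube_pure u' d)) (S (tube_pure v d'))))).
  apply: eq_bigr => i _.
  rewrite (csum_linE _ _ (lin_tmap _ _)) (csum_linE _ _ (lin_tlift _)) -csum_bigsum.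
  apply: eq_csum => k d u; rewrite tmapE //.
  rewrite tliftE //; last by move=> y; apply: lin_tlift_fun => x2 x3; apply: Ll.
  rewrite comul_pure. rewrite (lin_sum (lin_tlift _)); apply: eq_bigr => j _.
  rewrite (csum_linE _ _ (lin_tlift _)); apply: eq_csum => l d' u'.
  exact: (tliftE _ _ (fun t => Lm _ (S t)) (Lr _)).
rewrite exchange_big.
transitivity (\sum_j csum B (z := F a b (irr j)) (fun l d' u' =>
   mul (sc (dl h l ∘ (w ∘ (Fm a b (dl j f) ∘ u'))) *: \sum_i unt f i) (S (tube_pure v d')))).
  apply: eq_bigr => j _; rewrite (eq_bigr _ (fun i _ => exchange_csum B _)) -csum_bigsum.
  apply: eq_csum => l d' u'; rewrite -antipode_mul_comul.
  rewrite (lin_sum (lin_tube_mull _ _)); apply: eq_bigr => i _.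
  by rewrite (csum_linE _ _ (lin_tube_mull _ _)).
rewrite (big_only (j := f)) => [|j jf]; last first.
  rewrite /csum big1 // => l _; rewrite big1 // => p _.
  by rewrite (delta_neq jf) tens0l tens0r comp0l !comp0r sc0 scale0r (lin0 (lin_tube_mull _ _)).
transitivity (csum B (z := F a b (irr f)) (fun l d' u' =>
    sc (dl h l ∘ (w ∘ u')) *: mul (\sum_i unt f i) (S (tube_pure v d')))).
  by apply: eq_csum => l d' u'; rewrite delta_id fm1 comp1l (linZ (lin_tube_mull _ _)).
rewrite (csum_homl B w (G := fun k d => mul (\sum_i unt f i) (S (tube_pure v d)))); last first.
  by move=> k; apply: (lin_comp (lin_tube_mulr _ _)); apply: (lin_comp LS); lin.
rewrite antipode_pure (linZ (lin_tube_mulr _ _)); congr (_ *: _).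
rewrite -(bracket_irr B) (lin_sum (lin_tube_mull _ _)) (big_only (j := e)) => [|i ie].
  by rewrite mul_unitl // !eqxx.
by rewrite mul_unitl // (negPf ie) andbF.
Qed.
End Antipode.

(** * The involution *)

Section DoubleDual.
Variables (R : realType) (D : daggerMonCat R) (X : simples D) (sph : spherical X).
Local Notation "x ^b" := (bar sph x) (at level 2, format "x ^b").
Local Notation d_ := (qdim sph).
Implicit Types (a b c e f h k l : X) (x y z : D).
Local Notation F a b x := (act (irr a) (irr b) x).

(** Both [a], by flipping its zigzag, and the double dual are duals of [a^b]; transposing the
    identity of [a^b] compares them. *)
Definition bidual a : mor (irr a) (irr a^b^b) :=
  dualm (coev sph a^b) (coev sph a)^† (idm _).
Definition bidual_inv a : mor (irr a^b^b) (irr a) :=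
  dualm (ev sph a)^† (ev sph a^b) (idm _).

Let zf a := zigzag_flip (dual_zigzag sph a).
Let zb a := dual_zigzag sph a^b.

Lemma bidualK a : bidual_inv a ∘ bidual a = idm _.
Proof.
rewrite /bidual /bidual_inv -(dualm_comp _ _ _ (zb a) (zf a)) comp1l.
exact: dualm_id (zf a).
Qed.

(** [bidual a] carries the flipped evaluation of [a] to the coevaluation of [a^b], so the two loops
    differ by its scalar. *)
Lemma bidual_scale a : d_ a^b = sc ((bidual a)^† ∘ bidual a) * d_ a.
Proof.
have E : (idm _ ⊗m bidual a) ∘ (ev sph a)^† = coev sph a^b.
  by rewrite (dualm_coev _ _ (zf a)) tensm_id comp1l.
have := ev_tr sph ((bidual a)^† ∘ bidual a).
rewrite tens1M compA -compA E.
have -> : ev sph a ∘ (idm _ ⊗m (bidual a)^†) = (coev sph a^b)^†.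
  by rewrite -E dag_comp tensm_dag dag_id dagK.
have [i ->] := coev_norm sph a^b; have [j ->] := ev_norm sph a.
by rewrite scalerA; apply: unit_scale_inj.
Qed.

Lemma bidual_scale' a : d_ a = sc (bidual a ∘ (bidual a)^†) * d_ a^b.
Proof.
have E : (coev sph a)^† = ev sph a^b ∘ (bidual a ⊗m idm _).
  by have := dualm_ev (coev sph a)^† (idm _) (zb a); rewrite tensm_id comp1r.
have := ev_tr' (bidual a ∘ (bidual a)^†).
rewrite tensM1 compA -E -compA.
have -> : ((bidual a)^† ⊗m idm _) ∘ (ev sph a^b)^† = coev sph a.
  by rewrite -[RHS]dagK E dag_comp tensm_dag dag_id.
have [i ->] := coev_norm sph a; have [j ->] := ev_norm sph a^b.
by rewrite scalerA; apply: unit_scale_inj.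
Qed.

(** Both composites with the dagger are one scalar s, since the objects are simple. Comparing loops
    in both directions gives s^2 = 1, and s >= 0 by positivity. *)
Lemma bidual_unitary a : unitary (bidual a).
Proof.
set j := bidual a; set s := sc (j^† ∘ j); set s' := sc (j ∘ j^†).
have j0 : j != 0.
  apply: contra_neq (qdim_neq0 sph a^b) => j0.
  by rewrite bidual_scale -/j j0 comp0r sc0 mul0r.
have ss : s = s'.
  apply/eqP; rewrite -subr_eq0; have : (s - s') *: j = 0.
    rewrite scalerBl -[X in s *: X - _]comp1r -compZr -scE compA.
    by rewrite [X in X ∘ j]scE compZl comp1l subrr.
  by move/eqP; rewrite scaler_eq0 (negPf j0) orbF.
have s1 : s = 1.
  have s2 : s ^+ 2 = 1.
    apply: (mulIf (qdim_neq0 sph a)); rewrite mul1r [RHS]bidual_scale' -/j -/s' -ss.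
    by rewrite expr2 -mulrA -bidual_scale.
  have s0 : 0 <= s by apply: sc_ge0.
  by apply/eqP; rewrite -(eqrXn2 (n := 2)) // expr1n s2.
by split; apply: sc_inj; rewrite sc_id // -/s' -ss.
Qed.

Lemma bar_bar a : a^b^b = a.
Proof.
have [j1 j2] := bidual_unitary a.
by apply: irr_inj; exists (bidual a)^†, (bidual a).
Qed.

Lemma bidual_invE a : bidual_inv a = (bidual a)^†.
Proof.
have [_ j2] := bidual_unitary a.
by rewrite -[LHS]comp1r -j2 compA bidualK comp1l.
Qed.

(** [eta^†] is the bent identity, so bending it once more leaves the double dual comparison on each
    leg. *)
Lemma flat_eta_dag a b x : flat sph (eta sph a b x)^† = tc (bidual a) (bidual b) x.
Proof.
rewrite -[bidual a]dagK -bidual_invE flatE /eta /bidual_inv /bidual /dualm -!lock -!reassocE -!padE.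
rewrite /reassoc /pad; strict.
set k := st (coev sph b) _.
have E1 := st_nat (ev sph a) (idm x ⊗m k^†).
have E2 := st_nat (ev sph a^b)^† (idm (irr a) ⊗m (idm x ⊗m k^†)).
rewrite /= ?st_dag in E1 E2.
rewrite !dag_comp !tensm_dag !dag_id !dagK !tens1M -!compA.
rewrite [(st (ev _ a^b) _)^† ∘ (_ ∘ _) in RHS]compA E2 -!compA [RHS]compA -tens1M E1.
by rewrite !tens1M -!compA.
Qed.

Lemma bidual_tc a b x : (tc (bidual a) (bidual b) x)^† ∘ tc (bidual a) (bidual b) x = idm _.
Proof.
have [a1 _] := bidual_unitary a; have [b1 _] := bidual_unitary b.
by rewrite tc_dag -tcM a1 b1 tc1.
Qed.

Lemma flat_sharp_bidual a b x y (v : mor y (F a b x)) :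
  flat sph (sharp sph v) = tc (bidual a) (bidual b) x ∘ v.
Proof.
by rewrite flatE sharpE fmM -compA -eta_nat -flat_eta_dag flatE -compA.
Qed.

Lemma flat_dag a b x y (u : mor (F a b x) y) : (flat sph u)^† = sharp sph u^†.
Proof. by rewrite flatE sharpE dag_comp fm_dag. Qed.
Lemma sharp_dag a b x y (u : mor x (F a b y)) : (sharp sph u)^† = flat sph u^†.
Proof. by rewrite -[u in LHS]dagK -flat_dag dagK. Qed.

Lemma sharp_flat_bidual a b x y (w : mor (F a b x) y) :
  sharp sph (flat sph w) = w ∘ (tc (bidual a) (bidual b) x)^†.
Proof.
by rewrite -[LHS]dagK sharp_dag [(flat sph w)^†]flat_dag flat_sharp_bidual dag_comp dagK.
Qed.
End DoubleDual.

Section Star.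
Variables (R : realType) (D : daggerMonCat R) (X : simples D) (sph : spherical X).
Hypothesis HD : unitary_multifusion D.
Variable (B : forall (k : X) (z : D), dual_bases k z).
Hypothesis BO : forall k z p, tnth (dbd (B k z)) p = (tnth (dbv (B k z)) p)^†.
Local Notation C := R[i].
Local Notation "x ^b" := (bar sph x) (at level 2, format "x ^b").
Local Notation d_ := (qdim sph).
Local Notation Tube := (Tube X).
Local Notation comul := (tube_comul B).
Local Notation star := (@tube_star R D X sph).
Implicit Types (a b c e f h k l : X) (P Q : D).
Local Notation F a b x := (act (irr a) (irr b) x).
Local Notation G a b x := (act (irr a^b) (irr b^b) x).

Lemma slin_star : slin Num.conj star.
Proof. exact: slin_tube_lift. Qed.

Lemma starZ (t : C) x : star (t *: x) = t^* *: star x.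
Proof. exact: (slinZ slin_star). Qed.

Lemma slin_comp (s t : {rmorphism C -> C}) (L M N : lmodType C) (f : M -> N) (g : L -> M) :
  slin s f -> slin t g -> slin (s \o t) (fun x => f (g x)).
Proof. by move=> fl gl k x y; rewrite gl fl. Qed.

(** The identity is viewed as semilinear for the square of conjugation, so that [tube_eq] can
    compare it with the square of the star. *)
Lemma slin_id_conj (L : lmodType C) :
  slin [the {rmorphism C -> C} of Num.conj \o Num.conj] (fun x : L => x).
Proof. by move=> k x y; rewrite /= conjCK. Qed.

Lemma qdim_div_conj k l : (d_ k / d_ l)^* = d_ k / d_ l.
Proof.
by apply/conj_Creal/ger0_real; rewrite divr_ge0 // ltW // qdim_gt0.
Qed.

Lemma star_pure a b c e f h v w : star (@tube_pure R D X a b c e f h v w) =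
  (d_ e / d_ c) *: tube_pure (flat sph v^†) (sharp sph w^†).
Proof.
rewrite /tube_star tube_lift_for_pure // => y t v1 v2.
  rewrite (slin_dag t) (lin_flat sph t^* ) (lin_tube_purel _ t^*) scalerDr.
  by rewrite !scalerA mulrC.
rewrite (slin_dag t) (lin_sharp sph t^* ) (lin_tube_purer _ t^*) scalerDr.
by rewrite !scalerA mulrC.
Qed.

(** The double star has legs [a^b^b] and [b^b^b], equal to [a] and [b] only by [bar_bar]. Read as a
    bracket, it returns to the original legs by moving the unitary [bidual] across. *)
Lemma tube_starK : involutive star.
Proof.
have := slin_star; move=> S1.
apply: (tube_eq (s := [the {rmorphism C -> C} of Num.conj \o Num.conj])) => [||a b c e f h v w].
- exact: (slin_comp S1 S1).
- exact: slin_id_conj.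
rewrite star_pure starZ star_pure qdim_div_conj scalerA.
rewrite flat_dag sharp_dag !dagK flat_sharp_bidual sharp_flat_bidual.
have -> : d_ e / d_ c * (d_ c / d_ e) = 1.
  by rewrite mulrA divfK ?divff ?qdim_neq0.
rewrite scale1r -(bracket_irr B) bracket_nat -compA bidual_tc comp1r.
exact: bracket_irr.
Qed.

Let bendsum j a b (Y : lmodType C) (H : forall k, mor (G a b (irr j)) (irr k) -> mor (irr k) (G a b (irr j)) -> Y) :
  (forall k, bilin (H k)) ->
  csum B H = \sum_i \sum_(p < dbsize (B j (F a b (irr i)))) (d_ i / d_ j) *:
    H i (sharp sph (tnth (dbv (B j (F a b (irr i)))) p))
        (flat sph (tnth (dbd (B j (F a b (irr i)))) p)).
Proof.
move=> Hb.
pose T (i : X) := 'I_(dbsize (B j (F a b (irr i)))).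
pose V (t : {i : X & T i}) := tnth (dbv (B j (F a b (irr (tag t))))) (tagged t).
pose W (t : {i : X & T i}) := tnth (dbd (B j (F a b (irr (tag t))))) (tagged t).
rewrite (@csum_decomp R D X B _ _ (fun t : {i : X & T i} => tag t)
  (fun t => (d_ (tag t) / d_ j) *: flat sph (W t)) (fun t => sharp sph (V t))) //.
  rewrite (eq_bigr (fun t => (d_ (tag t) / d_ j) *: H (tag t) (sharp sph (V t)) (flat sph (W t)))).
    by rewrite [RHS](sig_big_dep xpredT (fun=> xpredT) (fun i (p : T i) => _)).
  by move=> t _; rewrite (linZ ((Hb _).2 _)).
rewrite -(bend_complete sph HD B a b j).
rewrite (sig_big_dep xpredT (fun=> xpredT) (fun i (p : T i) => _)) /=.
by apply: eq_bigr => t _; rewrite compZl.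
Qed.

(** For orthonormal bases the dagger exchanges a basis with its dual. The star thus produces bent
    bases, and its two weights combine into that of [bend_complete]. *)
Lemma tube_star_comul x :
  tlift_for Num.conj (fun a b : Tube => tpure (star a) (star b)) (comul x) = comul (star x).
Proof.
have Lc := @lin_comul R D X B; have S1 := slin_star.
have S2 : slin Num.conj (tlift_for Num.conj (fun a b : Tube => tpure (star a) (star b))).
  exact: slin_tlift_for.
move: x; apply: (tube_eq (s := Num.conj)) => [||a b c e f h v w].
- by move=> k x y; rewrite Lc S2.
- by move=> k x y; rewrite S1 Lc.
rewrite comul_pure star_pure (linZ Lc) comul_pure (slin_sum S2).
transitivity ((d_ e / d_ c) *: \sum_i \sum_j \sum_(p < dbsize (B j (F a b (irr i))))
  (d_ i / d_ j) *: tpure (tube_pure (flat sph (tnth (dbd (B j (F a b (irr i)))) p)) (sharp sph w^†))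
     (tube_pure (flat sph v^†) (sharp sph (tnth (dbv (B j (F a b (irr i)))) p)))).
  rewrite scaler_sumr; apply: eq_bigr => i _; rewrite (slin_sum S2) scaler_sumr.
  apply: eq_bigr => j _; rewrite (slin_sum S2) scaler_sumr; apply: eq_bigr => p _.
  rewrite tlift_for_pure; first last.
  - by move=> y k y1 y2; rewrite S1 (lin_tpurer _ k^*).
  - by move=> y k y1 y2; rewrite S1 (lin_tpurel _ k^*).
  rewrite !star_pure (linZ (lin_tpurel _)) (linZ (lin_tpurer _)) scalerA [_ * (d_ e / d_ c)]mulrC.
  by rewrite !BO dagK !scalerA mulrA.
congr (_ *: _); rewrite exchange_big; apply: eq_bigr => j _.
by rewrite bendsum // => k; split=> y; lin.
Qed.
End Star.

(** * The star reverses products *)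

Section StarMul.
Variables (R : realType) (D : daggerMonCat R) (X : simples D) (sph : spherical X).
Hypothesis HD : unitary_multifusion D.
Variable (B : forall (k : X) (z : D), dual_bases k z).
Hypothesis BO : forall k z p, tnth (dbd (B k z)) p = (tnth (dbv (B k z)) p)^†.
Local Notation "x ^b" := (bar sph x) (at level 2, format "x ^b").
Local Notation d_ := (qdim sph).
Local Notation br := (tube_bracket B).
Local Notation mul := (tube_mul B).
Local Notation dl := delta_mor.
Local Notation star := (@tube_star R D X sph).
Implicit Types (a b c e f h k l : X) (P Q : D).
Local Notation F a b x := (act (irr a) (irr b) x).
Local Notation G a b x := (act (irr a^b) (irr b^b) x).
Local Notation Gm a b f := (fm (irr a^b) (irr b^b) f).

Lemma bar_inj k l : k^b = l^b -> k = l.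
Proof. by move=> kl; rewrite -(bar_bar sph k) kl bar_bar. Qed.

Lemma slin_alpha a b k : slin Num.conj (@alpha R D X sph a b k).
Proof. by move=> t f g; rewrite /alpha slin_dag lin_dualm. Qed.

(** [alpha] preserves orthonormality by [alpha_orth] and is onto by [alpha_surj]. *)
Lemma alpha_complete a b :
  \sum_k \sum_(p < dbsize (B k (irr a ⊗ irr b)))
    alpha sph (tnth (dbv (B k (irr a ⊗ irr b))) p) ∘
    (alpha sph (tnth (dbv (B k (irr a ⊗ irr b))) p))^† = idm (irr b^b ⊗ irr a^b).
Proof.
set E := \sum_k _.
suff Ey l (y : mor (irr l) (irr b^b ⊗ irr a^b)) : E ∘ y = y.
  rewrite -[LHS]comp1r -(csum_id HD B) /csum comp_bigr; apply: eq_bigr => l _.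
  by rewrite comp_bigr; apply: eq_bigr => p _; rewrite compA Ey.
(* Every simple object is a dual, which puts [y] in the range of [alpha]. *)
rewrite -(bar_bar sph l) in y *; move: (l^b) y => m y.
have [f <-] := alpha_surj y.
rewrite /E comp_bigl (big_only (j := m)) => [|k km]; last first.
  rewrite comp_bigl big1 // => p _.
  rewrite -compA [_^† ∘ alpha _ _]hom_irr0 ?comp0r //.
  by apply: contra_neq km => /bar_inj.
rewrite comp_bigl [in RHS](dbv_expand B f) (slin_sum (@slin_alpha _ _ _)).
apply: eq_bigr => p _; rewrite (slinZ (@slin_alpha _ _ _)) -compA alpha_orth // compZr comp1r.
by congr (_ *: _); rewrite BO -[RHS]sc_dag dag_comp dagK.
Qed.

Section ProductBend.
Variables a a' b b' : X.

Definition eta2 x : mor x (G a' b' (G a b (F a b (F a' b' x)))) :=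
  locked (Gm a' b' (eta sph a b (F a' b' x)) ∘ eta sph a' b' x).

(** Bending a leg that was projected from a product amounts to bending its factors and then
    dualising the projection. The left leg is bent with evaluations and the right one with
    coevaluations, hence [alpha] on one and [beta] on the other; [alpha_beta] identifies them
    later. *)
Lemma prod_bend k s (g : mor (irr k) (irr a ⊗ irr a')) (h : mor (irr s) (irr b' ⊗ irr b)) x :
  (eta sph k s x)^† ∘ Gm k s (tc g^† h^† x ∘ ra _ _ _ _ _) =
  (eta2 x)^† ∘ (ra _ _ _ _ _)^† ∘ tc (alpha sph g) (beta sph h) (F a b (F a' b' x)).
Proof.
have Eg z : st (ev sph k) z ∘ (idm (irr k^b) ⊗m st g^† z) =
    st (ev sph a') z ∘ (idm (irr a'^b) ⊗m st (ev sph a) (irr a' ⊗ z)) ∘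
      st (alpha sph g) (irr a ⊗ (irr a' ⊗ z)).
  have zA := prod_zigzag (dual_zigzag sph a) (dual_zigzag sph a').
  have := congr1 (fun u => st u z) (dualm_ev (ev sph k) g^† zA).
  by rewrite /prod_ev -!lock !stE /= ?(dag_id, comp1l, comp1r, tensm_id).
have Eh z : (st (coev sph s) z)^† ∘ st h^† (irr s^b ⊗ z) =
    (st (coev sph b') z)^† ∘ ((idm (irr b') ⊗m (st (coev sph b) (irr b'^b ⊗ z))^†) ∘
    (idm (irr b') ⊗m (idm (irr b) ⊗m st (beta sph h) z))).
  have zB := prod_zigzag (dual_zigzag sph b') (dual_zigzag sph b).
  have := congr1 (fun u => st u z) (dualm_coev (coev sph s) h zB).
  rewrite /beta st_dag; set be := dualm _ _ _.
  rewrite /prod_coev -!lock !stE /= ?(dag_id, comp1l, comp1r, tensm_id).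
  by move/(congr1 (@dag _ _ _ _)); rewrite !dag_comp !tensm_dag !dag_id => <-; rewrite compA.
move: (alpha sph g) (beta sph h) Eg Eh => al be Eg Eh.
have nat z z' (f : mor z z') :
    st (ev sph k) z' ∘ (idm (irr k^b) ⊗m st g^† z') ∘
      (idm (irr k^b) ⊗m (idm (irr a) ⊗m (idm (irr a') ⊗m f))) =
    f ∘ (st (ev sph k) z ∘ (idm (irr k^b) ⊗m st g^† z)).
  have E := st_nat (ev sph k) f; rewrite /= in E.
  by rewrite -compA -tens1M (st_nat g^† f) tens1M !compA E.
rewrite /eta2 /eta -!lock -!reassocE -!padE /reassoc /pad; strict.
have E := st_nat (ev sph a') (idm x ⊗m (idm (irr b') ⊗m (st (coev sph b) (irr b'^b ⊗ tunit))^†)).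
rewrite /= in E.
rewrite !dag_comp !tensm_dag !dag_id !dagK -(st_dag g) -(st_dag h).
rewrite [(_^† ∘ _)^†]dag_comp !tensm_dag !dag_id !dagK.
have N1 := nat _ _ (idm x ⊗m st h^† (irr s^b ⊗ tunit)).
have N2 := nat _ _ (idm x ⊗m (idm (irr b') ⊗m (idm (irr b) ⊗m st be tunit))).
rewrite -[LHS]compA [idm (irr k^b) ⊗m (_ ∘ _)]tens1M [st (ev _ k) _ ∘ (_ ∘ _)]compA N1.
rewrite [LHS]compA -tens1M Eh !tens1M -!compA -N2 Eg.
rewrite -!compA; congr (_ ∘ _); rewrite [RHS]compA E.
by rewrite -!compA.
Qed.
End ProductBend.

Lemma delta_dag a b : (dl a b : mor (irr a) (irr b))^† = dl b a.
Proof.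
have [->|ab] := eqVneq a b; first by rewrite delta_id dag_id.
by rewrite (delta_neq ab) (@delta_neq _ _ _ b a) 1?eq_sym // dag0.
Qed.

Lemma sharp_prod a a' b b' k s (g : mor (irr k) (irr a ⊗ irr a')) (h : mor (irr s) (irr b' ⊗ irr b))
    x y (u : mor y (F a b (F a' b' x))) :
  sharp sph (tc g^† h^† x ∘ (ra _ _ _ _ _ ∘ u)) =
  (eta2 a a' b b' x)^† ∘ fm (irr a'^b) (irr b'^b) (Gm a b u) ∘ (ra _ _ _ _ _)^† ∘
    tc (alpha sph g) (alpha sph h) y.
Proof.
rewrite sharpE compA fmM compA prod_bend -(alpha_beta sph h) -!compA tc_fm.
by congr (_ ∘ _); rewrite !compA fm_ra.
Qed.

(** The bent basis vectors of the legs meet across the bracket and sum to an identity by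
    [alpha_complete]. Dualising a product reverses its factors, as the reversed product requires. *)
Lemma star_bracket a a' b b' c e f h
    (v : mor (irr c) (F a b (F a' b' (irr e)))) (w : mor (F a b (F a' b' (irr f))) (irr h)) :
  star (br (ra _ _ _ _ _ ∘ v) (w ∘ (ra _ _ _ _ _)^†)) = (d_ e / d_ c) *:
  br (ra _ _ _ _ _ ∘ (fm (irr a'^b) (irr b'^b) (Gm a b v^†) ∘ eta2 a a' b b' (irr e)))
     ((eta2 a a' b b' (irr f))^† ∘ fm (irr a'^b) (irr b'^b) (Gm a b w^†) ∘ (ra _ _ _ _ _)^†).
Proof.
set Y := _ ∘ (_ ∘ eta2 _ _ _ _ _); set Z := (eta2 _ _ _ _ _)^† ∘ _ ∘ _.
pose A := irr a ⊗ irr a'; pose Q := irr b' ⊗ irr b.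
have S1 := slin_star sph.
pose al k p := alpha sph (tnth (dbv (B k A)) p).
pose be s q := alpha sph (tnth (dbv (B s Q)) q).
transitivity ((d_ e / d_ c) *: \sum_k \sum_(p < dbsize (B k A)) \sum_s \sum_(q < dbsize (B s Q))
  br Y (Z ∘ tc (al k p ∘ (al k p)^†) (be s q ∘ (be s q)^†) (irr h))).
  rewrite bracketE /csum (slin_sum S1) scaler_sumr; apply: eq_bigr => k _.
  rewrite (slin_sum S1) scaler_sumr; apply: eq_bigr => p _.
  rewrite (slin_sum S1) scaler_sumr; apply: eq_bigr => s _.
  rewrite (slin_sum S1) scaler_sumr; apply: eq_bigr => q _.
  rewrite !BO star_pure; congr (_ *: _).
  rewrite -sharp_dag sharp_prod.
  have -> : (w ∘ (ra (irr a) (irr a') (irr f) (irr b') (irr b))^† ∘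
      tc (tnth (dbv (B k A)) p) (tnth (dbv (B s Q)) q) (irr f))^† =
      tc (tnth (dbv (B k A)) p)^† (tnth (dbv (B s Q)) q)^† (irr f) ∘ (ra _ _ _ _ _ ∘ w^†).
    by rewrite !dag_comp dagK tc_dag.
  rewrite sharp_prod -(bracket_irr B) -/Z dag_comp tc_dag.
  rewrite bracket_nat; congr (br _ _); last by rewrite -compA -tcM.
  by rewrite !dag_comp !dagK !fm_dag.
congr (_ *: _).
rewrite -[in RHS](comp1r Z) -tc1 -(alpha_complete a a') -(alpha_complete b' b).
rewrite tens_suml comp_bigr (lin_sum (lin_bracketr _ _)); apply: eq_bigr => k _.
rewrite tens_suml comp_bigr (lin_sum (lin_bracketr _ _)); apply: eq_bigr => p _.
rewrite !tens_sumr comp_bigr (lin_sum (lin_bracketr _ _)); apply: eq_bigr => s _.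
by rewrite !tens_sumr comp_bigr (lin_sum (lin_bracketr _ _)).
Qed.

Lemma mul_pure_neq a b c e f h v w a' b' c' e' f' h' v' w' : e != c' ->
  mul (@tube_pure R D X a b c e f h v w) (@tube_pure R D X a' b' c' e' f' h' v' w') = 0.
Proof.
move=> ec; rewrite mul_pure (delta_neq ec) comp0r tens0l tens0r comp0l comp0r.
exact: (lin0 (lin_bracketl _ _)).
Qed.

Lemma tube_starM x y : star (mul x y) = mul (star y) (star x).
Proof.
have S1 := slin_star sph.
move: x; apply: (tube_eq (s := Num.conj)) => [||a b c e f h v w].
- by move=> k x x'; rewrite (lin_tube_mull B) S1.
- by move=> k x x'; rewrite S1 (lin_tube_mulr B).
move: y; apply: (tube_eq (s := Num.conj)) => [||a' b' c' e' f' h' v' w'].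
- by move=> k y y'; rewrite (lin_tube_mulr B) S1.
- by move=> k y y'; rewrite S1 (lin_tube_mull B).
(* For [e = c'] the weights telescope to d_e' / d_c; otherwise both sides vanish. *)
have [ec|ec] := eqVneq e c'; last first.
  have S0 : star 0 = 0 := slin0 S1.
  rewrite (mul_pure_neq v w v' w' ec) S0 (star_pure sph v) (star_pure sph v').
  rewrite (linZ (lin_tube_mull _ _)) (linZ (lin_tube_mulr _ _)).
  by rewrite (mul_pure_neq (flat sph v'^†) _ (flat sph v^†)) ?scaler0 // eq_sym.
rewrite mul_pure star_bracket !star_pure.
rewrite (linZ (lin_tube_mull _ _)) (linZ (lin_tube_mulr _ _)) mul_pure scalerA.
have -> : d_ e' / d_ c' * (d_ e / d_ c) = d_ e' / d_ c.
  by rewrite ec mulrA divfK // qdim_neq0.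
have E1 := congr1 (fun u => fm (irr a'^b) (irr b'^b) u ∘ eta sph a' b' (irr e'))
  (eta_nat sph a b (dl c' e ∘ v'^†)).
have E2 := congr1 (fun u => fm (irr a'^b) (irr b'^b) u^†)
  (eta_nat sph a b (dl h' f ∘ w')).
rewrite !fmM -!compA in E1; rewrite /= !dag_comp !fm_dag !dag_comp !delta_dag !fmM !compA in E2.
congr (_ *: _); congr (br _ _).
  rewrite !flatE /eta2 -!lock dag_comp fm_dag dag_comp delta_dag.
  by rewrite !fmM -!compA; congr (_ ∘ (_ ∘ _)).
rewrite !sharpE /eta2 -!lock !dag_comp !fm_dag dag_comp delta_dag !fmM -!compA; congr (_ ∘ _).
by rewrite !compA -E2 ?fm_dag.
Qed.
End StarMul.

(** * The Hilbert space *)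

Section CauchySequences.
Variable R : realType.
Local Notation C := R[i].

Lemma cauchy_real (u : nat -> R) :
  (forall e : R, 0 < e -> exists N, forall m n, (N <= m)%N -> (N <= n)%N -> `|u m - u n| < e) ->
  exists l : R, forall e : R, 0 < e -> exists N, forall n, (N <= n)%N -> `|u n - l| < e.
Proof.
(* The limit is the supremum of the eventual lower bounds of the sequence. *)
move=> uC; pose S : classical_sets.set R := fun x => exists N, forall n, (N <= n)%N -> x <= u n.
have Sb e N : (forall m n, (N <= m)%N -> (N <= n)%N -> `|u m - u n| < e) ->
    S (u N - e) /\ classical_sets.ubound S (u N + e).
  move=> uN; split.
    by exists N => n Nn; have /ltr_normlP[] := uN N n (leqnn N) Nn; lra.
  move=> x [M xM].
  have := xM (maxn N M) (leq_maxr _ _).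
  have /ltr_normlP[] := uN N (maxn N M) (leqnn N) (leq_maxl _ _); lra.
exists (sup S) => e e0; have [N uN] := uC (e / 2) ltac:(lra).
exists N => n Nn; have [S1 S2] := Sb _ _ uN.
have hS : classical_sets.has_sup S by split; [exists (u N - e / 2)|exists (u N + e / 2)].
have /ltr_normlP[h1 h2] := uN n N Nn (leqnn N).
have h3 : u N - e / 2 <= sup S by apply: ub_le_sup => //; case: hS.
have h4 : sup S <= u N + e / 2 by apply: ge_sup => //; case: hS.
by apply/ltr_normlP; split; lra.
Qed.

Lemma sqrt_sum_lt (a b e : R) : 0 < e ->
  (Num.sqrt (a ^+ 2 + b ^+ 2) < e) = (a ^+ 2 + b ^+ 2 < e ^+ 2).
Proof.
move=> e0; rewrite -[e in LHS]ger0_norm ?ltW // -sqrtr_sqr ltr_sqrt //.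
by rewrite exprn_gt0.
Qed.

Lemma normc_lt (z e : C) : 0 < e ->
  (`|z| < e) = (complex.Re z ^+ 2 + complex.Im z ^+ 2 < complex.Re e ^+ 2).
Proof.
case: e => r i; rewrite ltcE /= => /andP[/eqP-> r0].
by rewrite normc_def ltcE /= eqxx sqrt_sum_lt.
Qed.

Lemma cauchy_complex (u : nat -> C) :
  (forall e : C, 0 < e -> exists N, forall m n, (N <= m)%N -> (N <= n)%N -> `|u m - u n| < e) ->
  exists l : C, forall e : C, 0 < e -> exists N, forall n, (N <= n)%N -> `|u n - l| < e.
Proof.
move=> uC.
have real_eps (e : R) : 0 < e -> 0 < (e%:C)%C by move=> e0; rewrite ltcR.
have sqr_lt (x e : R) : 0 < e -> x ^+ 2 < e ^+ 2 -> `|x| < e.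
  by move=> e0 xe; rewrite -sqrtr_sqr -[x ^+ 2]addr0 -[0](@expr0n _ 2) sqrt_sum_lt // expr0n addr0.
have [|a aP] := @cauchy_real (fun n => complex.Re (u n)).
  move=> e e0; have [N uN] := uC _ (real_eps e e0); exists N => m n Nm Nn.
  have := uN m n Nm Nn; rewrite normc_lt ?real_eps //.
  case: (u m) (u n) => [p q] [p' q'] /= h; apply: sqr_lt => //.
  by apply: le_lt_trans h; rewrite lerDl sqr_ge0.
have [|b bP] := @cauchy_real (fun n => complex.Im (u n)).
  move=> e e0; have [N uN] := uC _ (real_eps e e0); exists N => m n Nm Nn.
  have := uN m n Nm Nn; rewrite normc_lt ?real_eps //.
  case: (u m) (u n) => [p q] [p' q'] /= h; apply: sqr_lt => //.
  by apply: le_lt_trans h; rewrite lerDr sqr_ge0.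
exists (a +i* b)%C => e e0.
have r0 : 0 < complex.Re e by case: e e0 => r i; rewrite ltcE => /andP[].
(* Half the tolerance in each coordinate suffices, as e^2/4 + e^2/4 < e^2; a positive complex number
   is real, so its real part is the tolerance. *)
have [N aN] := aP (complex.Re e / 2) ltac:(lra).
have [M bM] := bP (complex.Re e / 2) ltac:(lra).
exists (maxn N M) => n; rewrite geq_max => /andP[Nn Mn].
rewrite normc_lt //; have := aN n Nn; have := bM n Mn.
case: (u n) => p q /=; move: (p - a) (q - b) (complex.Re e) r0 => x y r r0.
move=> /ltr_normlP[h1 h2] /ltr_normlP[h3 h4]; nra.
Qed.
End CauchySequences.

Section FiniteHilbert.
Variables (R : realType).
Local Notation C := R[i].
Variables (V : lmodType C) (J : finType) (w : J -> C) (T : J -> V) (co : J -> V -> C).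
Hypothesis w0 : forall j, 0 < w j.
Hypothesis col : forall j, scalar (co j).
Hypothesis coT : forall i j, co i (T j) = (i == j)%:R.
Hypothesis span : forall x, x = \sum_j co j x *: T j.

Definition wip (x y : V) : C := \sum_j w j * (co j x * (co j y)^*).

Let coB j x y : co j (x - y) = co j x - co j y.
Proof.
have L : lin (co j : V -> C^o) := col j.
by rewrite (linD L) (linN L).
Qed.
Let coD j x y : co j (x + y) = co j x + co j y.
Proof. by have L : lin (co j : V -> C^o) := col j; rewrite (linD L). Qed.
Let coZ j t x : co j (t *: x) = t * co j x.
Proof. by have L : lin (co j : V -> C^o) := col j; rewrite (linZ L). Qed.

Lemma wip_linl y : scalar (fun x => wip x y).
Proof.
move=> t x x'; rewrite /wip mulr_sumr -big_split; apply: eq_bigr => j _ /=.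
by rewrite col mulrDl mulrDr -mulrA [w j * (t * _)]mulrCA.
Qed.

Lemma wip_conj x y : wip y x = (wip x y)^*.
Proof.
rewrite /wip rmorph_sum; apply: eq_bigr => j _.
rewrite !rmorphM /= conjCK (conj_Creal (ger0_real (ltW (w0 j)))).
by rewrite [_ * co j y]mulrC.
Qed.

Let term_ge0 j x : 0 <= w j * (co j x * (co j x)^*).
Proof. by apply: mulr_ge0; [apply: ltW|apply: mul_conjC_ge0]. Qed.

Lemma wip_ge0 x : 0 <= wip x x.
Proof. by apply: sumr_ge0 => j _; apply: term_ge0. Qed.

Lemma wip_eq0 x : wip x x = 0 -> x = 0.
Proof.
move/eqP; rewrite psumr_eq0 => [/allP x0|j _]; last exact: term_ge0.
rewrite [x]span big1 // => j _.
have := x0 j (mem_index_enum _); rewrite /= mulf_eq0 (gt_eqF (w0 j)) /= mul_conjC_eq0.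
by move/eqP->; rewrite scale0r.
Qed.

Let term_le j x : w j * (co j x * (co j x)^*) <= wip x x.
Proof.
rewrite /wip (bigD1 j) //= lerDl; apply: sumr_ge0 => i _; exact: term_ge0.
Qed.

Lemma wip_complete (u : nat -> V) :
  (forall e : C, 0 < e -> exists N, forall m n, (N <= m)%N -> (N <= n)%N ->
     wip (u m - u n) (u m - u n) < e) ->
  exists l, forall e : C, 0 < e -> exists N, forall n, (N <= n)%N ->
     wip (u n - l) (u n - l) < e.
Proof.
move=> uC.
have lim j : exists l : C, forall e : C, 0 < e -> exists N, forall n, (N <= n)%N -> `|co j (u n) - l| < e.
  apply: cauchy_complex => e e0.
  (* The weight and the square undo those in [term_le], which bounds one coordinate by the norm. *)
  have [N uN] := uC (w j * (e * e)) ltac:(by rewrite !mulr_gt0).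
  exists N => m n Nm Nn; rewrite -coB.
  have := le_lt_trans (term_le j _) (uN m n Nm Nn).
  rewrite ltr_pM2l // -normCK expr2 -!expr2 ltr_pXn2r // nnegrE ?normr_ge0 //; exact: ltW.
pose l j := sval (cid (lim j)).
have lP j : forall e : C, 0 < e -> exists N, forall n, (N <= n)%N -> `|co j (u n) - l j| < e.
  exact: svalP (cid (lim j)).
have lT j : co j (\sum_i l i *: T i) = l j.
  have L : lin (co j : V -> C^o) := col j.
  rewrite (lin_sum L) (bigD1 j) //= coZ coT eqxx mulr1 big1 ?addr0 // => i ij.
  by rewrite coZ coT eq_sym (negPf ij) mulr0.
exists (\sum_j l j *: T j) => e e0.
(* The added 1 keeps s positive when [J] is empty and makes the final inequality strict. *)
pose s := \sum_j w j + 1.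
have s0 : 0 < s by rewrite ltr_wpDl // sumr_ge0 // => j _; apply: ltW.
have es0 : 0 < e / s by rewrite divr_gt0.
pose d := sqrtC (e / s).
have d0 : 0 < d by rewrite sqrtC_gt0.
have dd : d * d = e / s by rewrite -expr2 sqrtCK.
have [N NP] : exists N : J -> nat, forall j n, (N j <= n)%N -> `|co j (u n) - l j| < d.
  exists (fun j => sval (cid (lP j d d0))) => j; exact: svalP (cid (lP j d d0)).
exists (\max_j N j)%N => n Nn.
apply: (@le_lt_trans _ _ (\sum_j w j * (e / s))).
  apply: ler_sum => j _; rewrite ler_pM2l // coB lT -normCK -dd -expr2.
  rewrite ler_pXn2r // ?nnegrE ?normr_ge0 ?(ltW d0) //; apply/ltW/NP.
  by apply: leq_trans Nn; apply: leq_bigmax.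
rewrite -mulr_suml mulrCA -[X in _ < X]mulr1 ltr_pM2l // ltr_pdivrMr // mul1r.
by rewrite ltrDl.
Qed.

Definition fin_hilbert : hilbertSpace R :=
  HilbertSpace wip_linl wip_conj wip_ge0 wip_eq0 wip_complete.

Let wip_parallelogram x y : wip (x + y) (x + y) <= 2 * (wip x x + wip y y).
Proof.
have -> : 2 * (wip x x + wip y y) = wip (x + y) (x + y) + wip (x - y) (x - y).
  rewrite /wip -!big_split mulr_sumr; apply: eq_bigr => j _ /=.
  rewrite coB coD !rmorphD /= rmorphN /=; ring.
by rewrite lerDl wip_ge0.
Qed.

Let wipZ t x : wip (t *: x) (t *: x) = t * t^* * wip x x.
Proof.
rewrite /wip mulr_sumr; apply: eq_bigr => j _; rewrite coZ rmorphM /=; ring.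
Qed.

Lemma wip_bounded (f : V -> V) : linear f ->
  exists M : C, forall x, wip (f x) (f x) <= M * wip x x.
Proof.
(* By [term_le] the squared modulus of the j-th coordinate is at most [wip x x / w j], so the j-th
   term contributes at most [m j * wip x x]. Terms are added one by one, each time at the cost of a
   factor 2. *)
move=> fl; pose m j := wip (f (T j)) (f (T j)) / w j.
have m0 j : 0 <= m j by rewrite divr_ge0 ?wip_ge0 // ltW.
suff [M MP] : exists M : C, forall x, wip (\sum_j co j x *: f (T j)) (\sum_j co j x *: f (T j)) <= M * wip x x.
  exists M => x; have L : lin f := fl.
  by rewrite {1 2}[x]span (lin_sum L) (eq_bigr _ (fun j _ => linZ L _ _)).
elim: (index_enum J) => [|j r [M MP]].
  exists 0 => x; rewrite !big_nil mul0r /wip big1 // => j _.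
  by have L : lin (co j : V -> C^o) := col j; rewrite (lin0 L) mul0r mulr0.
exists (2 * (m j + M)) => x; rewrite !big_cons.
apply: le_trans (wip_parallelogram _ _) _.
rewrite -mulrA ler_pM2l ?ltr0n // mulrDl lerD //.
rewrite wipZ (_ : m j * wip x x = wip x x / w j * wip (f (T j)) (f (T j))).
  by rewrite ler_wpM2r ?wip_ge0 // ler_pdivlMr // mulrC term_le.
by rewrite /m [LHS]mulrC -[RHS]mulrA [_^-1 * _]mulrC.
Qed.
End FiniteHilbert.

(** * Orthonormal bases and independence of the bases *)

Section OrthonormalBases.
Variables (R : realType) (D : daggerMonCat R) (X : simples D).
Hypothesis HD : unitary_multifusion D.
Local Notation C := R[i].
Implicit Types (x y z : D) (k : X).

(** By the square root axiom [f^† ∘ f] is the squared modulus of a nonzero scalar; dividing [f] by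
    that scalar makes it an isometry. *)
Lemma unitary_iso k z : isomorphic (irr k) z -> exists f : mor (irr k) z, unitary f.
Proof.
case=> f [g [gf fg]]; have [h hE] := dag_sqrt f.
have h0 : sc h != 0.
  apply: contraTneq (irr_id_neq0 k) => h0; apply/negPn/eqP.
  have f0 : f = 0 by apply: dag_pos; rewrite hE [h]scE h0 scale0r comp0r.
  by rewrite -gf f0 comp0r.
pose F := (sc h)^-1 *: f; have FF : F^† ∘ F = idm _.
  apply: sc_inj; rewrite /F dagZ compZl compZr !scZ hE sc_comp sc_dag sc_id.
  by rewrite mulrA mulrACA -rmorphM mulVf // rmorph1 mul1r.
have FK : F ∘ (sc h *: g) = idm _ by rewrite compZr compZl scalerA divff // scale1r fg.
exists F; split=> //.
by rewrite -[F^†]comp1r -FK [_ ∘ (F ∘ _)]compA FF comp1l.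
Qed.

Lemma dual_bases_of k z n (V : n.-tuple (mor (irr k) z)) :
  (forall i j, (tnth V i)^† ∘ tnth V j = (i == j)%:R *: idm (irr k)) ->
  (forall f : mor (irr k) z, f = \sum_i sc ((tnth V i)^† ∘ f) *: tnth V i) ->
  exists b : dual_bases k z, forall p, tnth (dbd b) p = (tnth (dbv b) p)^†.
Proof.
move=> VV Vf; pose W := [tuple (tnth V i)^† | i < n].
have dual i j : tnth W i ∘ tnth V j = (i == j)%:R *: idm (irr k).
  by rewrite tnth_mktuple VV.
have pick (c : 'I_n -> C) j : \sum_i c i * (j == i)%:R = c j.
  rewrite (bigD1 j) //= eqxx mulr1 big1 ?addr0 // => i ij.
  by rewrite eq_sym (negPf ij) mulr0.
have fV : free V.
  apply/freeP => c /(congr1 (fun f j => sc (tnth W j ∘ f))) c0 j.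
  have := congr1 (@^~ j) c0; rewrite comp_sumr sc_sum comp0r sc0.
  under eq_bigr do rewrite compZr -tnth_nth dual !scZ sc_id mulr1.
  by rewrite pick.
have fW : free W.
  apply/freeP => c /(congr1 (fun f j => sc (f ∘ tnth V j))) c0 j.
  have := congr1 (@^~ j) c0; rewrite comp_suml sc_sum comp0l sc0.
  under eq_bigr do rewrite compZl -tnth_nth dual !scZ sc_id mulr1 eq_sym.
  by rewrite pick.
have bV : basis_of fullv V.
  rewrite /basis_of fV andbT eqEsubv subvf /=; apply/subvP => f _; rewrite [f]Vf.
  by apply: rpred_sum => i _; apply/rpredZ/memv_span/mem_tnth.
have bW : basis_of fullv W.
  rewrite /basis_of fW andbT eqEsubv subvf /=; apply/subvP => f _.
  rewrite -[f]dagK [f^†]Vf dag_sum.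
  apply: rpred_sum => i _; rewrite dagZ; apply/rpredZ/memv_span.
  by rewrite (_ : (tnth V i)^† = tnth W i) ?mem_tnth // tnth_mktuple.
by exists (DualBases bV bW dual) => p; rewrite tnth_mktuple.
Qed.

Lemma orthonormal_basis k z :
  exists b : dual_bases k z, forall p, tnth (dbd b) p = (tnth (dbv b) p)^†.
Proof.
have [n [s [p [ss [p1 p0 pz]]]]] := umfc_semisimple HD z.
pose I := [set i | `[< isomorphic (irr k) (s i) >]].
have iso (i : 'I_#|I|) : exists f : mor (irr k) (s (enum_val i)), unitary f.
  by apply: unitary_iso; have := enum_valP i; rewrite inE => /asboolP.
pose F i := sval (cid (iso i)).
have FU i : unitary (F i) by exact: svalP (cid (iso i)).
apply: (@dual_bases_of k z _ [tuple p (enum_val i) ∘ F i | i < #|I|]) => [i j|f].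
  rewrite !tnth_mktuple dag_comp -compA [_^† ∘ (_ ∘ F j)]compA.
  case: eqVneq => [<-|ij]; first by rewrite p1 comp1l (FU i).1 scale1r.
  by rewrite p0 ?(inj_eq enum_val_inj) // comp0l comp0r scale0r.
rewrite -[LHS]comp1l -pz comp_suml (bigID (mem I)) /= [X in _ + X]big1 => [|i]; last first.
  rewrite inE => /asboolP ni; rewrite -compA; suff -> : (p i)^† ∘ f = 0 by rewrite comp0r.
  by apply: contrapT => u0; apply: ni; apply: schur u0 => //; apply: irr_simple.
rewrite addr0 big_enum_val; apply: eq_bigr => i _; rewrite tnth_mktuple.
rewrite -[X in _ = _ *: X]comp1r -compZr -scE dag_comp.
by rewrite -!compA [F i ∘ (_ ∘ _)]compA (FU i).2 comp1l.
Qed.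

Lemma orthonormal_bases : exists B : forall (k : X) (z : D), dual_bases k z,
  forall k z p, tnth (dbd (B k z)) p = (tnth (dbv (B k z)) p)^†.
Proof.
exists (fun k z => sval (cid (orthonormal_basis k z))) => k z.
exact: svalP (cid (orthonormal_basis k z)).
Qed.
End OrthonormalBases.

Section BasisIndependence.
Variables (R : realType) (D : daggerMonCat R) (X : simples D) (sph : spherical X).
Hypothesis HD : unitary_multifusion D.
Variables (B B' : forall (k : X) (z : D), dual_bases k z).

(** The other family of dual bases is itself a resolution of the identity, to which [csum_decomp]
    applies. *)
Lemma csum_indep z (L : lmodType R[i]) (F : forall k, mor z (irr k) -> mor (irr k) z -> L) :
  (forall k, bilin (F k)) -> csum B F = csum B' F.
Proof.
move=> Fb.
rewrite (@csum_decomp R D X B _ _ (fun t : {k : X & 'I_(dbsize (B' k z))} => tag t)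
  (fun t => tnth (dbv (B' (tag t) z)) (tagged t))
  (fun t => tnth (dbd (B' (tag t) z)) (tagged t))) //.
  by rewrite /csum (sig_big_dep xpredT (fun=> xpredT) (fun k (p : 'I_(dbsize (B' k z))) => _)).
rewrite -(csum_id HD B' z) /csum.
by rewrite (sig_big_dep xpredT (fun=> xpredT) (fun k (p : 'I_(dbsize (B' k z))) => _)).
Qed.

Lemma bracket_indep c e f h P Q (v : mor (irr c) (act P Q (irr e)))
    (w : mor (act P Q (irr f)) (irr h)) : tube_bracket B v w = tube_bracket B' v w.
Proof.
rewrite !bracketE csum_indep => [|k]; last by split=> y; lin.
by apply: eq_csum => k d u; apply: csum_indep => s; split=> y; lin.
Qed.

Lemma mul_indep : tube_mul B = tube_mul B'.
Proof.
apply/funext => x; apply/funext => y; move: x.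
apply: tube_lin_eq (lin_tube_mull B y) (lin_tube_mull B' y) _ => a b c e f h v w.
move: y; apply: tube_lin_eq (lin_tube_mulr B _) (lin_tube_mulr B' _) _.
by move=> a' b' c' e' f' h' v' w'; rewrite !mul_pure bracket_indep.
Qed.

Lemma comul_indep : tube_comul B = tube_comul B'.
Proof.
apply/funext; apply: tube_lin_eq (lin_comul B) (lin_comul B') _ => a b c e f h v w.
rewrite !comul_pure; apply: eq_bigr => i _; apply: csum_indep => k.
by split=> y; lin.
Qed.

Lemma tube_wha_indep : tube_wha sph B = tube_wha sph B'.
Proof. by rewrite /tube_wha mul_indep comul_indep. Qed.
End BasisIndependence.

(** * Projection of legs to the unit object *)

Section UnitObject.
Variables (R : realType) (D : daggerMonCat R) (X : simples D).
Hypothesis HD : unitary_multifusion D.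
Variable (B : forall (k : X) (z : D), dual_bases k z).
Local Notation C := R[i].
Local Notation dl := delta_mor.
Implicit Types (a b c e f h k l : X) (P Q x y : D).

Lemma end_unitC (f g : mor tunit (tunit : D)) : f ∘ g = g ∘ f.
Proof.
strict; exact: (st_nat f (st g tunit)).
Qed.

(** End of the unit is commutative, while an isomorphism between two different summands would give
    an element not commuting with a projection. *)
Lemma uirr_inj : injective (@uirr R D X).
Proof.
move=> i j ij; apply: contrapT => /eqP nij.
have [t t0] : exists t : mor (irr (uirr i)) (irr (uirr j)), t <> 0.
  by rewrite ij; exists (idm _); apply/eqP/irr_id_neq0.
apply: t0; have := end_unitC (uinc j ∘ t ∘ (uinc i)^†) (uinc i ∘ (uinc i)^†).
rewrite -[RHS]compA [(uinc i)^† ∘ (_ ∘ _)]compA [(uinc i)^† ∘ (_ ∘ _)]compA uinc_orth //.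
rewrite !comp0l comp0r => /(congr1 (fun s => (uinc j)^† ∘ s ∘ uinc i)).
rewrite comp0r comp0l => <-.
by rewrite -!compA uincK comp1r !compA uincK comp1l -!compA uincK comp1r.
Qed.

(* [Psi] applied to the canonical element of Hom(P, 1) ⊗ Hom(1, P), see [utr_id]. *)
Definition utr P (L : lmodType C) (Psi : mor P tunit -> mor tunit P -> L) : L :=
  csum B (fun k (d : mor P (irr k)) u => \sum_i
    Psi (uinc i ∘ dl k (uirr i) ∘ d) (u ∘ ((dl k (uirr i))^† ∘ (uinc i)^†))).

(** Moving [g] across puts the sum on [tunit], where the inclusions [uinc] resolve the identity;
    [uirr_inj] removes the off-diagonal terms. *)
Lemma utr_id P (g : mor P tunit) : utr (fun d u => g ∘ (u ∘ d)) = g.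
Proof.
pose F k (d : mor P (irr k)) (u : mor (irr k) tunit) : mor P tunit :=
  \sum_i u ∘ ((dl k (uirr i))^† ∘ (uinc i)^†) ∘ (uinc i ∘ dl k (uirr i) ∘ d).
transitivity (csum B (fun k d u => F k d (g ∘ u))).
  by apply: eq_csum => k d u; apply: eq_bigr => i _; rewrite !compA.
rewrite -(csum_nat B g (F := fun k d u => \sum_i
  u ∘ ((dl k (uirr i))^† ∘ (uinc i)^†) ∘ (uinc i ∘ dl k (uirr i) ∘ d))); last first.
  by move=> k; split=> y; lin.
rewrite (@csum_decomp R D X B tunit _ (@uirr _ _ X) (@uinc _ _ X) (fun i => (uinc i)^†)).
- rewrite -[RHS]comp1l -(uinc_sum X) comp_bigl; apply: eq_bigr => m _.
  rewrite (big_only (j := m)) => [|i im].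
    by rewrite !delta_id dag_id comp1r comp1l -compA [(uinc m)^† ∘ (_ ∘ _)]compA uincK comp1l compA.
  by rewrite delta_neq ?dag0 ?comp0l ?comp0r ?comp0l // (inj_eq uirr_inj) eq_sym.
- by move=> k; split=> y; lin.
- exact: uinc_sum.
Qed.

(** When Hom(P, 1) is spanned by [e], the value is [m *: Psi e e^†] with one constant [m] for all
    [Psi]. Taking the [Psi] of [utr_id] with [g = e] gives m t = 1. *)
Lemma utr_rank1 P (e : mor P tunit) (j : uidx X) (t : C) (L : lmodType C) (Psi : mor P tunit -> mor tunit P -> L) :
  (forall g, lin (Psi g)) -> (forall g, lin (Psi ^~ g)) ->
  e ∘ e^† = t *: (uinc j ∘ (uinc j)^†) -> t != 0 ->
  (forall g : mor P tunit, exists s : C, g = s *: e) ->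
  utr Psi = t^-1 *: Psi e e^†.
Proof.
move=> Pr Pl ee t0 ge.
have ge' (g : mor tunit P) : exists s : C, g = s *: e^†.
  by have [s sE] := ge g^†; exists s^*; rewrite -[g]dagK sE dagZ.
pose c g := sval (cid (ge g)); have cE g : g = c g *: e := svalP (cid (ge g)).
pose c' g := sval (cid (ge' g)); have cE' g : g = c' g *: e^† := svalP (cid (ge' g)).
pose m := csum B (fun k (d : mor P (irr k)) u => (\sum_i c (uinc i ∘ dl k (uirr i) ∘ d) *
  c' (u ∘ ((dl k (uirr i))^† ∘ (uinc i)^†))) : C^o).
have mE (M : lmodType C) (Phi : mor P tunit -> mor tunit P -> M) :
    (forall g, lin (Phi g)) -> (forall g, lin (Phi ^~ g)) -> utr Phi = m *: Phi e e^†.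
  move=> Fr Fl; rewrite /utr /m.
  have S : lin (fun s : C^o => s *: Phi e e^†) by lin.
  rewrite (csum_linE B _ S); apply: eq_csum => k d u; rewrite (lin_sum S).
  apply: eq_bigr => i _; rewrite [X in Phi X]cE [X in Phi _ X]cE'.
  by rewrite (linZ (Fr _)) (linZ (Fl _)) scalerA mulrC.
have := utr_id e; rewrite mE => [|g|g]; try lin.
move/(congr1 (fun g => g ∘ e^†)); rewrite compZl compA ee -compA ee !compZl compZr.
rewrite -[uinc j ∘ _ ∘ _]compA [(uinc j)^† ∘ (_ ∘ _)]compA uincK comp1l !scalerA.
move/unit_scale_inj; rewrite -{3}[t]mul1r => /(mulIf t0) mt.
by rewrite mE // -[t^-1]mul1r -mt mulfK.
Qed.

Lemma utr_eq0 P (L : lmodType C) (Psi : mor P tunit -> mor tunit P -> L) :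
  (forall g g', Psi g g' = 0) -> utr Psi = 0.
Proof. by move=> P0; rewrite /utr /csum big1 // => k _; rewrite big1 // => p _; rewrite big1. Qed.

Lemma utr0 P (L : lmodType C) (Psi : mor P tunit -> mor tunit P -> L) :
  (forall g, lin (Psi ^~ g)) -> (forall g : mor P tunit, g = 0) -> utr Psi = 0.
Proof. by move=> Pl g0; apply: utr_eq0 => g g'; rewrite (g0 g) (lin0 (Pl _)). Qed.
End UnitObject.

Section UnitForm.
Variables (R : realType) (D : daggerMonCat R) (X : simples D) (sph : spherical X).
Hypothesis HD : unitary_multifusion D.
Variable (B : forall (k : X) (z : D), dual_bases k z).
Local Notation C := R[i].
Local Notation "x ^b" := (bar sph x) (at level 2, format "x ^b").
Local Notation d_ := (qdim sph).
Local Notation Tube := (Tube X).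
Local Notation br := (tube_bracket B).
Local Notation mul := (tube_mul B).
Local Notation dl := delta_mor.
Local Notation star := (@tube_star R D X sph).
Implicit Types (a b c e f h k l : X) (P Q x y : D).

Lemma bend_left x xb y (c : mor tunit (x ⊗ xb)) (e : mor (xb ⊗ x) tunit) (g : mor (xb ⊗ y) tunit) :
  zigzag c e -> exists g' : mor y x, g = e ∘ (idm xb ⊗m g').
Proof.
move=> zz; exists (runit x ∘ (idm x ⊗m g) ∘ assoc x xb y ∘ (c ⊗m idm y) ∘ (lunit y)^†).
strict; have E := st_nat e (st g tunit); rewrite /= in E.
by rewrite tens1M compA E -compA snake2 // comp1r.
Qed.

Lemma hom_ev a (g : mor (irr a^b ⊗ irr a) tunit) : exists s : C, g = s *: ev sph a.
Proof.
have [g' ->] := bend_left g (dual_zigzag sph a).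
by exists (sc g'); rewrite [g' in LHS]scE tensZr tensm_id compZr comp1r.
Qed.

Lemma hom_ev0 a b (g : mor (irr a^b ⊗ irr b) tunit) : a != b -> g = 0.
Proof.
move=> ab; have [g' ->] := bend_left g (dual_zigzag sph a).
by rewrite [g']hom_irr0 1?eq_sym // tens0r comp0r.
Qed.

Lemma hom_coev a (g : mor (irr a ⊗ irr a^b) tunit) : exists s : C, g = s *: (coev sph a)^†.
Proof.
have [g' ->] := bend_left g (zigzag_flip (dual_zigzag sph a)).
by exists (sc g'); rewrite [g' in LHS]scE tensZr tensm_id compZr comp1r.
Qed.

Lemma hom_coev0 a b (g : mor (irr a ⊗ irr b^b) tunit) : a != b -> g = 0.
Proof.
move=> ab; have [g' ->] := bend_left g (zigzag_flip (dual_zigzag sph a)).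
rewrite [g']hom_irr0 ?tens0r ?comp0r // eq_sym.
by apply: contra_neq ab; apply: bar_inj.
Qed.

Definition ug a (i : uidx X) : mor (irr a) (tunit : D) := uinc i ∘ dl a (uirr i).

Definition upair c e f h P Q (v : mor (irr c) (act P Q (irr e))) (w : mor (act P Q (irr f)) (irr h))
    (g : mor P tunit) (g' : mor tunit P) (q : mor Q tunit) (q' : mor tunit Q) : C^o :=
  sc (dl e c ∘ ((pd (irr e))^† ∘ tc g q (irr e) ∘ v)) *
  sc (dl h f ∘ (w ∘ (tc g' q' (irr f) ∘ pd (irr f)))).

(* The functional omega: both legs are projected to the unit, with e = c and f = h. *)
Definition uform (t : Tube) : C^o := tube_lift (fun a b c e f h v w =>
  \sum_i \sum_j upair v w (ug a i) (ug a i)^† (ug b j) (ug b j)^†) t.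

Lemma lin_uform : lin uform.
Proof. exact: lin_tube_lift. Qed.

Lemma uform_pure a b c e f h v w : uform (@tube_pure R D X a b c e f h v w) =
  \sum_i \sum_j upair v w (ug a i) (ug a i)^† (ug b j) (ug b j)^†.
Proof. by rewrite /uform tube_liftE //; split=> y; rewrite /upair; lin. Qed.

Lemma uform_bracket c e f h P Q (v : mor (irr c) (act P Q (irr e)))
    (w : mor (act P Q (irr f)) (irr h)) :
  uform (br v w) = utr B (fun g g' => utr B (fun q q' => upair v w g g' q q')).
Proof.
rewrite bracketE (csum_linE B _ lin_uform); apply: eq_csum => k d u.
rewrite (csum_linE B _ lin_uform) /utr.
rewrite -csum_bigsum; apply: eq_csum => l d' u'.
rewrite uform_pure; apply: eq_bigr => i _; apply: eq_bigr => j _.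
by rewrite /upair /ug !tcM !dag_comp !tcM !compA.
Qed.

Lemma lin_utr P (L M : lmodType C) (Psi : M -> mor P tunit -> mor tunit P -> L) :
  (forall g g', lin (fun t => Psi t g g')) -> lin (fun t => utr B (Psi t)).
Proof. by move=> Pl; apply: lin_csum => k d u; apply: lin_bigsum => i. Qed.

Lemma star_mul_pure a b c e f h v w a' b' c' e' f' h' v' w' :
  mul (star (@tube_pure R D X a' b' c' e' f' h' v' w')) (@tube_pure R D X a b c e f h v w) =
  (d_ e' / d_ c') *: br
    (ra _ _ _ _ _ ∘ (fm (irr a'^b) (irr b'^b) (v ∘ dl c' c) ∘ flat sph v'^†))
    (sharp sph w'^† ∘ fm (irr a'^b) (irr b'^b) (dl h h' ∘ w) ∘ (ra _ _ _ _ _)^†).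
Proof. by rewrite star_pure (linZ (lin_tube_mull B _)) mul_pure. Qed.

(** The weight d_e / d_c of the star cancels the factor from rotating [v]; rotating [w] leaves d_h /
    d_f, and projecting the legs a^b ⊗ a and b ⊗ b^b to the unit divides by the loops d_a and
    d_b. *)
Lemma uform_starM a b c e f h v w v' w' :
  uform (mul (star (@tube_pure R D X a b c e f h v' w')) (@tube_pure R D X a b c e f h v w)) =
  d_ h / (d_ f * d_ a * d_ b) * (sc (v'^† ∘ v) * sc (w ∘ w'^†)).
Proof.
have q0 k : d_ k != 0 by exact: qdim_neq0.
rewrite star_mul_pure (linZ lin_uform) uform_bracket.
have [j eva] := ev_norm sph a; have [i coevb] := coev_norm sph b.
have coevb' : (coev sph b)^† ∘ (coev sph b)^†^† = d_ b *: (uinc i ∘ (uinc i)^†) by rewrite dagK.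
have v_flat : sharp sph v ∘ flat sph v'^† = (pd (irr e))^† ∘ tc (ev sph a) (coev sph b)^† (irr e) ∘
    (ra _ _ _ _ _ ∘ (fm _ _ v ∘ flat sph v'^†)) by rewrite sharpE eta_dag !compA.
have w_flat : sharp sph w'^† ∘ flat sph w = sharp sph w'^† ∘ fm _ _ w ∘ (ra _ _ _ _ _)^† ∘
    (tc (ev sph a)^† (coev sph b) (irr f) ∘ pd (irr f)) by rewrite flatE /eta -lock !compA.
have [vv ww] : sc (sharp sph v ∘ flat sph v'^†) = d_ c * sc (v'^† ∘ v) / d_ e /\
    sc (sharp sph w'^† ∘ flat sph w) = d_ h * sc (w ∘ w'^†) / d_ f.
  rewrite -(sharp_flat sph HD B v v'^†) -(sharp_flat sph HD B w'^† w).
  by split; rewrite mulrC mulKf.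
rewrite (utr_rank1 B _ _ eva (q0 a) (@hom_ev a)).
- rewrite (utr_rank1 B _ _ coevb' (q0 b) (@hom_coev b)).
  + rewrite /upair !delta_id !comp1l comp1r dagK -[in LHS]v_flat -[in LHS]w_flat.
    rewrite vv ww -![_ *: _]/(_ * _); field.
    by rewrite !q0.
  + by move=> g; rewrite /upair; lin.
  + by move=> g; rewrite /upair; lin.
- by move=> g; apply: lin_utr => *; rewrite /upair; lin.
- by move=> g; apply: lin_utr => *; rewrite /upair; lin.
Qed.

End UnitForm.

(** * An orthogonal basis of the tube space *)

Section HilbertSpace.
Variables (R : realType) (D : daggerMonCat R) (X : simples D) (sph : spherical X).
Hypothesis HD : unitary_multifusion D.
Variable (B : forall (k : X) (z : D), dual_bases k z).
Hypothesis BO : forall k z p, tnth (dbd (B k z)) p = (tnth (dbv (B k z)) p)^†.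
Local Notation C := R[i].
Local Notation d_ := (qdim sph).
Local Notation Tube := (Tube X).
Local Notation mul := (tube_mul B).
Local Notation star := (@tube_star R D X sph).
Local Notation uform := (@uform R D X).
Implicit Types (a b c e f h k l : X) (P Q x y : D).

(** Distinct [c] or [h] are killed by the product, distinct [e] or [f] by the functional, and
    distinct [a] or [b] because the leg then has no morphism to the unit. *)
Lemma uform_starM_neq a b c e f h v w a' b' c' e' f' h' v' w' :
  (a', b', c', e', f', h') != (a, b, c, e, f, h) ->
  uform (mul (star (@tube_pure R D X a' b' c' e' f' h' v' w')) (@tube_pure R D X a b c e f h v w)) = 0.
Proof.
have uf0 (s : C) : s *: uform 0 = 0 by rewrite (lin0 (@lin_uform R D X)) scaler0.
rewrite star_mul_pure (linZ (@lin_uform R D X)).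
move=> ne; have [hh|hh] := eqVneq h' h; last first.
  rewrite (@delta_neq R D X h h') 1?eq_sym // comp0l tens0l tens0r comp0r comp0l.
  by rewrite (lin0 (lin_bracketr _ _)) uf0.
have [cc|cc] := eqVneq c' c; last first.
  rewrite (delta_neq cc) comp0r tens0l tens0r comp0l comp0r.
  by rewrite (lin0 (lin_bracketl _ _)) uf0.
rewrite uform_bracket.
have [aa|aa] := eqVneq a' a; last first.
  rewrite utr0 ?scaler0 // => [g|g]; last exact: hom_ev0.
  by apply: lin_utr => *; rewrite /upair; lin.
have [bb|bb] := eqVneq b' b; last first.
  rewrite utr_eq0 ?scaler0 // => g g'; rewrite utr0 // => [q|q].
    by rewrite /upair; lin.
  by apply: hom_coev0; rewrite eq_sym.
have [ee|ee] := eqVneq e' e; last first.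
  rewrite utr_eq0 ?scaler0 // => g g'; rewrite utr_eq0 // => q q'.
  by rewrite /upair (@delta_neq R D X e e') 1?eq_sym // comp0l sc0 mul0r.
have [ff|ff] := eqVneq f' f; last first.
  rewrite utr_eq0 ?scaler0 // => g g'; rewrite utr_eq0 // => q q'.
  by rewrite /upair (delta_neq ff) comp0l sc0 mulr0.
by case/eqP: ne; rewrite aa bb cc ee ff hh.
Qed.

Let VN (t : tube_idx X) : nat :=
  let: (a, b, c, e, f, h) := t in dbsize (B c (act (irr a) (irr b) (irr e))).
Let WN (t : tube_idx X) : nat :=
  let: (a, b, c, e, f, h) := t in dbsize (B h (act (irr a) (irr b) (irr f))).

Definition wt (t : tube_idx X) : C :=
  let: (a, b, c, e, f, h) := t in d_ h / (d_ f * d_ a * d_ b).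

Definition tvec (t : tube_idx X) : 'I_(VN t) -> 'I_(WN t) -> Tube :=
  let: (a, b, c, e, f, h) as t := t return 'I_(VN t) -> 'I_(WN t) -> Tube in
  fun p q => @tube_pure R D X a b c e f h (tnth (dbv (B _ _)) p) (tnth (dbd (B _ _)) q).

Definition tidx : finType := {t : tube_idx X & 'I_(VN t) * 'I_(WN t)}%type.

Definition tbas (j : tidx) : Tube :=
  tvec (tagged j).1 (tagged j).2.

(** The vectors [tbas] are orthogonal with squared norm [wt], so a coordinate is an inner product
    divided by that norm. *)
Definition tco j (t : Tube) : C := uform (mul (star (tbas j)) t) / wt (tag j).

Lemma wt_gt0 t : 0 < wt t.
Proof.
by case: t => [[[[[a b] c] e] f] h]; rewrite /wt divr_gt0 ?mulr_gt0 ?qdim_gt0.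
Qed.

Lemma tco_lin j : scalar (tco j).
Proof.
have L : lin (fun t => uform (mul (star (tbas j)) t)).
  exact: lin_comp (@lin_uform R D X) (lin_tube_mulr _ _).
move=> s x y; apply: (etrans (congr1 (fun z : C => z / wt (tag j)) (L s x y))).
by rewrite mulrDl -mulrA.
Qed.

Lemma tco_tbas i j : tco i (tbas j) = (i == j)%:R.
Proof.
case: i j => [s [p q]] [t [p' q']]; rewrite /tco /tbas /=.
have [st|st] := eqVneq s t; last first.
  rewrite -tag_eqE /tag_eq /= (negPf st) /=.
  move: s t p q p' q' st => [[[[[a b] c] e] f] h] [[[[[a' b'] c'] e'] f'] h'] p q p' q' st.
  by rewrite uform_starM_neq // mul0r.
case: t / st p' q' => p' q'; rewrite eq_Tagged /= xpair_eqE.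
case: s p q p' q' => [[[[[a b] c] e] f] h] p q p' q'.
rewrite uform_starM // mulrAC mulfV ?mul1r; last first.
  by apply: lt0r_neq0; apply: (wt_gt0 (a, b, c, e, f, h)).
rewrite -BO db_dual [tnth (dbd (B h _)) q]BO dagK BO -BO db_dual !scZ !sc_id !mulr1 -natrM mulnb.
by rewrite [q' == q]eq_sym.
Qed.

Lemma tbas_span t : t = \sum_j tco j t *: tbas j.
Proof.
move: t; apply: tube_lin_eq => [||a b c e f h v w]; first by move=> k x y.
  by apply: lin_bigsum => j; apply: lin_scalel; apply: tco_lin.
pose t0 : tube_idx X := (a, b, c, e, f, h).
pose G t (p : 'I_(VN t)) (q : 'I_(WN t)) : Tube :=
  (uform (mul (star (tvec p q)) (tube_pure v w)) / wt t) *: tvec p q.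
transitivity (\sum_t \sum_(u : 'I_(VN t) * 'I_(WN t)) G t u.1 u.2); last first.
  by rewrite (sig_big_dep xpredT (fun=> xpredT) (fun t (u : 'I_(VN t) * 'I_(WN t)) => G t u.1 u.2)).
rewrite (big_only (j := t0)) => [|[[[[[a' b'] c'] e'] f'] h'] ne]; last first.
  by rewrite big1 // => u _; rewrite /G uform_starM_neq // mul0r scale0r.
rewrite -(pair_bigA _ (G t0)).
rewrite [v in LHS](dbv_expand B) (lin_sum (lin_tube_purel w)); apply: eq_bigr => p _.
rewrite (linZ (lin_tube_purel w)).
rewrite [w in LHS](dbd_expand B) (lin_sum (lin_tube_purer _)) scaler_sumr.
apply: eq_bigr => q _; rewrite (linZ (lin_tube_purer _)) scalerA; congr (_ *: _).
rewrite uform_starM // mulrAC mulfV ?mul1r.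
  by rewrite -BO [tnth (dbd (B h _)) q]BO dagK.
by apply: lt0r_neq0; apply: (wt_gt0 t0).
Qed.
End HilbertSpace.

(** * The weak Hopf structure and its faithful representation *)

Section CstarStructure.
Variables (R : realType) (D : daggerMonCat R) (X : simples D) (sph : spherical X).
Hypothesis HD : unitary_multifusion D.
Variable (B : forall (k : X) (z : D), dual_bases k z).
Local Notation Tube := (Tube X).
Local Notation mul := (tube_mul B).
Local Notation star := (@tube_star R D X sph).
Local Notation uform := (@uform R D X).

Lemma tube_weak_hopf : weak_hopf_algebra (tube_wha sph B).
Proof.
constructor.
- exact: lin_tube_mull.
- exact: lin_tube_mulr.
- exact: tube_mulA.
- exact: tube_mul1l.
- exact: tube_mul1r.
- exact: lin_comul.
- exact: lin_counit.
- exact: lin_antipode.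
- exact: tube_comulA.
- exact: tube_counitl.
- exact: tube_counitr.
- exact: tube_comulM.
- exact: tube_comul1l.
- exact: tube_comul1r.
- exact: tube_counitM.
- exact: tube_counitMop.
- exact: tube_antipoder.
- exact: tube_antipodel.
- exact: tube_antipode3.
Qed.

Hypothesis BO : forall k z p, tnth (dbd (B k z)) p = (tnth (dbv (B k z)) p)^†.

Lemma tube_star_weak_hopf : star_weak_hopf_algebra (tube_wha sph B) star.
Proof.
constructor.
- exact: tube_weak_hopf.
- exact: slin_star.
- exact: tube_starK sph B.
- by move=> x y; exact (tube_starM sph HD BO x y).
- by move=> x; exact (tube_star_comul sph HD BO x).
Qed.

Let w0 (j : tidx B) : 0 < wt sph (tag j) := wt_gt0 sph (tag j).
Let ip (x y : Tube) := wip (fun j : tidx B => wt sph (tag j)) (tco sph (B := B)) x y.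

(** The inner product built from coordinates, for which completeness and boundedness are known, is
    the one given by the functional, for which adjoints are known. *)
Let ipE x y : ip x y = uform (mul (star y) x).
Proof.
rewrite [y in RHS](tbas_span sph HD BO).
have L : lin (fun t => uform (mul t x)) by exact: lin_comp (@lin_uform R D X) (lin_tube_mull _ _).
rewrite (slin_sum (slin_star sph)) (lin_sum L); apply: eq_bigr => j _.
rewrite (slinZ (slin_star sph)) (linZ L) [_ *: _]mulrC mulrA; congr (_ * _).
by rewrite /tco mulrC divfK // gt_eqF.
Qed.

Definition tube_hilbert : hilbertSpace R :=
  fin_hilbert w0 (tco_lin sph (B := B)) (tco_tbas sph HD BO) (tbas_span sph HD BO).

Lemma tube_cstar : cstar_weak_hopf_algebra (tube_wha sph B) star.
Proof.
split; first exact: tube_star_weak_hopf.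
exists tube_hilbert, (fun x u => mul x u); constructor.
- exact: lin_tube_mulr.
- by move=> x; apply: (wip_bounded w0 (tco_lin sph (B := B)) (tbas_span sph HD BO)); apply: lin_tube_mulr.
- exact: lin_tube_mull.
- by move=> x y u; rewrite (tube_mulA HD B x y u).
- exact: tube_mul1l.
- move=> x u v.
  have E : mul (star (mul (star x) v)) u = mul (star v) (mul x u).
    apply: (etrans (congr1 (fun t => mul t u) (tube_starM sph HD BO (star x) v))).
    rewrite [star (star x)](tube_starK sph B x).
    exact: (esym (tube_mulA HD B (star v) x u)).
  exact: (etrans (ipE (mul x u) v) (esym (etrans (ipE u (mul (star x) v)) (congr1 uform E)))).
(* The unit is a vector of the representation space, and [x] is recovered from its action on it. *)
- by move=> x x0; rewrite -[x](tube_mul1r HD B) [LHS]x0.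
Qed.
End CstarStructure.

Theorem proposition10 (R : realType) (D : daggerMonCat R)
    (HD : unitary_multifusion D) (X : simples D) (sph : spherical X)
    (B : forall (k : X) (z : D), dual_bases k z) :
  cstar_weak_hopf_algebra (tube_wha sph B) (@tube_star R D X sph).
Proof.
have [B0 BO] := orthonormal_bases X HD.
rewrite (tube_wha_indep sph HD B B0); exact (tube_cstar sph HD BO).
Qed.
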